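(* Suppose that $\mu=\otimes_{k\in\mathcal K}\mu_k$ is a product of $K$ independent univariate distributions of the form $\mu_k=\sum_{l\in\mathcal L}\mu_k^l\delta_{x_k^l}$, that $\nu_t=t\delta_{\boldsymbol y_1}+(1-t)\delta_{\boldsymbol y_2}$ is a two-point distribution with $t\in[0,1]$, that $c(\boldsymbol x,\boldsymbol y)=\|\boldsymbol x-\boldsymbol y\|^2$, and that $\mathcal M=\{x_k^l(y_{1,k}-y_{2,k}) : k\in\mathcal K,\ l\in\mathcal L\}$ spans a regular one-dimensional grid $\mathcal N$ with (known) cardinality. If in addition $L=2$, $x_k^1=0$ and $x_k^2=1$ for all $k\in\mathcal K$, and $\boldsymbol y_1,\boldsymbol y_2\in\{0,1\}^K$, then the optimal transport distance $W_c(\mu,\nu_t)$ can be computed in strongly polynomial time.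
   Context: $\mathcal K=\{1,\dots,K\}$, $\mathcal L=\{1,\dots,L\}$; $x_k^l\in\mathbb R$ are the support points and $\mu_k^l\ge0$, $\sum_l\mu_k^l=1$, the probabilities of the marginal $\mu_k$. $y_{j,k}$ is the $k$-th coordinate of $\boldsymbol y_j$. $\|\cdot\|$ is the Euclidean norm. The input consists of the numbers $x_k^l$, $\mu_k^l$, $\boldsymbol y_1$, $\boldsymbol y_2$, $t$; all of them are rational, encoded as ratios of two integers in binary. The atoms of $\mu$ are not enumerated in the input. For discrete distributions $\mu=\sum_i\mu_i\delta_{\boldsymbol x_i}$ and $\nu=\sum_j\nu_j\delta_{\boldsymbol y_j}$ on $\mathbb R^K$, the optimal transport distance is $W_c(\mu,\nu)=\min_{\boldsymbol\pi}\sum_{i,j}c(\boldsymbol x_i,\boldsymbol y_j)\pi_{ij}$, with the minimum over all nonnegative matrices $\boldsymbol\pi$ with row sums $\mu_i$ and column sums $\nu_j$. A set $\mathcal N\subseteq\mathbb R$ is a one-dimensional regular grid with cardinality $N$ if there exist $\hat s_1,\dots,\hat s_N\in\mathbb R$ and $d>0$ such that $\hat s_{i+1}=\hat s_i+d$ for all $i=1,\dots,N-1$ and $\mathcal N=\{\hat s_1,\dots,\hat s_N\}$. A set $\mathcal M\subseteq\mathbb R$ spans $\mathcal N$ if $\mathcal M\subseteq\mathcal N$, $\min\mathcal M=\min\mathcal N$ and $\max\mathcal M=\max\mathcal N$. An algorithm runs in strongly polynomial time if it computes $W_c(\mu,\nu_t)$ in time (on a Turing machine) polynomial in the bit length of the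 input and if, in addition, it requires a number of arithmetic operations that grows at most polynomially with the dimension of the input (i.e., the number of input numbers). *)

(* Defs.v *)
From mathcomp Require Import all_boot all_order all_algebra.
From mathcomp Require Import classical_sets reals.

Set Implicit Arguments.
Unset Strict Implicit.
Unset Printing Implicit Defensive.

Import Order.TTheory GRing.Theory Num.Theory.
Local Open Scope ring_scope.

(* \sum_(i : I) weight i * delta_(atom i); the atoms need not be distinct. *)
Record ddist (R : realType) (I : finType) (T : Type) :=
  DDist { atom : I -> T; weight : I -> R }.

(* I enumerates all choices of one atom per factor. *)
Definition product_dist (R : realType) (K L : nat)
    (mu : 'I_K -> ddist R 'I_L R) : ddist R {ffun 'I_K -> 'I_L} 'rV[R]_K :=
  DDist (fun i : {ffun 'I_K -> 'I_L} => \row_k atom (mu k) (i k))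
        (fun i : {ffun 'I_K -> 'I_L} => \prod_k weight (mu k) (i k)).

Definition two_point (R : realType) (K : nat) (t : R) (y1 y2 : 'rV[R]_K) :
    ddist R bool 'rV[R]_K :=
  DDist (fun b => if b then y1 else y2) (fun b => if b then t else 1 - t).

Definition coupling (R : realType) (I J : finType) (T : Type)
    (mu : ddist R I T) (nu : ddist R J T) (pi : I -> J -> R) : Prop :=
  [/\ forall i j, 0 <= pi i j,
      forall i, \sum_j pi i j = weight mu i
    & forall j, \sum_i pi i j = weight nu j].

Definition transport_cost (R : realType) (I J : finType) (T : Type)
    (c : T -> T -> R) (mu : ddist R I T) (nu : ddist R J T)
    (pi : I -> J -> R) : R :=
  \sum_i \sum_j c (atom mu i) (atom nu j) * pi i j.

(* w is the minimum (attained) of the transport cost: w = W_c(mu, nu). *)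
Definition is_ot_distance (R : realType) (I J : finType) (T : Type)
    (c : T -> T -> R) (mu : ddist R I T) (nu : ddist R J T) (w : R) : Prop :=
  (exists2 pi, coupling mu nu pi & w = transport_cost c mu nu pi) /\
  (forall pi, coupling mu nu pi -> w <= transport_cost c mu nu pi).

Definition enorm (R : realType) (n : nat) (v : 'rV[R]_n) : R :=
  Num.sqrt (\sum_i v 0 i ^+ 2).

Definition sq_dist (R : realType) (n : nat) (x y : 'rV[R]_n) : R :=
  enorm (x - y) ^+ 2.

Definition regular_grid (R : realType) (n : nat) (N : set R) : Prop :=
  exists (s : 'I_n -> R) (d : R),
    [/\ 0 < d,
        forall i j : 'I_n, nat_of_ord j = i.+1 -> s j = s i + d
      & forall z, N z <-> exists i, z = s i].

Definition is_minimum (R : realType) (A : set R) (a : R) : Prop :=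
  A a /\ forall z, A z -> a <= z.

Definition is_maximum (R : realType) (A : set R) (a : R) : Prop :=
  A a /\ forall z, A z -> z <= a.

Definition spans (R : realType) (M N : set R) : Prop :=
  [/\ forall z, M z -> N z,
      exists a, is_minimum M a /\ is_minimum N a
    & exists b, is_maximum M b /\ is_maximum N b].

Record instance := Instance {
  dimK : nat;
  dimL : nat;
  supp : 'M[rat]_(dimK, dimL);
  prob : 'M[rat]_(dimK, dimL);
  pt1 : 'rV[rat]_dimK;
  pt2 : 'rV[rat]_dimK;
  mass : rat }.

(* For fixed dimL, the length of this sequence determines dimK. *)
Definition input_numbers (a : instance) : seq rat :=
  [seq supp a k l | k <- enum 'I_(dimK a), l <- enum 'I_(dimL a)] ++
  [seq prob a k l | k <- enum 'I_(dimK a), l <- enum 'I_(dimL a)] ++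
  [seq pt1 a 0 k | k <- enum 'I_(dimK a)] ++
  [seq pt2 a 0 k | k <- enum 'I_(dimK a)] ++ [:: mass a].

Definition well_formed (a : instance) : Prop :=
  [/\ forall k l, 0 <= prob a k l,
      forall k, \sum_l prob a k l = 1
    & 0 <= mass a <= 1].

Definition marginal (R : realType) (a : instance) (k : 'I_(dimK a)) :
    ddist R 'I_(dimL a) R :=
  DDist (fun l => ratr (supp a k l)) (fun l => ratr (prob a k l)).

Definition mu_of (R : realType) (a : instance) :=
  product_dist (@marginal R a).

Definition nu_of (R : realType) (a : instance) :=
  two_point (ratr (mass a) : R) (map_mx ratr (pt1 a)) (map_mx ratr (pt2 a)).

Definition M_of (R : realType) (a : instance) : set R :=
  fun z => exists k l,
    z = ratr (supp a k l) * (ratr (pt1 a 0 k) - ratr (pt2 a 0 k)).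

Inductive sym := Bit of bool | Minus | Slash | Comma.

(* Sign (true is negative) and digits, most significant first. *)
Definition numeral : Type := (bool * seq bool)%type.

Definition numeral_value (z : numeral) : int :=
  (-1) ^+ z.1 * (foldl (fun (n : nat) (b : bool) => b + n.*2)%N 0%N z.2)%:Z.

Definition numeral_word (z : numeral) : seq sym :=
  (if z.1 then [:: Minus] else [::]) ++ map Bit z.2.

Definition ratio : Type := (numeral * numeral)%type.

Definition proper_ratio (r : ratio) : bool :=
  [&& r.1.2 != [::], r.2.2 != [::] & numeral_value r.2 != 0].

Definition ratio_value (r : ratio) : rat :=
  (numeral_value r.1)%:~R / (numeral_value r.2)%:~R.

Definition ratio_word (r : ratio) : seq sym :=
  numeral_word r.1 ++ Slash :: numeral_word r.2.

(* The word w writes the numbers of s as ratios of binary integers, each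
   followed by a comma.  Fractions need not be reduced and leading zeros are
   allowed, so a sequence has many encodings; the bit length is that of w. *)
Definition encodes (w : seq sym) (s : seq rat) : Prop :=
  exists rs : seq ratio,
    [/\ all proper_ratio rs,
        s = map ratio_value rs
      & w = flatten [seq rcons (ratio_word r) Comma | r <- rs]].

Inductive move := MoveL | MoveN | MoveR.

(* None is the blank symbol. *)
Definition cell (work : finType) : Type := option (sym + work).

(* Tape 0 is the input tape, the last tape is the output tape. *)
Record tm := TM {
  extra_tapes : nat;
  tm_state : finType;
  tm_work : finType;
  tm_start : tm_state;
  tm_final : pred tm_state;
  tm_delta : tm_state -> {ffun 'I_extra_tapes.+2 -> cell tm_work} ->
             tm_state * {ffun 'I_extra_tapes.+2 -> cell tm_work * move} }.

(* Cells left of the head, nearest first, and cells from the head on; all cells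
   beyond the two sequences are blank. *)
Definition tape (work : finType) : Type :=
  (seq (cell work) * seq (cell work))%type.

Definition tape_read (work : finType) (tp : tape work) : cell work :=
  head None tp.2.

Definition tape_act (work : finType) (a : cell work * move) (tp : tape work) :
    tape work :=
  match a.2 with
  | MoveL => (behead tp.1, head None tp.1 :: a.1 :: behead tp.2)
  | MoveN => (tp.1, a.1 :: behead tp.2)
  | MoveR => (a.1 :: tp.1, behead tp.2)
  end.

(* The tape contains exactly w, with the head on its first symbol. *)
Definition tape_holds (work : finType) (tp : tape work) (w : seq sym) : Prop :=
  exists m n, tp = (nseq m None, [seq Some (inl s) | s <- w] ++ nseq n None).

Definition tm_conf (M : tm) : Type :=
  (tm_state M * {ffun 'I_(extra_tapes M).+2 -> tape (tm_work M)})%type.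

Definition tm_init (M : tm) (w : seq sym) : tm_conf M :=
  (tm_start M,
   [ffun i => if i == ord0 then ([::], [seq Some (inl s) | s <- w])
              else ([::], [::])]).

Definition tm_step (M : tm) (c : tm_conf M) : tm_conf M :=
  if tm_final c.1 then c else
  let qa := tm_delta c.1 [ffun i => tape_read (c.2 i)] in
  (qa.1, [ffun i => tape_act (qa.2 i) (c.2 i)]).

Definition tm_run (M : tm) (w : seq sym) (t : nat) : tm_conf M :=
  iter t (@tm_step M) (tm_init M w).

(* A random access machine whose memory cells hold rationals and can only be
   accessed by arithmetic operations and comparisons: in particular neither
   rounding nor access to numerators, denominators or digits is available.
   Cells are addressed through natural-number index registers. *)

Inductive arith := Add | Sub | Mul | Div.

(* A nat is an index register, except that the last argument of IJump and RJump
   is the jump target. *)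
Inductive instr :=
| IZero of nat
| ISucc of nat
| IPred of nat
| ICopy of nat & nat
| IJump of nat & nat & nat
| RConst of nat & rat
| ROp of arith & nat & nat & nat
| RJump of nat & nat & nat.

Definition program := seq instr.

(* Unallocated index registers and memory cells read as 0. *)
Record ram := Ram { pc : nat; idx : seq nat; cells : seq rat }.

Definition arith_fun (o : arith) (x y : rat) : rat :=
  match o with
  | Add => x + y | Sub => x - y | Mul => x * y | Div => x / y
  end.

Definition get_idx (s : ram) (i : nat) : nat := nth 0%N (idx s) i.
Definition get_mem (s : ram) (i : nat) : rat := nth 0 (cells s) (get_idx s i).
Definition put_idx (s : ram) (i n : nat) : ram :=
  Ram (pc s).+1 (set_nth 0%N (idx s) i n) (cells s).
Definition put_mem (s : ram) (i : nat) (q : rat) : ram :=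
  Ram (pc s).+1 (idx s) (set_nth 0 (cells s) (get_idx s i) q).
Definition jump_if (s : ram) (b : bool) (l : nat) : ram :=
  Ram (if b then l else (pc s).+1) (idx s) (cells s).

Definition ram_exec (o : instr) (s : ram) : ram :=
  match o with
  | IZero i => put_idx s i 0%N
  | ISucc i => put_idx s i (get_idx s i).+1
  | IPred i => put_idx s i (get_idx s i).-1
  | ICopy i j => put_idx s i (get_idx s j)
  | IJump i j l => jump_if s (get_idx s i <= get_idx s j)%N l
  | RConst i q => put_mem s i q
  | ROp o i j k => put_mem s i (arith_fun o (get_mem s j) (get_mem s k))
  | RJump i j l => jump_if s (get_mem s i <= get_mem s j) l
  end.

Definition ram_halted (P : program) (s : ram) : bool := (size P <= pc s)%N.

Definition ram_step (P : program) (s : ram) : ram :=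
  if ram_halted P s then s else ram_exec (nth (IZero 0%N) P (pc s)) s.

(* The input fills the memory, and index register 0 holds its length. *)
Definition ram_run (P : program) (inp : seq rat) (n : nat) : ram :=
  iter n (ram_step P) (Ram 0%N [:: size inp] inp).

(* The Turing machine M, started on w, carries out the first n steps of the
   arithmetic program P: at increasing times tau 0, ..., tau n <= T, its input
   tape contains the memory of P after 0, ..., n steps in binary. *)
Definition executes (M : tm) (w : seq sym) (T : nat)
    (P : program) (inp : seq rat) (n : nat) : Prop :=
  exists tau : nat -> nat,
    [/\ forall i, (tau i < tau i.+1)%N, (tau n <= T)%N
      & forall i, (i <= n)%N -> exists2 v,
          encodes v (cells (ram_run P inp i))
          & tape_holds ((tm_run M w (tau i)).2 ord0) v].

(* One algorithm, given as an arithmetic program P together with a Turing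
   machine M executing it, solves all instances satisfying the promise.  The
   number of instructions of P (arithmetic operations, and also index
   operations and jumps) is polynomial in the number of input numbers, and the
   running time of M is polynomial in the length of the binary input. *)
Definition strongly_polynomial (I : Type) (numbers : I -> seq rat)
    (promise : I -> Prop) (answer : I -> rat -> Prop) : Prop :=
  exists (P : program) (M : tm) (c d : nat),
    forall a, promise a -> forall w, encodes w (numbers a) ->
    exists (n T : nat) (r : rat),
      [/\ answer a r,
          (n <= c * size (numbers a) ^ d + c)%N /\
          (T <= c * size w ^ d + c)%N,
          ram_halted P (ram_run P (numbers a) n) /\
          nth 0 (cells (ram_run P (numbers a) n)) 0%N = r,
          tm_final (tm_run M w T).1 /\
          (exists2 v, encodes v [:: r]
                    & tape_holds ((tm_run M w T).2 ord_max) v)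
        & executes M w T P (numbers a) n].

(* Main.v *)
Require Import Defs.
From mathcomp Require Import all_boot all_order all_algebra.
From mathcomp Require Import classical_sets reals.
From mathcomp Require Import zify ring lra boolp.

Set Implicit Arguments.
Unset Strict Implicit.
Unset Printing Implicit Defensive.

Import Order.TTheory GRing.Theory Num.Theory.

(** The promise makes the problem one-dimensional. The points [x], [y1], [y2]
    are 0-1 vectors, so both costs count coordinates. Let [m] be the number of
    coordinates on which [y1] and [y2] differ, [G(x)] the number of those on
    which [x] agrees with [y2], and [u(x)] the number of coordinates on which
    [y1] and [y2] agree but [x] deviates from them. Then
    [c(x, y1) = u(x) + G(x)] and [c(x, y2) = u(x) + m - G(x)]. Put
    [F(j) = P(G <= j)] and cut the cost into layers [j < m]: a coupling pays, in
    layer [j], the mass above [j] sent to [y1] plus the mass up to [j] sent to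
    [y2]. The difference of the two is [t - F(j)], so every coupling pays at
    least [|F(j) - t|], and the coupling that fills [y1] with the atoms of
    smallest [G] pays exactly this in all layers at once. Hence
    [W = E u + \sum_(j < m) |F(j) - t|] ([two_point_ot]). As [G] is a sum of
    independent Bernoulli variables with parameters [q_k = P(x_k = y2_k)], its
    generating polynomial is the product of the [(1 - q_k) + q_k X], and [F] is
    the last row of the table
    [F_(k+1)(j) = (1 - q_k) F_k(j) + q_k F_k(j-1)] ([cdfE]). The arithmetic
    program overwrites the rows of this table in place, which takes quadratically
    many instructions ([ot_program_correct]).

    The Turing machine computes with unreduced fractions, and two observations
    keep these short. All numbers that occur are nonnegative, so signs can be
    dropped when the input is read. All entries of a row have the same
    denominator, the product of the denominators of the [q_k], provided that
    [1 - q_k] is computed from [q_k]; hence the addition in the recursion can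
    leave the denominator alone ([OAddSame]). With cross-multiplication the
    lengths would double from row to row; with a common denominator they grow
    linearly. Cross-multiplication is used only along one chain of additions of
    numbers of bounded length, which again adds lengths.

    The machine itself is written in a small language of programs on stacks of
    input symbols, each tape being one stack ([compile_ok]). One loop executes
    one arithmetic instruction per round ([run_block], [run_body]); the moments
    at which its condition is tested are those at which the input tape has to
    hold the memory ([loop_trace], [simulation]). Fractions are only an encoding
    of the rational memory as long as subtractions do not borrow and denominators
    declared equal are equal; these conditions are collected in [step_ok], and
    [simulation_executes] turns an execution that respects them into the
    execution that strong polynomiality asks for. *)

(** * Programs on stacks and their compilation *)

Definition stacks := nat -> seq sym.
Definition view := nat -> option sym.

Definition upd (s : stacks) (i : nat) (v : seq sym) : stacks :=
  fun x => if x == i then v else s x.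

Definition tops (s : stacks) : view := fun i => ohead (s i).

Inductive cmd :=
| Skip
| Push of nat & (view -> sym)
| Pop of nat
| Seq of cmd & cmd
| If of (view -> bool) & cmd & cmd
| While of (view -> bool) & cmd.

(** The natural number is the exact number of machine steps. A pushed symbol is
    computed from the view in which the receiving stack looks empty: to push, the
    head first moves left onto a blank cell, and only then is the symbol
    written. *)
Inductive exec : cmd -> stacks -> nat -> stacks -> Prop :=
| ESkip s : exec Skip s 0 s
| EPush i f s :
    exec (Push i f) s 2 (upd s i (f (tops (upd s i [::])) :: s i))
| EPop i s : exec (Pop i) s 1 (upd s i (behead (s i)))
| ESeq c1 c2 s t1 s1 t2 s2 :
    exec c1 s t1 s1 -> exec c2 s1 t2 s2 -> exec (Seq c1 c2) s (t1 + t2) s2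
| EIfT (b : view -> bool) c1 c2 s t s' :
    b (tops s) -> exec c1 s t s' -> exec (If b c1 c2) s (1 + t + 1) s'
| EIfF (b : view -> bool) c1 c2 s t s' :
    ~~ b (tops s) -> exec c2 s t s' -> exec (If b c1 c2) s (1 + t) s'
| EWhileF (b : view -> bool) c s : ~~ b (tops s) -> exec (While b c) s 1 s
| EWhileT (b : view -> bool) c s t1 s1 t2 s2 :
    b (tops s) -> exec c s t1 s1 -> exec (While b c) s1 t2 s2 ->
    exec (While b c) s (1 + t1 + 1 + t2) s2.

Inductive fop :=
| FLeft of nat
| FWrite of nat & (view -> sym)
| FPop of nat
| FGoto of (view -> bool) & nat.

Fixpoint csize (c : cmd) : nat :=
  match c with
  | Skip => 0
  | Push _ _ => 2
  | Pop _ => 1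
  | Seq c1 c2 => csize c1 + csize c2
  | If _ c1 c2 => csize c1 + csize c2 + 2
  | While _ c => csize c + 2
  end.

(** The compiled conditions are negated because a jump skips what follows. *)
Fixpoint compile (b : nat) (c : cmd) : seq fop :=
  match c with
  | Skip => [::]
  | Push i f => [:: FLeft i; FWrite i f]
  | Pop i => [:: FPop i]
  | Seq c1 c2 => compile b c1 ++ compile (b + csize c1) c2
  | If t c1 c2 =>
      FGoto (fun h => ~~ t h) (b + csize c1 + 2) ::
      compile b.+1 c1 ++
      FGoto xpredT (b + (csize c1 + csize c2 + 2)) :: compile (b + csize c1 + 2) c2
  | While t c =>
      FGoto (fun h => ~~ t h) (b + (csize c + 2)) ::
      compile b.+1 c ++ [:: FGoto xpredT b]
  end.

Fixpoint stacks_below (n : nat) (c : cmd) : bool :=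
  match c with
  | Skip => true
  | Push i _ | Pop i => i < n
  | Seq c1 c2 | If _ c1 c2 => stacks_below n c1 && stacks_below n c2
  | While _ c => stacks_below n c
  end.

Lemma size_comp b c : size (compile b c) = csize c.
Proof.
elim: c b => //= [c1 IH1 c2 IH2|t c1 IH1 c2 IH2|t c IH] b.
- by rewrite size_cat IH1 IH2.
- by rewrite size_cat /= IH1 IH2; lia.
- by rewrite size_cat /= IH; lia.
Qed.

Section Machine.

Variables (N : nat) (code : seq fop).

Local Notation reads := {ffun 'I_N.+2 -> cell void}.

Definition view_of (rd : reads) : view :=
  fun i => if insub i is Some o then
             if rd o is Some (inl a) then Some a else None
           else None.

Definition act_on (rd : reads) (i : nat) (a : cell void -> cell void * move) :
    {ffun 'I_N.+2 -> cell void * move} :=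
  [ffun o => if val o == i then a (rd o) else (rd o, MoveN)].

Definition machine_delta (q : 'I_(size code).+1) (rd : reads) :
    'I_(size code).+1 * {ffun 'I_N.+2 -> cell void * move} :=
  match nth (FPop 0) code q with
  | FLeft i => (inord q.+1, act_on rd i (fun x => (x, MoveL)))
  | FWrite i f =>
      (inord q.+1, act_on rd i (fun _ => (Some (inl (f (view_of rd))), MoveN)))
  | FPop i => (inord q.+1, act_on rd i (fun _ => (None, MoveR)))
  | FGoto t l =>
      (inord (if t (view_of rd) then l else q.+1), [ffun o => (rd o, MoveN)])
  end.

Definition machine : tm :=
  @TM N 'I_(size code).+1 void (inord 0)
      (fun q => q == size code :> nat) machine_delta.

(** Tapes that differ in trailing blanks are indistinguishable to a machine, and
    a head that rests beyond the represented part adds a blank to it. Stripped tapes are canonical representatives, and the operations on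
    tapes commute with stripping. *)
Definition ccons (x : cell void) (s : seq (cell void)) :=
  if x is None then if s is [::] then [::] else x :: s else x :: s.

Definition strip (s : seq (cell void)) := foldr ccons [::] s.

Definition lit (w : seq sym) : seq (cell void) := [seq Some (inl a) | a <- w].

Lemma strip_lit w : strip (lit w) = lit w.
Proof. by elim: w => //= a w ->. Qed.

Lemma head_strip s : head None (strip s) = head None s.
Proof. by case: s => //= -[x|] s //=; case: (strip s). Qed.

Lemma strip_behead s : strip (behead s) = behead (strip s).
Proof. by case: s => //= -[x|] s //=; case: (strip s). Qed.

Lemma stripP s w : strip s = lit w -> exists n, s = lit w ++ nseq n None.
Proof.
elim: s w => [|x s IH] w /=; first by case: w => // _; exists 0.
case: x => [x|] /=.
  by case: w => //= a w [-> /IH[n ->]]; exists n.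
case E: (strip s) => [|y r]; last by case: w.
case: w => // _; have [n ->] := IH [::] E.
by exists n.+1.
Qed.

(** A stack lies on its tape with the top under the head and with nothing but
    blanks to the left, so that the stack on the input tape is the word this tape
    contains. *)
Definition holds (s : stacks) (tp : {ffun 'I_N.+2 -> tape void}) : Prop :=
  (forall o : 'I_N.+2, strip (tp o).1 = [::] /\ strip (tp o).2 = lit (s o)) /\
  (forall i, N.+2 <= i -> s i = [::]).

Lemma view_of_holds s tp : holds s tp ->
  view_of [ffun o => tape_read (tp o)] = tops s.
Proof.
move=> [H H']; apply: funext => i; rewrite /view_of /tops.
case: insubP => [o _ <-|]; last by rewrite -leqNgt => /H' ->.
rewrite ffunE /tape_read -head_strip (H o).2.
by case: (s o).
Qed.

Definition at_ (l : nat) (s : stacks) (c : tm_conf machine) : Prop :=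
  c.1 = l :> nat /\ holds s c.2.

Lemma strip_eta (tp : tape void) :
  ccons (tape_read tp) (strip (behead tp.2)) = strip tp.2.
Proof. by case: tp => l [|x r]. Qed.

Definition code_at (b : nat) (cs : seq fop) : Prop :=
  b + size cs <= size code /\
  forall i, i < size cs -> nth (FPop 0) code (b + i) = nth (FPop 0) cs i.

Lemma code_at_cat b c1 c2 : code_at b (c1 ++ c2) ->
  code_at b c1 /\ code_at (b + size c1) c2.
Proof.
rewrite /code_at size_cat => -[Hs H]; split; split; first by lia.
- by move=> i Hi; rewrite H ?nth_cat ?Hi //; lia.
- by lia.
- move=> i Hi; rewrite -addnA H ?nth_cat; last by lia.
  by rewrite ltnNge leq_addr /= addKn.
Qed.

Lemma code_at_cons b f cs : code_at b (f :: cs) ->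
  [/\ b < size code, nth (FPop 0) code b = f & code_at b.+1 cs].
Proof.
rewrite -cat1s => /code_at_cat[[H1 H2]]; rewrite /= addn1 => H3; split => //.
  by move: H1; rewrite /=; lia.
by have := H2 0 isT; rewrite addn0.
Qed.

Lemma goto_ok b t l s c : l <= size code -> b < size code ->
  nth (FPop 0) code b = FGoto t l -> at_ b s c ->
  at_ (if t (tops s) then l else b.+1) s (tm_step c).
Proof.
move=> Hl Hb Hn [Hc H]; rewrite /at_ /tm_step /= Hc ltn_eqF //.
rewrite /machine_delta Hc Hn (view_of_holds H) /= inordK; last by case: ifP; lia.
split=> //; case: H => H H'; split=> // o.
by rewrite !ffunE /= strip_eta (H o).1 (H o).2.
Qed.

Lemma pop_ok b i s c : i < N.+2 -> b < size code ->
  nth (FPop 0) code b = FPop i -> at_ b s c ->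
  at_ b.+1 (upd s i (behead (s i))) (tm_step c).
Proof.
move=> Hi Hb Hn [Hc H]; rewrite /at_ /tm_step /= Hc ltn_eqF //.
rewrite /machine_delta Hc Hn /= inordK; last by lia.
split=> //; case: H => H H'; split=> [o|j Hj].
  rewrite !ffunE /upd /=; case: eqP => [Eo|_] /=; last first.
    by rewrite strip_eta (H o).1 (H o).2.
  rewrite (H o).1; split => //.
  by rewrite strip_behead (H o).2 Eo; case: (s i).
by rewrite /upd; case: eqP => [E|_]; [lia|exact: H'].
Qed.

Lemma push_ok b i f s c : i < N.+2 -> code_at b [:: FLeft i; FWrite i f] ->
  at_ b s c ->
  at_ b.+2 (upd s i (f (tops (upd s i [::])) :: s i)) (iter 2 (@tm_step _) c).
Proof.
move=> Hi /code_at_cons[Hb Hn /code_at_cons[Hb1 Hn1 _]] [Hc H].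
set c1 := tm_step c.
have Hc1 : c1.1 = b.+1 :> nat.
  rewrite /c1 /tm_step /= Hc ltn_eqF //.
  by rewrite /machine_delta Hc Hn /= inordK //; lia.
have Hv : view_of [ffun o => tape_read (c1.2 o)] = tops (upd s i [::]).
  apply: funext => j; rewrite /view_of /tops.
  case: insubP => [o _ <-|]; last first.
    by rewrite -leqNgt => Hj; rewrite /upd; case: eqP => // _; rewrite H.2.
  rewrite ffunE /c1 /tm_step /= Hc ltn_eqF // /machine_delta Hc Hn /= !ffunE.
  rewrite /upd; case: eqP => [Eo|_] /=.
    rewrite /tape_read /=; case: (H) => /(_ o)[Hl _] _.
    by move: Hl; rewrite -head_strip => ->.
  rewrite /tape_read /=.
  have -> : head None (c.2 o).2 = head None (lit (s o)).
    by rewrite -(H.1 o).2 head_strip.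
  by case: (s o).
rewrite /= -/c1 /at_ /tm_step /= Hc1 ltn_eqF //.
rewrite /machine_delta Hc1 Hn1 /= inordK; last by lia.
split=> //; split=> [o|j Hj]; last first.
  by rewrite /upd; case: eqP => [E|_]; [lia|exact: H.2].
rewrite !ffunE Hv /upd; case: (val o =P i) => [Eo|no] /=; last first.
  rewrite strip_eta /c1 /tm_step /= Hc ltn_eqF // /machine_delta Hc Hn /= !ffunE.
  case: eqP => [/no//|_] /=; rewrite strip_eta; exact: (H.1 o).
rewrite /c1 /tm_step /= Hc ltn_eqF // /machine_delta Hc Hn /= !ffunE Eo eqxx /=.
by rewrite strip_behead (H.1 o).1 strip_eta (H.1 o).2 Eo.
Qed.

(** One round of a loop. The correctness of the body is a premise because the
    lemma is needed twice: inside the induction that proves this correctness, and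
    for the rounds of the outermost loop. *)
Lemma while_iter p c s t s' b x :
  code_at b (compile b (While p c)) -> p (tops s) ->
  (code_at b.+1 (compile b.+1 c) -> forall y,
     at_ b.+1 s y -> at_ (b.+1 + csize c) s' (iter t (@tm_step _) y)) ->
  at_ b s x -> at_ b s' (iter t.+2 (@tm_step _) x).
Proof.
move=> Hc Hp IH Hx; have [Hle _] := Hc; case/code_at_cons: Hc => Hb Hn.
move=> /code_at_cat[H1 /code_at_cons[Hb' Hn' _]].
rewrite /= size_cat /= !size_comp in Hle; rewrite size_comp in Hb' Hn'.
have Hx1 : at_ b.+1 s (tm_step x).
  by have := goto_ok _ Hb Hn Hx; rewrite Hp /=; apply; lia.
rewrite iterS iterSr.
have := goto_ok _ Hb' Hn' (IH H1 _ Hx1) => /=.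
by apply; lia.
Qed.

(** The configurations are related only before and after a command: in the
    middle of a push the head is off its stack. *)
Lemma compile_ok c s t s' : exec c s t s' -> stacks_below N.+2 c ->
  forall b x, code_at b (compile b c) -> at_ b s x ->
  at_ (b + csize c) s' (iter t (@tm_step _) x).
Proof.
elim=> {c s t s'}.
- by move=> s _ b x _; rewrite addn0.
- by move=> i f s /= Hi b x Hc Hx; rewrite addn2; apply: push_ok.
- move=> i s /= Hi b x /code_at_cons[Hb Hn _] Hx; rewrite addn1.
  exact: pop_ok Hx.
- move=> c1 c2 s t1 s1 t2 s2 _ IH1 _ IH2 W b x; have /andP[W1 W2] : stacks_below N.+2 c1 && stacks_below N.+2 c2 by [].
  move=> /code_at_cat[H1 H2] Hx; rewrite (addnC t1) iterD /= addnA.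
  by rewrite size_comp in H2; apply: IH2 => //; apply: IH1.
- move=> p c1 c2 s t s' Hp _ IH W b x; have /andP[W1 W2] : stacks_below N.+2 c1 && stacks_below N.+2 c2 by [].
  move=> Hc Hx; have [Hle _] := Hc; case/code_at_cons: Hc => Hb Hn.
  move=> /code_at_cat[H1 /code_at_cons[Hb' Hn' _]].
  rewrite /= size_cat /= !size_comp in Hle; rewrite size_comp in Hb' Hn'.
  have Hx1 : at_ b.+1 s (tm_step x).
    by have := goto_ok _ Hb Hn Hx; rewrite Hp /=; apply; lia.
  have -> : 1 + t + 1 = t.+2 by lia.
  rewrite iterS iterSr.
  have := goto_ok _ Hb' Hn' (IH W1 _ _ H1 Hx1) => /=.
  by apply; lia.
- move=> p c1 c2 s t s' Hp _ IH W b x; have /andP[W1 W2] : stacks_below N.+2 c1 && stacks_below N.+2 c2 by [].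
  move=> Hc Hx; have [Hle _] := Hc; case/code_at_cons: Hc => Hb Hn.
  move=> /code_at_cat[H1 /code_at_cons[Hb' Hn' H2]].
  rewrite /= size_cat /= !size_comp in Hle; rewrite size_comp in H2.
  have Hx1 : at_ (b + csize c1 + 2) s (tm_step x).
    by have := goto_ok _ Hb Hn Hx; rewrite Hp /=; apply; lia.
  have -> : 1 + t = t.+1 by lia.
  rewrite iterSr /=.
  have -> : b + (csize c1 + csize c2 + 2) = b + csize c1 + 2 + csize c2 by lia.
  by apply: IH => //; move: H2; congr code_at; lia.
- move=> p c s Hp /= W b x.
  move=> Hc Hx; have [Hle _] := Hc; case/code_at_cons: Hc => Hb Hn _.
  rewrite /= size_cat /= !size_comp in Hle.
  have := goto_ok _ Hb Hn Hx; rewrite Hp /=; apply; lia.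
- move=> p c s t1 s1 t2 s2 Hp _ IH1 _ IH2 W b x Hc Hx.
  have -> : 1 + t1 + 1 + t2 = t2 + t1.+2 by lia.
  rewrite iterD; apply: (IH2 W _ _ Hc); apply: (while_iter Hc Hp _ Hx) => D y.
  exact: IH1.
Qed.

End Machine.

(** Upper bounds on the time compose more easily than exact times. *)
Definition run (c : cmd) (s : stacks) (T : nat) (s' : stacks) : Prop :=
  exists2 t, t <= T & exec c s t s'.

Definition input_stacks (w : seq sym) : stacks :=
  fun i => if i == 0 then w else [::].

Lemma holds_init N code w :
  at_ (code := code) (N := N) 0 (input_stacks w) (tm_init (machine N code) w).
Proof.
split; first by rewrite /= inordK.
split=> [o|i Hi]; rewrite ?ffunE /input_stacks; last by case: eqP => // Ei; lia.
have -> : (o == ord0) = (val o == 0) by [].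
by case: eqP => _; split => //=; rewrite strip_lit.
Qed.

(** While [compile_ok] only speaks of the end of a computation, an execution of
    an arithmetic program has to show its memory after every instruction. If a
    round of the loop executes one instruction, the times at which the loop
    condition is tested do. *)
Lemma loop_trace N ini p body fin w n (S : nat -> stacks) t0 tb tf sf :
  let c := Seq ini (Seq (While p body) fin) in
  let M := machine N (compile 0 c) in
  stacks_below N.+2 c ->
  run ini (input_stacks w) t0 (S 0) ->
  (forall i, i < n -> p (tops (S i)) /\ run body (S i) tb (S i.+1)) ->
  ~~ p (tops (S n)) -> run fin (S n) tf sf ->
  exists (tau : nat -> nat) (T : nat),
    [/\ (forall i, tau i < tau i.+1), tau n <= T,
        T <= t0 + n * (tb + 2) + tf + 1,
        forall i, i <= n -> holds (S i) (tm_run M w (tau i)).2 &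
        tm_final (tm_run M w T).1 /\ holds sf (tm_run M w T).2].
Proof.
move=> c M W [ti Hti Ei] Hb Hp [tfin Htf Ef].
have [Wi Wb Wf] : [/\ stacks_below N.+2 ini, stacks_below N.+2 body &
    stacks_below N.+2 fin] by move: W; rewrite /c /= => /and3P.
have [C1 C2 C3] : [/\ code_at (compile 0 c) 0 (compile 0 ini),
    code_at (compile 0 c) (csize ini) (compile (csize ini) (While p body)) &
    code_at (compile 0 c) (csize ini + csize (While p body))
      (compile (csize ini + csize (While p body)) fin)].
  have /code_at_cat[? /code_at_cat[]] : code_at (compile 0 c) 0
    (compile 0 ini ++ compile (csize ini) (While p body) ++
     compile (csize ini + csize (While p body)) fin) by [].
  by rewrite !size_comp.
have H0 := compile_ok Ei Wi C1 (holds_init N (compile 0 c) w).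
rewrite add0n in H0.
have [t Ht] : exists t : nat -> nat, forall i, i < n ->
    t i <= tb /\ exec body (S i) (t i) (S i.+1).
  pose Q i y := i < n -> y <= tb /\ exec body (S i) y (S i.+1).
  suff /(@choice _ _ Q)[f Hf] : forall i, exists y, Q i y by exists f.
  move=> i; rewrite /Q; case: (ltnP i n) => [Hi|_]; last by exists 0.
  by have [_ [y]] := Hb i Hi; exists y.
pose tau i := ti + \sum_(j < i) ((if j < n then t j else 0) + 2).
have tauS i : tau i.+1 = tau i + (if i < n then t i else 0) + 2.
  by rewrite /tau big_ord_recr /= !addnA.
have Hat i : i <= n -> at_ (csize ini) (S i) (tm_run M w (tau i)).
  elim: i => [|i IH] Hi; first by rewrite /tau big_ord0 addn0.
  have [_ Hx] := Ht i Hi; have [Hpi _] := Hb i Hi; have {IH}Ha := IH (ltnW Hi).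
  rewrite tauS Hi /tm_run -addnA addnC iterD addn2.
  by apply: (while_iter C2 Hpi _ Ha) => D y; exact: compile_ok.
exists tau, (tau n + 1 + tfin); split.
- by move=> i; rewrite tauS; lia.
- by lia.
- suff : tau n <= ti + n * (tb + 2) by lia.
  rewrite /tau leq_add2l.
  apply: (@leq_trans (\sum_(j < n) (tb + 2))); last first.
    by rewrite sum_nat_const card_ord.
  by apply: leq_sum => i _; rewrite ltn_ord leq_add2r; have [] := Ht i (ltn_ord i).
- by move=> i /Hat[].
- have E1 := compile_ok (EWhileF body Hp) Wb C2 (Hat n (leqnn n)).
  have [E2 E3] := compile_ok Ef Wf C3 E1.
  rewrite /tm_run addnC iterD (addnC _ 1) iterD -/(tm_run _ _ _).
  split => //; apply/eqP; apply: (etrans E2).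
  by rewrite size_comp /=; lia.
Qed.

(** * Binary arithmetic on stacks *)

Declare Scope cmd_scope.
Notation "c1 ;; c2" := (Seq c1 c2) (at level 60, right associativity) : cmd_scope.
Local Open Scope cmd_scope.

Lemma run_le c s T T' s' : run c s T s' -> T <= T' -> run c s T' s'.
Proof. by case=> t Ht H HT; exists t => //; exact: leq_trans HT. Qed.

Lemma run_cast c s T T' s' s'' :
  run c s T s' -> T <= T' -> s' = s'' -> run c s T' s''.
Proof. by move=> H HT <-; exact: run_le HT. Qed.

Lemma run_skip s : run Skip s 0 s.
Proof. by exists 0 => //; constructor. Qed.

Lemma run_push i f s :
  run (Push i f) s 2 (upd s i (f (tops (upd s i [::])) :: s i)).
Proof. by exists 2 => //; constructor. Qed.

Lemma run_pop i s : run (Pop i) s 1 (upd s i (behead (s i))).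
Proof. by exists 1 => //; constructor. Qed.

Lemma run_seq c1 c2 s T1 s1 T2 s2 :
  run c1 s T1 s1 -> run c2 s1 T2 s2 -> run (Seq c1 c2) s (T1 + T2) s2.
Proof.
move=> [t1 H1 E1] [t2 H2 E2]; exists (t1 + t2); first exact: leq_add.
by econstructor; eauto.
Qed.

Lemma run_if (b : view -> bool) c1 c2 s T s' :
  run (if b (tops s) then c1 else c2) s T s' -> run (If b c1 c2) s (T + 2) s'.
Proof.
case: ifP => Hb [t Ht E].
  by exists (1 + t + 1); [lia | constructor].
by exists (1 + t); [lia | apply: EIfF => //; rewrite Hb].
Qed.

Lemma run_while0 (b : view -> bool) c s :
  ~~ b (tops s) -> run (While b c) s 1 s.
Proof. by move=> H; exists 1 => //; constructor. Qed.

Lemma run_whileS (b : view -> bool) c s T1 s1 T2 s2 :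
  b (tops s) -> run c s T1 s1 -> run (While b c) s1 T2 s2 ->
  run (While b c) s (T1 + 2 + T2) s2.
Proof.
move=> H [t1 H1 E1] [t2 H2 E2]; exists (1 + t1 + 1 + t2); first by lia.
by econstructor; eauto.
Qed.

(** Decides all comparisons of stack numbers that occur in chains of [upd],
    using the inequalities in the context. *)
Ltac updr := rewrite /upd;
  repeat match goal with |- context [?a == ?b] =>
    case: (a =P b) => ? /=; try (exfalso; lia) end.

Ltac eqst := apply: funext => ?; updr; subst; try (by []); try (exfalso; lia).

Definition filled i : view -> bool := fun h => h i.
Definition top i : view -> sym := fun h => odflt Comma (h i).
Definition bit (x : option sym) : bool := if x is Some (Bit b) then b else false.
Definition bits (l : seq bool) : seq sym := map Bit l.

Definition mv1 i j : cmd := Push j (top i) ;; Pop i.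
Definition mvall i j : cmd := While (filled i) (mv1 i j).
Definition clear i : cmd := While (filled i) (Pop i).

Lemma run_mv1 i j s a l : i != j -> s i = a :: l ->
  run (mv1 i j) s 3 (upd (upd s j (a :: s j)) i l).
Proof.
move=> Hij E; apply: run_cast; first by apply: run_seq; [exact: run_push|exact: run_pop].
  by [].
by rewrite /top /tops /upd (negPf Hij) E; eqst.
Qed.

Lemma run_mvall i j s l : i != j -> s i = l ->
  run (mvall i j) s (5 * size l + 1) (upd (upd s j (rev l ++ s j)) i [::]).
Proof.
move=> Hij; elim: l s => [|a l IH] s E.
  apply: run_cast; first by apply: run_while0; rewrite /filled /tops E.
    by [].
  by eqst.
apply: run_cast.
- apply: run_whileS; first by rewrite /filled /tops E.
    exact: run_mv1 E.
  by apply: IH; rewrite /upd eqxx.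
- by rewrite /=; lia.
- by rewrite /upd eq_sym (negPf Hij) eqxx rev_cons cat_rcons; eqst.
Qed.

Lemma run_clear i s l : s i = l ->
  run (clear i) s (3 * size l + 1) (upd s i [::]).
Proof.
elim: l s => [|a l IH] s E.
  apply: run_cast; first by apply: run_while0; rewrite /filled /tops E.
    by [].
  by eqst.
apply: run_cast.
- apply: run_whileS; first by rewrite /filled /tops E.
    exact: run_pop.
  by apply: IH; rewrite /upd eqxx E.
- by rewrite /=; lia.
- by eqst.
Qed.

Definition maj (x y z : bool) : bool := [|| x && y, x && z | y && z].

(** Digits are listed from the least significant one. The final carry becomes
    the most significant digit; after a subtraction it is the borrow. Subtraction
    has the sum digit of addition, and its borrow is the majority with the
    minuend's digit negated. *)
Fixpoint adder (sub : bool) n (c : bool) (l1 l2 : seq bool) : seq bool :=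
  if n is n'.+1 then
    let x := head false l1 in let y := head false l2 in
    (x (+) y (+) c) ::
      adder sub n' (maj (x (+) sub) y c) (behead l1) (behead l2)
  else [:: c].

Definition adds (sub : bool) (l1 l2 : seq bool) : seq bool :=
  adder sub (maxn (size l1) (size l2)) false l1 l2.

(** Horner's scheme over the digits of the multiplier, most significant digit
    first. *)
Definition mulb (a ms : seq bool) : seq bool :=
  foldl (fun acc b => if b : bool then adds false (false :: acc) a
                      else false :: acc) [::] ms.

Fixpoint bval (l : seq bool) : nat := if l is b :: l' then b + (bval l').*2 else 0.

Lemma size_adder sub n c l1 l2 : size (adder sub n c l1 l2) = n.+1.
Proof. by elim: n c l1 l2 => //= n IH c l1 l2; rewrite IH. Qed.

Lemma size_adds sub l1 l2 : size (adds sub l1 l2) = (maxn (size l1) (size l2)).+1.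
Proof. exact: size_adder. Qed.

Lemma adder_addE n c l1 l2 : size l1 <= n -> size l2 <= n ->
  bval (adder false n c l1 l2) = bval l1 + bval l2 + c.
Proof.
elim: n c l1 l2 => [|n IH] c l1 l2.
  by case: l1 l2 => [|? ?] [|? ?] //= _ _; lia.
move=> H1 H2; rewrite /= IH; first last.
- by rewrite size_behead; case: l2 H2.
- by rewrite size_behead; case: l1 H1.
rewrite addbF; case: l1 l2 c {H1 H2 IH} => [|[] l1] [|[] l2] [] /=; rewrite /maj /=; lia.
Qed.

(** The top digit is itself the borrow: the digits below it encode the
    difference modulo [2 ^ n], and the digit adds [2 ^ n] once more. *)
Lemma adder_subE n c l1 l2 : size l1 <= n -> size l2 <= n ->
  bval (adder true n c l1 l2) + bval l2 + c =
  bval l1 + (last c (adder true n c l1 l2)) * 2 ^ n.+1.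
Proof.
elim: n c l1 l2 => [|n IH] c l1 l2.
  by case: l1 l2 => [|? ?] [|? ?] //= _ _; rewrite expn1; lia.
move=> H1 H2; set c' := maj (head false l1 (+) true) (head false l2) c.
have B1 : size (behead l1) <= n by rewrite size_behead; lia.
have B2 : size (behead l2) <= n by rewrite size_behead; lia.
have := IH c' _ _ B1 B2.
rewrite /= -/c'.
have -> : last (head false l1 (+) head false l2 (+) c)
  (adder true n c' (behead l1) (behead l2)) =
  last c' (adder true n c' (behead l1) (behead l2)).
  by case: (n).
rewrite (expnS 2 n.+1) {B1 B2 H1 H2 IH}.
move: (bval (adder _ _ _ _ _)) => r; case: (last _ _); rewrite /c' {c'}.
all: case: l1 l2 c => [|[] l1] [|[] l2] [] /=; rewrite /maj /=; lia.
Qed.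

Lemma bval_adds l1 l2 : bval (adds false l1 l2) = bval l1 + bval l2.
Proof. by rewrite adder_addE ?addn0 // ?leq_maxl ?leq_maxr. Qed.

Lemma bval_lt l : bval l < 2 ^ size l.
Proof. by elim: l => //= b l IH; rewrite expnS; case: b; lia. Qed.

Definition borrow (l1 l2 : seq bool) : bool := last false (adds true l1 l2).

Lemma borrowE l1 l2 : borrow l1 l2 = (bval l1 < bval l2).
Proof.
have := @adder_subE (maxn (size l1) (size l2)) false l1 l2.
rewrite leq_maxl leq_maxr => /(_ isT isT); rewrite -/(adds _ _ _) -/(borrow _ _) addn0.
have := bval_lt (adds true l1 l2); rewrite size_adds.
have := bval_lt l2; have : 2 ^ size l2 <= 2 ^ (maxn (size l1) (size l2)).+1.
  by rewrite leq_pexp2l // ltnW // ltnS leq_maxr.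
case: (borrow _ _); case: ltnP => //; lia.
Qed.

Lemma bval_subs l1 l2 : bval l2 <= bval l1 ->
  bval (adds true l1 l2) = bval l1 - bval l2.
Proof.
move=> H; have := @adder_subE (maxn (size l1) (size l2)) false l1 l2.
rewrite leq_maxl leq_maxr => /(_ isT isT); rewrite -/(adds _ _ _) -/(borrow _ _).
by rewrite borrowE ltnNge H /=; lia.
Qed.

Lemma bval_mulb a ms : bval (mulb a ms) = bval a * bval (rev ms).
Proof.
rewrite /mulb; elim/last_ind: ms => [|ms b IH]; first by rewrite /= muln0.
rewrite -cats1 foldl_cat /= cats1 rev_rcons /=; case: b; rewrite ?bval_adds /= IH.
all: lia.
Qed.

(** Each digit of the multiplier lengthens the product by at most two, one for
    the doubling and one for the carry. Since the coefficient of the other length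
    is one, repeated multiplication of a long number by short ones adds
    lengths. *)
Lemma size_mulb a ms : size (mulb a ms) <= size a + 2 * size ms.
Proof.
rewrite /mulb; elim/last_ind: ms => [|ms b IH] //.
rewrite -cats1 foldl_cat /= cats1 size_rcons; case: b; rewrite ?size_adds /=; lia.
Qed.

Lemma mulb_neq0 a ms : ms != [::] -> mulb a ms != [::].
Proof.
rewrite /mulb; elim/last_ind: ms => [|ms b IH] // _.
rewrite -cats1 foldl_cat /=; case: b => //.
by rewrite -size_eq0 size_adds.
Qed.

(** Adds stack [i] to stack [k], or subtracts it. Stack 13 holds the carry and
    keeps it for the caller, who learns from it the outcome of a comparison; the
    digits of [i] are parked on stack 11 and restored, those of the result appear
    in reverse order on stack 12. *)
Definition addin (sub : bool) i k : cmd :=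
  (Push 13 (fun _ => Bit false) ;;
   While (fun h => filled i h || filled k h)
     (Push 12 (fun h => Bit (bit (h k) (+) bit (h i) (+) bit (h 13))) ;;
      If (fun h => maj (bit (h k) (+) sub) (bit (h i)) (bit (h 13)))
        (Pop 13 ;; Push 13 (fun _ => Bit true))
        (Pop 13 ;; Push 13 (fun _ => Bit false)) ;;
      If (filled i) (mv1 i 11) Skip ;;
      Pop k) ;;
   Push 12 (top 13) ;;
   mvall 11 i ;; mvall 12 k).

(** Moving the multiplier to stack 14 reverses it, which is the order that
    Horner's scheme needs, and lets it return to stack [j] digit by digit. *)
Definition times (i j k : nat) : cmd :=
  (mvall j 14 ;;
   While (filled 14)
     (Push k (fun _ => Bit false) ;;
      If (fun h => bit (h 14)) (addin false i k ;; Pop 13) Skip ;;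
      mv1 14 j)).

Definition scratch i := i \in [:: 11; 12; 13; 14].

Lemma bit_head l : bit (ohead (bits l)) = head false l.
Proof. by case: l. Qed.

Lemma run_setbit s c c' :
  s 13 = [:: c] ->
  run (Pop 13 ;; Push 13 (fun _ => Bit c')) s 3 (upd s 13 [:: Bit c']).
Proof.
move=> E; apply: run_cast.
- by apply: run_seq; [exact: run_pop|exact: run_push].
- by [].
- by rewrite /upd /= E; eqst.
Qed.

Lemma run_mvtop s i j l : i != j -> s i = l ->
  run (If (filled i) (mv1 i j) Skip) s 5
    (upd (upd s j (take 1 l ++ s j)) i (behead l)).
Proof.
move=> Hij E; apply: (@run_if _ _ _ _ 3); rewrite /filled /tops E.
case: l E => [|a l] E /=; first by apply: (run_cast (run_skip _)) => //; eqst.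
by rewrite take0; exact: run_mv1 E.
Qed.

(** The final carry is kept apart from the digits because the loop leaves it on
    its own stack. *)
Lemma run_addloop sub (i k : nat) l1 l2 c r v s :
  i != k -> ~~ scratch i -> ~~ scratch k ->
  s i = bits l2 -> s k = bits l1 -> s 13 = [:: Bit c] -> s 12 = r -> s 11 = v ->
  exists d c', adder sub (maxn (size l1) (size l2)) c l1 l2 = rcons d c' /\
  run (While (fun h => filled i h || filled k h)
     (Push 12 (fun h => Bit (bit (h k) (+) bit (h i) (+) bit (h 13))) ;;
      If (fun h => maj (bit (h k) (+) sub) (bit (h i)) (bit (h 13)))
        (Pop 13 ;; Push 13 (fun _ => Bit true))
        (Pop 13 ;; Push 13 (fun _ => Bit false)) ;;
      If (filled i) (mv1 i 11) Skip ;;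
      Pop k)) s (15 * maxn (size l1) (size l2) + 1)
   (upd (upd (upd (upd (upd s i [::]) k [::]) 13 [:: Bit c'])
      12 (rev (bits d) ++ r)) 11 (rev (bits l2) ++ v)).
Proof.
rewrite /scratch !inE => Hik Hi Hk.
have [n En] : exists n, maxn (size l1) (size l2) = n by eexists.
elim: n l1 l2 c r v s En => [|n IH] l1 l2 c r v s En E1 E2 E3 E4 E5; rewrite En.
  have [/size0nil Z1 /size0nil Z2] : size l1 = 0 /\ size l2 = 0 by lia.
  rewrite {}Z1 {}Z2 in E1 E2 *; exists [::], c; split=> //.
  apply: run_cast; first by apply: run_while0; rewrite /filled /tops E1 E2.
    by [].
  by eqst.
pose x := head false l1; pose y := head false l2.
pose c1 := maj (x (+) sub) y c.
pose s1 := upd (upd (upd (upd (upd s i (bits (behead l2))) k (bits (behead l1)))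
   13 [:: Bit c1]) 12 (Bit (x (+) y (+) c) :: r)) 11 (bits (take 1 l2) ++ v).
have En' : maxn (size (behead l1)) (size (behead l2)) = n.
  by rewrite !size_behead; lia.
case: (IH _ _ c1 (Bit (x (+) y (+) c) :: r) (bits (take 1 l2) ++ v) s1 En').
- by rewrite /s1; updr.
- by rewrite /s1; updr.
- by [].
- by [].
- by [].
move=> d [c' [Ed Hr]]; exists (x (+) y (+) c :: d), c'; split.
  by rewrite /= -/x -/y -/c1 -En' Ed.
have Hbody : run
     (Push 12 (fun h => Bit (bit (h k) (+) bit (h i) (+) bit (h 13))) ;;
      If (fun h => maj (bit (h k) (+) sub) (bit (h i)) (bit (h 13)))
        (Pop 13 ;; Push 13 (fun _ => Bit true))
        (Pop 13 ;; Push 13 (fun _ => Bit false)) ;;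
      If (filled i) (mv1 i 11) Skip ;;
      Pop k) s 13 s1.
  pose s2 := upd s 12 (Bit (x (+) y (+) c) :: r).
  have R1 : run (Push 12 (fun h => Bit (bit (h k) (+) bit (h i) (+) bit (h 13))))
      s 2 s2.
    apply: (run_cast (run_push _ _ _)) => //; rewrite /s2 E4.
    congr (upd _ _ (Bit _ :: _)).
    rewrite /tops; updr; by rewrite E1 E2 E3 !bit_head.
  pose s3 := upd s2 13 [:: Bit c1].
  have R2 : run (If (fun h => maj (bit (h k) (+) sub) (bit (h i)) (bit (h 13)))
        (Pop 13 ;; Push 13 (fun _ => Bit true))
        (Pop 13 ;; Push 13 (fun _ => Bit false))) s2 5 s3.
    apply: (@run_if _ _ _ _ 3); set b := (X in if X then _ else _).
    have -> : b = c1.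
      rewrite /b /s2 /c1 /tops; updr.
      by rewrite E1 E2 E3 !bit_head.
    by case: (c1) @s3 => s3; apply: run_setbit; rewrite /s2 /upd /= E3.
  have R3 := @run_mvtop s3 i 11 (bits l2) _ _.
  apply: run_cast (run_seq R1 (run_seq R2 (run_seq (R3 _ _) (run_pop _ _)))) _ _ => //.
  - by lia.
  - by rewrite /s3 /s2; updr.
  rewrite /s1 /s3 /s2; eqst; rewrite ?E1 ?E2.
  - by case: (l1).
  - by case: (l2).
  - by case: (l2) => //= ? ?; rewrite !take0.
apply: run_cast.
- apply: run_whileS; [| exact: Hbody | exact: Hr].
  by rewrite /filled /tops E1 E2; case: (l1) (l2) En => [|? ?] [|? ?].
- by rewrite En'; lia.
- rewrite /s1; eqst; last by rewrite rev_cons cat_rcons.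
  by case: (l2) => [|b l] //=; rewrite take0 rev_cons cat_rcons.
Qed.

Lemma run_addin sub (i k : nat) l1 l2 s :
  i != k -> ~~ scratch i -> ~~ scratch k ->
  s i = bits l2 -> s k = bits l1 ->
  s 11 = [::] -> s 12 = [::] -> s 13 = [::] ->
  run (addin sub i k) s (30 * maxn (size l1) (size l2) + 30)
    (upd (upd s k (bits (adds sub l1 l2))) 13
         [:: Bit (last false (adds sub l1 l2))]).
Proof.
move=> Hik Hi Hk E1 E2 E11 E12 E13; rewrite /addin.
have Hi' := Hi; have Hk' := Hk; rewrite /scratch !inE in Hi' Hk'.
pose s1 := upd s 13 [:: Bit false].
have R1 : run (Push 13 (fun=> Bit false)) s 2 s1.
  by apply: (run_cast (run_push _ _ _)) => //; rewrite /s1 E13.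
have [|||||d [c [Ed R2]]] := @run_addloop sub i k l1 l2 false [::] [::] s1 Hik Hi Hk.
- by rewrite /s1; updr.
- by rewrite /s1; updr.
- by [].
- by [].
- by [].
rewrite -/(adds _ _ _) in Ed.
rewrite !cats0 in R2; set s2 := upd _ 11 _ in R2.
pose s3 := upd s2 12 (rev (bits (adds sub l1 l2))).
have R3 : run (Push 12 (top 13)) s2 2 s3.
  apply: (run_cast (run_push _ _ _)) => //.
  rewrite /s3 Ed; congr upd; rewrite /top /tops /s2 /upd /=.
  by rewrite -rev_rcons /bits map_rcons.
have R4 : run (mvall 11 i) s3 (5 * size (rev (bits l2)) + 1) (upd (upd s3 i (bits l2)) 11 [::]).
  apply: run_cast; first apply: (@run_mvall 11 i _ (rev (bits l2))) => //.
  - by lia.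
  - by [].
  - rewrite revK; rewrite /s3 /s2; eqst; by rewrite cats0.
set s4 := upd _ 11 _ in R4.
have R5 := @run_mvall 12 k s4 (rev (bits (adds sub l1 l2))) _ _.
apply: run_cast (run_seq R1 (run_seq R2 (run_seq R3 (run_seq R4 (R5 _ _))))) _ _.
- by lia.
- by rewrite /s4 /s3; updr.
- rewrite !size_rev !size_map size_adds; lia.
- rewrite revK /s4 /s3 /s2 /s1; eqst; rewrite ?cats0 //.
  by rewrite Ed last_rcons.
Qed.

Lemma run_times (i j k : nat) a b s :
  i != k -> j != k -> i != j -> ~~ scratch i -> ~~ scratch j -> ~~ scratch k ->
  s i = bits a -> s j = bits b -> s k = [::] ->
  s 11 = [::] -> s 12 = [::] -> s 13 = [::] -> s 14 = [::] ->
  run (times i j k) s (100 * (size a + size b + 1) ^ 2)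
    (upd s k (bits (mulb a (rev b)))).
Proof.
move=> Hik Hjk Hij Hi Hj Hk E1 E2 E3 E11 E12 E13 E14.
have Hi' := Hi; have Hj' := Hj; have Hk' := Hk; rewrite /scratch !inE in Hi' Hj' Hk'.
pose s1 := upd (upd s 14 (rev (bits b))) j [::].
have R1 : run (mvall j 14) s (5 * size b + 1) s1.
  apply: run_cast; first apply: (@run_mvall j 14 _ (bits b)) => //.
  - by lia.
  - by rewrite size_map.
  - by rewrite E14 cats0.
rewrite /times.
have Hloop : forall (ms acc rest : seq bool) t,
    t i = bits a -> t 14 = bits ms -> t j = bits rest -> t k = bits acc ->
    t 11 = [::] -> t 12 = [::] -> t 13 = [::] ->
    size acc + 2 * size ms <= size a + 2 * size b -> size ms <= size b ->
    run (While (filled 14)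
     (Push k (fun _ => Bit false) ;;
      If (fun h => bit (h 14)) (addin false i k ;; Pop 13) Skip ;;
      mv1 14 j)) t (size ms * (30 * (size a + 2 * size b) + 40) + 1)
      (upd (upd (upd t 14 [::]) j (rev (bits ms) ++ bits rest)) k
         (bits (foldl (fun acc b => if b : bool then adds false (false :: acc) a
                      else false :: acc) acc ms))).
  elim=> [|m ms IH] acc rest t T1 T14 T2 T3 T11 T12 T13 Hs Hb.
    apply: run_cast; first by apply: run_while0; rewrite /filled /tops T14.
      by [].
    by eqst.
  pose acc' := if m then adds false (false :: acc) a else false :: acc.
  pose t1 := upd t k (bits (false :: acc)).
  have Q1 : run (Push k (fun=> Bit false)) t 2 t1.
    by apply: (run_cast (run_push _ _ _)) => //; rewrite T3.
  pose t2 := upd t k (bits acc').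
  have Q2 : run (If (fun h => bit (h 14)) (addin false i k ;; Pop 13) Skip)
      t1 (30 * (size a + 2 * size b) + 33) t2.
    apply: run_le; first apply: (@run_if _ _ _ _ (30 * (size a + 2 * size b) + 31) t2).
      have -> : bit (tops t1 14) = m by rewrite /tops /t1; updr; rewrite T14.
      rewrite /t2 /acc'; case: m {acc' t2} T14 Hs Hb => T14 Hs Hb; last first.
        by apply: (run_cast (run_skip _)).
      have Q := @run_addin false i k (false :: acc) a t1 Hik Hi Hk _ _ _ _ _.
      apply: run_cast (run_seq (Q _ _ _ _ _) (run_pop _ _)) _ _.
      - by rewrite /t1; updr.
      - by rewrite /t1; updr.
      - by rewrite /t1; updr.
      - by rewrite /t1; updr.
      - by rewrite /t1; updr.
      - by move: Hs => /=; lia.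
      - by rewrite /t1; eqst.
    by lia.
  have Q3 := @run_mv1 14 j t2 (Bit m) (bits ms) _ _.
  apply: run_cast.
  - apply: run_whileS; first by rewrite /filled /tops T14.
    + apply: run_seq Q1 (run_seq Q2 (Q3 _ _)); first by lia.
      by rewrite /t2; updr.
    + apply: (IH acc' (m :: rest)); rewrite /t2; updr; rewrite ?T2 //; last exact: ltnW.
      by rewrite /acc'; case: (m) Hs Hb; rewrite ?size_adds /=; lia.
  - by rewrite /=; lia.
  - rewrite /t2 /=; eqst.
    by rewrite rev_cons cat_rcons.
apply: run_cast (run_seq R1 (Hloop (rev b) [::] [::] s1 _ _ _ _ _ _ _ _ _)) _ _.
- by rewrite /s1; updr.
- by rewrite /s1; updr; rewrite /bits map_rev.
- by rewrite /s1; updr.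
- by rewrite /s1; updr.
- by rewrite /s1; updr.
- by rewrite /s1; updr.
- by rewrite /s1; updr.
- by rewrite size_rev /=; lia.
- by rewrite size_rev.
- by rewrite size_rev; nia.
- rewrite /s1; eqst; by rewrite cats0 /bits map_rev revK.
Qed.

(** * Memory words *)

(** An unsigned fraction, digits from the least significant one: this is how
    they lie on a stack after the word has been popped from the input tape. *)
Definition urat := (seq bool * seq bool)%type.
Definition uword (u : urat) : seq sym := bits (rev u.1) ++ Slash :: bits (rev u.2).
Definition mword (m : seq urat) : seq sym :=
  flatten [seq rcons (uword u) Comma | u <- m].

Definition is_comma (x : option sym) := if x is Some Comma then true else false.
Definition is_slash (x : option sym) := if x is Some Slash then true else false.

Arguments is_comma : simpl never.
Arguments is_slash : simpl never.

Definition scan (stop : option sym -> bool) k : cmd :=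
  While (fun h => ~~ stop (h 0)) (Push k (top 0) ;; mv1 0 1).
Definition skip_block : cmd :=
  While (fun h => ~~ is_comma (h 0)) (mv1 0 1) ;; mv1 0 1.
(** The index register is emptied into stack 11 and refilled while the blocks
    pass from stack 0 to stack 1. *)
Definition skip r : cmd :=
  mvall r 11 ;; While (filled 11) (mv1 11 r ;; skip_block).
Definition load r n d : cmd :=
  skip r ;; scan is_slash n ;; mv1 0 1 ;; scan is_comma d ;; mvall 1 0.
(** If the index register points just behind the memory, there is no block to
    drop and the new one is appended. *)
Definition store r n d : cmd :=
  skip r ;;
  If (filled 0) (While (fun h => ~~ is_comma (h 0)) (Pop 0) ;; Pop 0) Skip ;;
  Push 0 (fun _ => Comma) ;; mvall d 0 ;; Push 0 (fun _ => Slash) ;; mvall n 0 ;;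
  mvall 1 0.

Lemma mword_cat m1 m2 : mword (m1 ++ m2) = mword m1 ++ mword m2.
Proof. by rewrite /mword map_cat flatten_cat. Qed.

Lemma mword_cons u m : mword (u :: m) = uword u ++ Comma :: mword m.
Proof. by rewrite /mword /= cat_rcons. Qed.

Lemma run_scan (stop : option sym -> bool) (k : nat) (s : stacks) l c rest : 1 < k ->
  s 0 = l ++ c :: rest -> stop (Some c) -> all (fun x => ~~ stop (Some x)) l ->
  run (scan stop k) s (7 * size l + 1)
    (upd (upd (upd s 0 (c :: rest)) 1 (rev l ++ s 1)) k (rev l ++ s k)).
Proof.
move=> Hk E Hc; elim: l s E => [|a l IH] s E /=.
  move=> _; apply: run_cast; first by apply: run_while0; rewrite /tops E /= Hc.
    by [].
  by eqst.
move=> /andP[Ha Hl].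
pose s1 := upd (upd (upd s k (a :: s k)) 1 (a :: s 1)) 0 (l ++ c :: rest).
have Hb : run (Push k (top 0) ;; mv1 0 1) s 5 s1.
  pose s2 := upd s k (a :: s k).
  apply: run_cast (run_seq (s1 := s2) (T1 := 2) _ (@run_mv1 0 1 s2 a (l ++ c :: rest) _ _)) _ _ => //.
  - apply: (run_cast (run_push _ _ _)) => //.
    by rewrite /s2 /top /tops; congr (upd _ _ (_ :: _)); updr; rewrite E.
  - by rewrite /s2; updr.
  - by rewrite /s1 /s2; eqst.
apply: run_cast; first apply: (run_whileS _ Hb (IH s1 _ Hl)).
- by rewrite /tops E.
- by rewrite /s1; updr.
- by lia.
- by rewrite /s1; eqst; rewrite rev_cons cat_rcons.
Qed.

Lemma uword_no_comma u : all (fun x => ~~ is_comma (Some x)) (uword u).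
Proof. by rewrite /uword all_cat /= !all_map; apply/andP; split; apply/allP. Qed.

Lemma run_skip_block (s : stacks) u rest :
  s 0 = uword u ++ Comma :: rest ->
  run skip_block s (5 * (size (uword u)).+1 + 1)
    (upd (upd s 0 rest) 1 (rev (rcons (uword u) Comma) ++ s 1)).
Proof.
move=> E.
have H : forall l (t : stacks), all (fun x => ~~ is_comma (Some x)) l ->
    t 0 = l ++ Comma :: rest ->
    run (While (fun h => ~~ is_comma (h 0)) (mv1 0 1)) t (5 * size l + 1)
      (upd (upd t 0 (Comma :: rest)) 1 (rev l ++ t 1)).
  elim=> [|a l IH] t /=.
    move=> _ T; apply: run_cast; first by apply: run_while0; rewrite /tops T.
      by [].
    by eqst.
  move=> /andP[Ha Hl] T.
  have R := @run_mv1 0 1 t a _ isT T.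
  apply: run_cast; first apply: (run_whileS _ R (IH _ Hl _)).
  - by rewrite /tops T.
  - by updr.
  - by lia.
  - by eqst; rewrite rev_cons cat_rcons.
apply: run_cast; first apply: (run_seq (H _ _ (uword_no_comma u) E) (@run_mv1 0 1 _ Comma rest isT _)).
- by updr.
- by lia.
- by eqst; rewrite rev_rcons.
Qed.

Definition unary n : seq sym := nseq n Comma.

Lemma rev_nseq T n (x : T) : rev (nseq n x) = nseq n x.
Proof.
elim: n => //= n IH; rewrite rev_cons IH -cats1 cat_nseq.
by elim: n {IH} => //= n ->.
Qed.

Lemma run_skip_to (r : nat) m k (s : stacks) : 14 < r -> k <= size m ->
  s 0 = mword m -> s 1 = [::] -> s 11 = [::] -> s r = unary k ->
  run (skip r) s (14 * k + 5 * size (mword m) + 2)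
    (upd (upd s 0 (mword (drop k m))) 1 (rev (mword (take k m)))).
Proof.
move=> Hr Hk E0 E1 E11 Er.
pose s1 := upd (upd s 11 (unary k)) r [::].
have R1 : run (mvall r 11) s (5 * k + 1) s1.
  apply: run_cast; first apply: (@run_mvall r 11 s _ _ Er); first by lia.
  - by rewrite size_nseq.
  - by rewrite /s1 E11 cats0 rev_nseq.
have Hloop : forall k m z j (t : stacks), k <= size m ->
    t 0 = mword m -> t 1 = z -> t 11 = unary k -> t r = unary j ->
    run (While (filled 11) (mv1 11 r ;; skip_block)) t
      (9 * k + 5 * size (mword m) + 1)
      (upd (upd (upd (upd t 0 (mword (drop k m))) 1 (rev (mword (take k m)) ++ z))
         11 [::]) r (unary (k + j))).
  elim=> [|k' IH] m' z j t Hk' T0 T1 T11 Tr.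
    apply: run_cast; first by apply: run_while0; rewrite /filled /tops T11.
      by lia.
    by rewrite drop0 take0; eqst.
  case: m' Hk' T0 => // u m' Hk' T0; rewrite mword_cons in T0.
  pose t1 := upd (upd t r (unary j.+1)) 11 (unary k').
  have Q1 : run (mv1 11 r) t 3 t1.
    apply: run_cast; first apply: (@run_mv1 11 r t Comma (unary k')) => //.
    - by lia.
    - by [].
    - by rewrite Tr.
  pose t2 := upd (upd t1 0 (mword m')) 1 (rev (rcons (uword u) Comma) ++ z).
  have Q2 : run skip_block t1 (5 * (size (uword u)).+1 + 1) t2.
    apply: run_cast; first apply: (@run_skip_block t1 u (mword m')) => //.
    - by rewrite /t1; updr.
    - by [].
    - by rewrite /t2 /t1; eqst.
  apply: run_cast; first apply: (run_whileS _ (run_seq Q1 Q2) (IH m' _ j.+1 t2 _ _ _ _ _)).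
  - by rewrite /filled /tops T11.
  - by [].
  - by rewrite /t2 /t1; updr.
  - by [].
  - by rewrite /t2 /t1; updr.
  - by rewrite /t2 /t1; updr.
  - by rewrite mword_cons size_cat /=; lia.
  - rewrite /t2 /t1 /=; eqst; first by rewrite addnS.
    by rewrite mword_cons rev_cat rev_cons rev_rcons -!cats1 -!catA.
apply: run_cast; first apply: (run_seq R1 (Hloop k m [::] 0 s1 Hk _ _ _ _)).
- by rewrite /s1; updr.
- by rewrite /s1; updr.
- by rewrite /s1; updr.
- by rewrite /s1; updr.
- by lia.
- by rewrite /s1 addn0; eqst; rewrite cats0.
Qed.

(** Reading beyond the memory yields zero, and padding writes zeros. *)
Definition u0 : urat := ([:: false], [:: true]).

Lemma run_load (r n d : nat) m k (s : stacks) : 14 < r -> k < size m ->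
  1 < n < 11 -> 1 < d < 11 -> n != d ->
  s 0 = mword m -> s 1 = [::] -> s 11 = [::] -> s r = unary k ->
  s n = [::] -> s d = [::] ->
  run (load r n d) s (14 * k + 24 * size (mword m) + 24)
    (upd (upd s n (bits (nth u0 m k).1)) d (bits (nth u0 m k).2)).
Proof.
move=> Hr Hk Hn Hd Hnd E0 E1 E11 Er En Ed.
have R1 := run_skip_to Hr (ltnW Hk) E0 E1 E11 Er.
rewrite (drop_nth u0 Hk) mword_cons in R1.
set u := nth u0 m k in R1 *; set pre := mword (take k m) in R1.
set post := mword (drop k.+1 m) in R1; set s1 := upd _ 1 _ in R1.
have Em : mword m = pre ++ uword u ++ Comma :: post.
  by rewrite -mword_cons -(drop_nth u0 Hk) -mword_cat cat_take_drop.
have nostop (stop : option sym -> bool) l :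
    (forall b, ~~ stop (Some (Bit b))) -> all (fun x => ~~ stop (Some x)) (bits l).
  by move=> H; rewrite all_map; apply/allP => b _; exact: H.
have D1 : s1 0 = bits (rev u.1) ++ Slash :: bits (rev u.2) ++ Comma :: post.
  by rewrite /s1 /uword; updr; rewrite -catA.
have R2 := @run_scan is_slash n s1 _ _ _ _ D1 isT (nostop _ _ _).
set s2 := upd _ n _ in R2.
have D2 : s2 0 = Slash :: bits (rev u.2) ++ Comma :: post by rewrite /s2; updr.
have R3 := @run_mv1 0 1 s2 _ _ isT D2; set s3 := upd _ 0 _ in R3.
have D3 : s3 0 = bits (rev u.2) ++ Comma :: post by rewrite /s3; updr.
have R4 := @run_scan is_comma d s3 _ _ _ _ D3 isT (nostop _ _ _).
set s4 := upd _ d _ in R4.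
have R5 := @run_mvall 1 0 s4 (rev (pre ++ uword u)) isT _.
apply: run_cast; first apply: (run_seq R1 (run_seq (R2 _ _) (run_seq R3 (run_seq (R4 _ _) (R5 _))))).
- by lia.
- by [].
- by lia.
- by [].
- rewrite /s4 /s3 /s2 /s1; updr.
  by rewrite /uword !rev_cat rev_cons -cats1 -!catA.
- by rewrite Em !(size_cat, size_rev, size_map) /= !(size_cat, size_rev, size_map) /=; lia.
- rewrite /s4 /s3 /s2 /s1 revK; eqst; first by rewrite E0 Em -catA.
  + by rewrite Ed cats0 /bits map_rev revK.
  + by rewrite En cats0 /bits map_rev revK.
Qed.

Definition put m k (u : urat) : seq urat := set_nth u0 m k u.

Lemma mword_put m k u : k <= size m ->
  mword (put m k u) = mword (take k m) ++ uword u ++ Comma :: mword (drop k.+1 m).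
Proof.
move=> Hk; rewrite -mword_cons -mword_cat; congr mword.
by elim: m k Hk => [|a m IH] [|k] //= Hk; rewrite ?drop0 ?IH.
Qed.

Lemma run_drop_block (s : stacks) u rest :
  s 0 = uword u ++ Comma :: rest ->
  run (While (fun h => ~~ is_comma (h 0)) (Pop 0) ;; Pop 0) s
    (5 * (size (uword u)).+1 + 1) (upd s 0 rest).
Proof.
move=> E.
have H : forall l (t : stacks), all (fun x => ~~ is_comma (Some x)) l ->
    t 0 = l ++ Comma :: rest ->
    run (While (fun h => ~~ is_comma (h 0)) (Pop 0)) t (3 * size l + 1)
      (upd t 0 (Comma :: rest)).
  elim=> [|a l IH] t /=.
    move=> _ T; apply: run_cast; first by apply: run_while0; rewrite /tops T.
      by [].
    by eqst.
  move=> /andP[Ha Hl] T.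
  apply: run_cast; first apply: (run_whileS _ (run_pop _ _) (IH _ Hl _)).
  - by rewrite /tops T.
  - by updr; rewrite T.
  - by lia.
  - by eqst.
apply: run_cast; first apply: (run_seq (H _ _ (uword_no_comma u) E) (run_pop _ _)).
- by lia.
- by eqst.
Qed.

Lemma run_store (r n d : nat) m k u (s : stacks) : 14 < r -> k <= size m ->
  1 < n < 11 -> 1 < d < 11 -> n != d ->
  s 0 = mword m -> s 1 = [::] -> s 11 = [::] -> s r = unary k ->
  s n = bits u.1 -> s d = bits u.2 ->
  run (store r n d) s
    (14 * k + 24 * size (mword m) + 5 * (size u.1 + size u.2) + 24)
    (upd (upd (upd s 0 (mword (put m k u))) n [::]) d [::]).
Proof.
move=> Hr Hk Hn Hd Hnd E0 E1 E11 Er En Ed.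
have R1 := run_skip_to Hr Hk E0 E1 E11 Er.
set pre := mword (take k m) in R1.
have Em : mword m = pre ++ mword (drop k m).
  by rewrite -mword_cat cat_take_drop.
pose post := mword (drop k.+1 m); set s1 := upd _ 1 _ in R1.
pose s2 := upd s1 0 post.
have R2 : run (If (filled 0) (While (fun h => ~~ is_comma (h 0)) (Pop 0) ;; Pop 0) Skip)
    s1 (5 * size (mword (drop k m)) + 8) s2.
  apply: (@run_le _ _ (5 * size (mword (drop k m)) + 6 + 2)); last by lia.
  apply: run_if; rewrite /filled.
  have -> : tops s1 0 = ohead (mword (drop k m)) by rewrite /tops /s1; updr.
  case: (ltnP k (size m)) => Hkm; last first.
    have Z : mword (drop k m) = [::] by rewrite drop_oversize.
    rewrite Z /=; apply: (run_cast (run_skip _)) => //.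
    by rewrite /s2 /s1 Z; eqst; rewrite /post drop_oversize // ltnW.
  rewrite (drop_nth u0 Hkm) mword_cons.
  have -> : ohead (uword (nth u0 m k) ++ Comma :: mword (drop k.+1 m)) :> bool.
    by case: (uword _).
  apply: run_cast; first apply: (@run_drop_block s1 (nth u0 m k) post).
  - by rewrite /s1 (drop_nth u0 Hkm) mword_cons; updr.
  - by rewrite size_cat /=; lia.
  - by [].
pose s3 := upd s2 0 (Comma :: post).
have R3 : run (Push 0 (fun=> Comma)) s2 2 s3.
  by apply: (run_cast (run_push _ _ _)).
have Hd0 : d != 0 by lia.
have Hn0 : n != 0 by lia.
have D3 : s3 d = bits u.2 by rewrite /s3 /s2 /s1; updr.
have R4 := run_mvall Hd0 D3; set s4 := upd _ d _ in R4.
pose s5 := upd s4 0 (Slash :: rev (bits u.2) ++ Comma :: post).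
have R5 : run (Push 0 (fun=> Slash)) s4 2 s5.
  apply: (run_cast (run_push _ _ _)) => //; rewrite /s5; congr (upd _ _ (_ :: _)).
  by rewrite /s4 /s3; updr.
have D5 : s5 n = bits u.1 by rewrite /s5 /s4 /s3 /s2 /s1; updr.
have R6 := run_mvall Hn0 D5; set s6 := upd _ n _ in R6.
have D6 : s6 1 = rev pre by rewrite /s6 /s5 /s4 /s3 /s2 /s1; updr.
have R7 := @run_mvall 1 0 s6 _ isT D6.
apply: run_cast; first apply: (run_seq R1 (run_seq R2 (run_seq R3 (run_seq R4
  (run_seq R5 (run_seq R6 R7)))))).
- by rewrite Em size_cat size_rev !size_map; lia.
- rewrite /s6 /s5 /s4 /s3 /s2 /s1 revK; eqst.
  by rewrite mword_put // /uword /bits !map_rev -!catA.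
Qed.

(** * Simulation of one arithmetic instruction *)

(** [OAddSame] assumes equal denominators and keeps them; [OCross] adds or
    subtracts, if its argument is true, by cross-multiplication. *)
Inductive binop := OMul | OAddSame | OCross of bool.

(** The arithmetic instructions that occur in the program, annotated with the
    way in which fractions are added. [XGoto] abbreviates the comparison of an
    index register with itself, so that [XJump] need only be implemented for two
    different registers. *)
Inductive xinstr :=
| XZero of nat
| XSucc of nat
| XPred of nat
| XCopy of nat & nat
| XJump of nat & nat & nat
| XGoto of nat
| XConst of nat & bool
| XOp of binop & nat & nat & nat
| XLe of nat & nat & nat.

Record xst := XState { xpc : nat; xidx : seq nat; xmem : seq urat }.

Definition xop (o : binop) (x y : urat) : urat :=
  match o with
  | OMul => (mulb x.1 (rev y.1), mulb x.2 (rev y.2))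
  | OAddSame => (adds false x.1 y.1, x.2)
  | OCross sub => (adds sub (mulb x.1 (rev y.2)) (mulb x.2 (rev y.1)),
                   mulb x.2 (rev y.2))
  end.

Definition xle (x y : urat) : bool :=
  ~~ borrow (mulb x.2 (rev y.1)) (mulb x.1 (rev y.2)).

Definition xconst (b : bool) : urat := ([:: b], [:: true]).

Definition xexec (o : xinstr) (x : xst) : xst :=
  let: XState p r m := x in
  match o with
  | XZero i => XState p.+1 (set_nth 0 r i 0) m
  | XSucc i => XState p.+1 (set_nth 0 r i (nth 0 r i).+1) m
  | XPred i => XState p.+1 (set_nth 0 r i (nth 0 r i).-1) m
  | XCopy i j => XState p.+1 (set_nth 0 r i (nth 0 r j)) m
  | XJump i j l => XState (if nth 0 r i <= nth 0 r j then l else p.+1) r m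
  | XGoto l => XState l r m
  | XConst i b => XState p.+1 r (put m (nth 0 r i) (xconst b))
  | XOp o i j k =>
      XState p.+1 r (put m (nth 0 r i)
        (xop o (nth u0 m (nth 0 r j)) (nth u0 m (nth 0 r k))))
  | XLe i j l =>
      XState (if xle (nth u0 m (nth 0 r i)) (nth u0 m (nth 0 r j)) then l else p.+1) r m
  end.

(** Memory accesses are in range, up to appending one cell. *)
Definition in_range (o : xinstr) (r : seq nat) (m : seq urat) : bool :=
  match o with
  | XConst i _ => nth 0 r i <= size m
  | XOp _ i j k =>
      [&& nth 0 r i <= size m, nth 0 r j < size m & nth 0 r k < size m]
  | XLe i j _ => (nth 0 r i < size m) && (nth 0 r j < size m)
  | _ => true
  end.

Section Blocks.

Variables (NR PN : nat).

Definition reg i := 15 + i.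

Definition reg_stacks (r : seq nat) : stacks :=
  fun i => if 15 <= i < 15 + NR then unary (nth 0 r (i - 15)) else [::].

(** The program counter is kept in unary as the distance to the end of the
    program: the stack is empty exactly when the program has halted, and an
    instruction is selected by popping. *)
Definition enc (x : xst) : stacks :=
  upd (upd (reg_stacks (xidx x)) 2 (unary (PN - xpc x))) 0 (mword (xmem x)).

Definition enc_data (r : seq nat) (m : seq urat) : stacks :=
  upd (reg_stacks r) 0 (mword m).

Fixpoint pushes n := if n is n'.+1 then Push 2 (fun _ => Comma) ;; pushes n' else Skip.

Definition setpc l := pushes (PN - l).

Definition clears (L : seq nat) : cmd := foldr (fun i c => clear i ;; c) Skip L.

Definition cleanup := clears [:: 3; 4; 5; 6; 7; 8; 9; 10].

(** All four products of numerators and denominators are computed, whichever of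
    them the instruction uses, so that a single lemma describes the stacks
    before any arithmetic operation. *)
Definition operands j k : cmd :=
  load (reg j) 3 4 ;; load (reg k) 5 6 ;;
  times 3 6 7 ;; times 4 5 8 ;; times 4 6 9 ;; times 3 5 10.

Definition op_block (o : binop) i : cmd :=
  match o with
  | OMul => store (reg i) 10 9
  | OAddSame => addin false 5 3 ;; Pop 13 ;; store (reg i) 3 4
  | OCross sub => addin sub 8 7 ;; Pop 13 ;; store (reg i) 7 9
  end.

Definition block (p : nat) (o : xinstr) : cmd :=
  match o with
  | XZero i => clear (reg i) ;; setpc p.+1
  | XSucc i => Push (reg i) (fun _ => Comma) ;; setpc p.+1
  | XPred i => Pop (reg i) ;; setpc p.+1
  | XCopy i j =>
      clear (reg i) ;; mvall (reg j) 11 ;;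
      While (filled 11) (Push (reg i) (fun _ => Comma) ;; mv1 11 (reg j)) ;;
      setpc p.+1
  | XJump i j l =>
      While (fun h => filled (reg i) h && filled (reg j) h)
        (Pop (reg i) ;; mv1 (reg j) 11) ;;
      If (filled (reg i))
        (While (filled 11) (Push (reg i) (fun _ => Comma) ;; mv1 11 (reg j)) ;;
         setpc p.+1)
        (While (filled 11) (Push (reg i) (fun _ => Comma) ;; mv1 11 (reg j)) ;;
         setpc l)
  | XGoto l => setpc l
  | XConst i b =>
      Push 3 (fun _ => Bit b) ;; Push 4 (fun _ => Bit true) ;;
      store (reg i) 3 4 ;; setpc p.+1
  | XOp o i j k => operands j k ;; op_block o i ;; cleanup ;; setpc p.+1
  | XLe i j l =>
      operands i j ;; addin true 7 8 ;;
      If (fun h => bit (h 13)) (Pop 13 ;; cleanup ;; setpc p.+1)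
                               (Pop 13 ;; cleanup ;; setpc l)
  end.

(** The loops that copy and compare two index registers use both as stacks, so
    these must be different. *)
Definition regs_ok (o : xinstr) : bool :=
  match o with
  | XZero i | XSucc i | XPred i | XConst i _ => i < NR
  | XCopy i j | XJump i j _ => [&& i != j, i < NR & j < NR]
  | XGoto _ => true
  | XOp _ i j k => [&& i < NR, j < NR & k < NR]
  | XLe i j _ => (i < NR) && (j < NR)
  end.

Lemma reg_stacksE r i : i < NR -> reg_stacks r (reg i) = unary (nth 0 r i).
Proof. by move=> Hi; rewrite /reg_stacks /reg leq_addr ltn_add2l Hi addKn. Qed.

Lemma reg_stacks_set r i v : i < NR ->
  reg_stacks (set_nth 0 r i v) = upd (reg_stacks r) (reg i) (unary v).
Proof.
move=> Hi; apply: funext => x; rewrite /reg_stacks nth_set_nth /= /upd.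
case: (x =P reg i) => [->|Hx]; first by rewrite /reg addKn eqxx leq_addr ltn_add2l Hi.
case: ifP => // H; case: eqP => // E.
by exfalso; apply: Hx; rewrite /reg; lia.
Qed.

Lemma run_pushes n s :
  run (pushes n) s (2 * n) (upd s 2 (unary n ++ s 2)).
Proof.
elim: n s => [|n IH] s /=; first by apply: (run_cast (run_skip _)) => //; eqst.
apply: run_cast; first apply: (run_seq (run_push _ _ _) (IH _)); first by lia.
by eqst; elim: n {IH} => //= n ->.
Qed.

Lemma run_setpc l r m :
  run (setpc l) (enc_data r m) (2 * PN) (enc (XState l r m)).
Proof.
apply: run_cast; first exact: run_pushes.
- by lia.
- by rewrite /enc /enc_data; eqst; rewrite cats0.
Qed.

Lemma run_clears L s n : (forall i, i \in L -> size (s i) <= n) ->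
  run (clears L) s (size L * (3 * n + 1)) (fun i => if i \in L then [::] else s i).
Proof.
elim: L s => [|i L IH] s H /=; first by apply: (run_cast (run_skip _)).
apply: run_cast.
- apply: (run_seq (run_clear (erefl _)) (IH _ _)) => j Hj.
  by rewrite /upd; case: eqP => // _; apply: H; rewrite in_cons Hj orbT.
- by have := H i; rewrite in_cons eqxx /= => /(_ isT); nia.
- apply: funext => j; rewrite in_cons /upd; case: (j =P i) => //= _.
  by case: ifP.
Qed.

Definition computed (s : stacks) (x y : urat) : stacks :=
  upd (upd (upd (upd (upd (upd (upd (upd s
    3 (bits x.1)) 4 (bits x.2)) 5 (bits y.1)) 6 (bits y.2))
    7 (bits (mulb x.1 (rev y.2)))) 8 (bits (mulb x.2 (rev y.1))))
    9 (bits (mulb x.2 (rev y.2)))) 10 (bits (mulb x.1 (rev y.1))).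

Lemma size_nth_mword m k : k < size m ->
  size (nth u0 m k).1 + size (nth u0 m k).2 <= size (mword m).
Proof.
move=> Hk; set u := nth u0 m k.
have -> : mword m = mword (take k m) ++ uword u ++ Comma :: mword (drop k.+1 m).
  by rewrite -mword_cons -(drop_nth u0 Hk) -mword_cat cat_take_drop.
by rewrite !size_cat /= !size_map !size_rev; lia.
Qed.

Lemma run_operands j k r m N : j < NR -> k < NR ->
  nth 0 r j < size m -> nth 0 r k < size m -> size (mword m) <= N ->
  nth 0 r j <= N -> nth 0 r k <= N ->
  run (operands j k) (enc_data r m) (2000 * (N + 1) ^ 2)
    (computed (enc_data r m) (nth u0 m (nth 0 r j)) (nth u0 m (nth 0 r k))).
Proof.
move=> Hj Hk Hjm Hkm HN HjN HkN.
set x := nth u0 m (nth 0 r j); set y := nth u0 m (nth 0 r k).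
have Sx : size x.1 + size x.2 <= N by apply: leq_trans HN; exact: size_nth_mword.
have Sy : size y.1 + size y.2 <= N by apply: leq_trans HN; exact: size_nth_mword.
have R1 := @run_load (reg j) 3 4 m _ (enc_data r m) isT Hjm isT isT isT erefl erefl erefl
  _ erefl erefl.
rewrite -/x in R1; set s1 := upd _ 4 _ in R1.
have R2 := @run_load (reg k) 5 6 m _ s1 isT Hkm isT isT isT erefl erefl erefl
  _ erefl erefl.
rewrite -/y in R2; set s2 := upd _ 6 _ in R2.
have R3 := @run_times 3 6 7 x.1 y.2 s2 isT isT isT isT isT isT
  erefl erefl erefl erefl erefl erefl erefl.
set s3 := upd _ 7 _ in R3.
have R4 := @run_times 4 5 8 x.2 y.1 s3 isT isT isT isT isT isT
  erefl erefl erefl erefl erefl erefl erefl.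
set s4 := upd _ 8 _ in R4.
have R5 := @run_times 4 6 9 x.2 y.2 s4 isT isT isT isT isT isT
  erefl erefl erefl erefl erefl erefl erefl.
set s5 := upd _ 9 _ in R5.
have R6 := @run_times 3 5 10 x.1 y.1 s5 isT isT isT isT isT isT
  erefl erefl erefl erefl erefl erefl erefl.
apply: run_cast; first apply: (run_seq (R1 _) (run_seq (R2 _) (run_seq R3 (run_seq R4
  (run_seq R5 R6))))).
- exact: reg_stacksE.
- exact: reg_stacksE.
- have H (a b : seq bool) : size a <= N -> size b <= N ->
    100 * (size a + size b + 1) ^ 2 <= 400 * (N + 1) ^ 2.
    move=> Ha Hb; apply: (@leq_trans (100 * (2 * (N + 1)) ^ 2)); last by nia.
    by rewrite leq_mul2l leq_exp2r //; lia.
  have := H x.1 y.2; have := H x.2 y.1; have := H x.2 y.2; have := H x.1 y.1.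
  move: (100 * _) (100 * _) (100 * _) (100 * _) => t1 t2 t3 t4 H1 H2 H3 H4.
  nia.
- by [].
Qed.

Lemma run_restore (i j : nat) v a b (t : stacks) : i != j -> 14 < i -> 14 < j ->
  t 11 = unary v -> t i = unary a -> t j = unary b ->
  run (While (filled 11) (Push i (fun _ => Comma) ;; mv1 11 j)) t (7 * v + 1)
    (upd (upd (upd t i (unary (v + a))) j (unary (v + b))) 11 [::]).
Proof.
move=> Hij Hi Hj; elim: v a b t => [|v IH] a b t E Ei Ej.
  apply: run_cast; first by apply: run_while0; rewrite /filled /tops E.
    by [].
  by eqst.
pose t1 := upd t i (unary a.+1).
have R1 : run (Push i (fun _ => Comma)) t 2 t1.
  by apply: (run_cast (run_push _ _ _)); rewrite ?Ei.
have R2 := @run_mv1 11 j t1 Comma (unary v) _ _.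
apply: run_cast; first apply: (run_whileS _ (run_seq R1 (R2 _ _)) (IH a.+1 b.+1 _ _ _ _)).
- by rewrite /filled /tops E.
- by lia.
- by rewrite /t1; updr.
- by updr.
- by rewrite /t1; updr.
- by rewrite /t1; updr; rewrite Ej.
- by lia.
- by rewrite /t1 !addnS; eqst.
Qed.

(** Common units are removed from both registers and parked on stack 11, after
    which the first one is empty exactly if it was the smaller one. *)
Lemma run_compare (i j : nat) a b c (t : stacks) : i != j -> 14 < i -> 14 < j ->
  t 11 = unary c -> t i = unary a -> t j = unary b ->
  run (While (fun h => filled i h && filled j h) (Pop i ;; mv1 j 11)) t
    (6 * a + 1)
    (upd (upd (upd t i (unary (a - b))) j (unary (b - a))) 11 (unary (minn a b + c))).
Proof.
move=> Hij Hi Hj; elim: a b c t => [|a IH] b c t E Ei Ej.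
  apply: run_cast; first by apply: run_while0; rewrite /filled /tops Ei.
    by [].
  by rewrite sub0n subn0 min0n; eqst.
case: b Ej => [|b] Ej.
  apply: run_cast; first by apply: run_while0; rewrite /filled /tops Ej andbF.
    by lia.
  by rewrite sub0n subn0 minn0; eqst.
pose t1 := upd t i (unary a).
have R1 : run (Pop i) t 1 t1 by apply: (run_cast (run_pop _ _)); rewrite ?Ei.
have R2 := @run_mv1 j 11 t1 Comma (unary b) _ _.
apply: run_cast; first apply: (run_whileS _ (run_seq R1 (R2 _ _)) (IH b c.+1 _ _ _ _)).
- by rewrite /filled /tops Ei Ej.
- by lia.
- by rewrite /t1; updr.
- by rewrite /t1; updr; rewrite E.
- by rewrite /t1; updr.
- by updr.
- by lia.
- by rewrite /t1 subSS minnSS addnS addSn; eqst.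
Qed.

Lemma run_op_block o i r m N x y : i < NR -> nth 0 r i <= size m ->
  nth 0 r i <= N -> size (mword m) <= N ->
  size x.1 + size x.2 <= N -> size y.1 + size y.2 <= N ->
  exists s1 T1 T2,
    [/\ run (op_block o i) (computed (enc_data r m) x y) T1 s1,
        run cleanup s1 T2 (enc_data r (put m (nth 0 r i) (xop o x y))) &
        T1 + T2 <= 2000 * (N + 1)].
Proof.
move=> Hi Him HiN HN Sx Sy; set s := computed _ _ _; set k := nth 0 r i in Him HiN *.
have Hmul a b : size (mulb a (rev b)) <= size a + 2 * size b.
  by rewrite -(size_rev b); exact: size_mulb.
have M1 := Hmul x.1 y.1; have M2 := Hmul x.1 y.2.
have M3 := Hmul x.2 y.1; have M4 := Hmul x.2 y.2.
have Er : s (reg i) = unary k by exact: reg_stacksE.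
have clean s1 T : run (op_block o i) s T s1 -> T + 8 * (3 * (4 * N + 2) + 1) <= 2000 * (N + 1) ->
    (forall j, 3 <= j < 11 -> size (s1 j) <= 4 * N + 2) ->
    (fun i => if i \in [:: 3; 4; 5; 6; 7; 8; 9; 10] then [::] else s1 i) =
       enc_data r (put m k (xop o x y)) ->
    exists s1 T1 T2, [/\ run (op_block o i) s T1 s1,
        run cleanup s1 T2 (enc_data r (put m k (xop o x y))) & T1 + T2 <= 2000 * (N + 1)].
  move=> R HT Hsz <-; exists s1, T, (8 * (3 * (4 * N + 2) + 1)); split => //.
  by apply: (run_clears (n := 4 * N + 2)) => j; rewrite !inE => Hj; apply: Hsz; lia.
case: o clean => [||sub] clean.
- have R := @run_store (reg i) 10 9 m k (xop OMul x y) s isT Him isT isT isT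
    erefl erefl erefl Er erefl erefl.
  apply: (clean _ _ R).
  + by rewrite /=; lia.
  + by move=> j Hj; rewrite /s /computed; updr; rewrite ?size_map; lia.
  + by apply: funext => j; rewrite !inE /s /computed /enc_data; updr; subst.
- have R1 := @run_addin false 5 3 x.1 y.1 s isT isT isT erefl erefl erefl erefl erefl.
  set s1 := upd _ 13 _ in R1; pose s2 := upd s1 13 [::].
  have R2 : run (Pop 13) s1 1 s2 by apply: (run_cast (run_pop _ _)).
  have R3 := @run_store (reg i) 3 4 m k (xop OAddSame x y) s2 isT Him isT isT isT
    erefl erefl erefl Er erefl erefl.
  have Z := run_seq R1 (run_seq R2 R3).
  apply: (clean _ _ Z).
  + by rewrite /= size_adds; lia.
  + by move=> j Hj; rewrite /s2 /s1 /s /computed; updr; rewrite ?size_map ?size_adds; lia.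
  + by apply: funext => j; rewrite !inE /s2 /s1 /s /computed /enc_data; updr; subst.
- have R1 := @run_addin sub 8 7 (mulb x.1 (rev y.2)) (mulb x.2 (rev y.1)) s
    isT isT isT erefl erefl erefl erefl erefl.
  set s1 := upd _ 13 _ in R1; pose s2 := upd s1 13 [::].
  have R2 : run (Pop 13) s1 1 s2 by apply: (run_cast (run_pop _ _)).
  have R3 := @run_store (reg i) 7 9 m k (xop (OCross sub) x y) s2 isT Him isT isT isT
    erefl erefl erefl Er erefl erefl.
  have Z := run_seq R1 (run_seq R2 R3).
  apply: (clean _ _ Z).
  + by rewrite /= size_adds; lia.
  + by move=> j Hj; rewrite /s2 /s1 /s /computed; updr; rewrite ?size_map ?size_adds; lia.
  + by apply: funext => j; rewrite !inE /s2 /s1 /s /computed /enc_data; updr; subst.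
Qed.

Lemma run_block p o r m N : regs_ok o -> in_range o r m ->
  (forall i, nth 0 r i <= N) -> size (mword m) <= N ->
  run (block p o) (enc_data r m) (5000 * (N + 1) ^ 2 + 2 * PN) (enc (xexec o (XState p r m))).
Proof.
move=> Hreg Hin HrN HN.
have B : 5000 * (N + 1) <= 5000 * (N + 1) ^ 2 by nia.
have SU i v : i < NR -> enc_data (set_nth 0 r i v) m = upd (enc_data r m) (reg i) (unary v).
  by move=> Hi; rewrite /enc_data reg_stacks_set //; eqst.
have GR i : i < NR -> enc_data r m (reg i) = unary (nth 0 r i) by exact: reg_stacksE.
case: o Hreg Hin => [i|i|i|i j|i j l|l|i b|o i j k|i j l] /= Hreg Hin.
- apply: run_cast; first apply: (run_seq (run_clear (GR _ Hreg))).
  + by rewrite -[[::]]/(unary 0) -SU //; exact: run_setpc.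
  + by rewrite size_nseq; have := HrN i; lia.
  + by [].
- apply: run_cast; first apply: (run_seq (run_push _ _ _)).
  + by rewrite GR // -[_ :: _]/(unary (nth 0 r i).+1) -SU //; exact: run_setpc.
  + by lia.
  + by [].
- apply: run_cast; first apply: (run_seq (run_pop _ _)).
  + have -> : behead (enc_data r m (reg i)) = unary (nth 0 r i).-1.
      by rewrite GR //; case: (nth 0 r i).
    by rewrite -SU //; exact: run_setpc.
  + by lia.
  + by [].
- case/and3P: Hreg => Hij Hi Hj.
  have Hne : reg i != reg j by rewrite /reg eqn_add2l.
  have Gi : 14 < reg i by []; have Gj : 14 < reg j by [].
  have R1 := run_clear (GR _ Hi); set s1 := upd _ _ _ in R1.
  have R2 := @run_mvall (reg j) 11 s1 (unary (nth 0 r j)) _ _.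
  set s2 := upd _ (reg j) [::] in R2.
  have R3 := @run_restore (reg i) (reg j) (nth 0 r j) 0 0 s2 Hne isT isT.
  set s3 := upd _ 11 [::] in R3.
  have E : s3 = enc_data (set_nth 0 r i (nth 0 r j)) m.
    by rewrite SU // /s3 /s2 /s1 !addn0; eqst; rewrite -GR.
  rewrite E in R3.
  apply: run_cast; first apply: (run_seq R1 (run_seq (R2 _ _) (run_seq (R3 _ _ _) (run_setpc _ _ _)))).
  + by rewrite /reg; lia.
  + by rewrite /s1; updr; rewrite GR.
  + by rewrite /s2 /s1; updr; rewrite rev_nseq cats0.
  + by rewrite /s2 /s1; updr.
  + by rewrite /s2 /s1; updr.
  + by rewrite !size_nseq; have := HrN i; have := HrN j; lia.
  + by [].
- case/and3P: Hreg => Hij Hi Hj.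
  have Hne : reg i != reg j by rewrite /reg eqn_add2l.
  have Gi : 14 < reg i by []; have Gj : 14 < reg j by [].
  set a := nth 0 r i; set b := nth 0 r j.
  have R1 := @run_compare (reg i) (reg j) a b 0 (enc_data r m) Hne isT isT erefl
    (GR _ Hi) (GR _ Hj).
  set s1 := upd _ 11 _ in R1.
  have R2 := @run_restore (reg i) (reg j) (minn a b) (a - b) (b - a) s1 Hne isT isT.
  set s2 := upd _ 11 [::] in R2.
  have E : s2 = enc_data r m.
    rewrite /s2 /s1; eqst.
    + by rewrite GR //; congr unary; lia.
    + by rewrite GR //; congr unary; lia.
  have {}R2 : run (While (filled 11) (Push (reg i) (fun _ => Comma) ;; mv1 11 (reg j)))
      s1 (7 * minn a b + 1) (enc_data r m).
    rewrite -E; apply: R2; rewrite /s1; updr => //.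
    by rewrite addn0.
  apply: run_cast; first apply: (run_seq R1 (run_if (T := 7 * minn a b + 1 + 2 * PN) (s' := enc (XState (if a <= b then l else p.+1) r m)) _)).
  + have -> : filled (reg i) (tops s1) = ~~ (a <= b).
      rewrite /filled /tops /s1; updr; rewrite -subn_eq0.
      by case: (a - b).
    by case: (a <= b); apply: (run_seq R2 (run_setpc _ _ _)).
  + by have := HrN i; have := HrN j; rewrite -/a -/b; lia.
  + by [].
- by apply: run_cast; [exact: run_setpc|lia|].
- pose s1 := upd (enc_data r m) 3 [:: Bit b]; pose s2 := upd s1 4 [:: Bit true].
  have R1 : run (Push 3 (fun=> Bit b)) (enc_data r m) 2 s1 by apply: (run_cast (run_push _ _ _)).
  have R2 : run (Push 4 (fun=> Bit true)) s1 2 s2 by apply: (run_cast (run_push _ _ _)).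
  have R3 := @run_store (reg i) 3 4 m _ (xconst b) s2 isT Hin isT isT
    isT erefl erefl erefl (GR _ Hreg) erefl erefl.
  set s3 := upd _ 4 [::] in R3.
  have E : s3 = enc_data r (put m (nth 0 r i) (xconst b)).
    by rewrite /s3 /s2 /s1 /enc_data; eqst.
  rewrite E in R3.
  apply: run_cast; first apply: (run_seq R1 (run_seq R2 (run_seq R3 (run_setpc _ _ _)))).
  + by rewrite /=; have := HrN i; lia.
  + by [].
- case/and3P: Hreg => Hi Hj Hk; case/and3P: Hin => Him Hjm Hkm.
  have R1 := run_operands Hj Hk Hjm Hkm HN (HrN _) (HrN _).
  have Sx := leq_trans (size_nth_mword Hjm) HN.
  have Sy := leq_trans (size_nth_mword Hkm) HN.
  have [s1 [T1 [T2 [R2 R3 HT]]]] := run_op_block o Hi Him (HrN _) HN Sx Sy.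
  apply: run_cast; first apply: (run_seq R1 (run_seq R2 (run_seq R3 (run_setpc _ _ _)))).
  + by lia.
  + by [].
- case/andP: Hreg => Hi Hj; case/andP: Hin => Him Hjm.
  have R1 := run_operands Hi Hj Him Hjm HN (HrN _) (HrN _).
  have Sx := leq_trans (size_nth_mword Him) HN.
  have Sy := leq_trans (size_nth_mword Hjm) HN.
  set x := nth u0 m _ in R1 Sx *; set y := nth u0 m _ in R1 Sy *.
  have Hmul a b : size (mulb a (rev b)) <= size a + 2 * size b.
    by rewrite -(size_rev b); exact: size_mulb.
  have M1 := Hmul x.1 y.1; have M2 := Hmul x.1 y.2.
  have M3 := Hmul x.2 y.1; have M4 := Hmul x.2 y.2.
  set s := computed _ _ _ in R1.
  have R2 := @run_addin true 7 8 (mulb x.2 (rev y.1)) (mulb x.1 (rev y.2)) s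
    isT isT isT erefl erefl erefl erefl erefl.
  set s1 := upd _ 13 _ in R2; pose s2 := upd s1 13 [::].
  have R3 : run (Pop 13) s1 1 s2 by apply: (run_cast (run_pop _ _)).
  have R4 := @run_clears [:: 3; 4; 5; 6; 7; 8; 9; 10] s2 (4 * N + 2) _.
  set s3 := (fun i => _) in R4.
  have E3 : s3 = enc_data r m.
    by apply: funext => q; rewrite /s3 !inE /s2 /s1 /s /computed /enc_data; updr; subst.
  rewrite E3 in R4.
  have {}R4 : run cleanup s2 (8 * (3 * (4 * N + 2) + 1)) (enc_data r m).
    apply: R4 => q; rewrite !inE => Hq; rewrite /s2 /s1 /s /computed.
    by updr; rewrite ?size_map ?size_adds; lia.
  have R5 l' := run_seq R3 (run_seq R4 (run_setpc l' r m)).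
  apply: run_cast; first apply: (run_seq R1 (run_seq R2 (run_if (s' := enc (XState (if xle x y then l else p.+1) r m)) _))).
  + have -> : bit (tops s1 13) = ~~ xle x y by rewrite /xle negbK.
    by case: (xle x y); apply: R5.
  + by lia.
  + by [].
Qed.

End Blocks.

(** * Simulation of an arithmetic program *)

Fixpoint dispatch (bs : seq cmd) : cmd :=
  if bs is b :: bs' then Pop 2 ;; If (fun h => ~~ filled 2 h) b (dispatch bs')
  else Skip.

Lemma run_dispatch bs q (s : stacks) T s' : s 2 = unary q.+1 -> q < size bs ->
  run (nth Skip bs q) (upd s 2 [::]) T s' ->
  run (dispatch bs) s (3 * q.+1 + T) s'.
Proof.
elim: bs q s => // b bs IH q s E Hq H.
have R1 : run (Pop 2) s 1 (upd s 2 (unary q)).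
  by apply: (run_cast (run_pop _ _)); rewrite ?E.
case: q Hq E H R1 => [|q] Hq E H R1.
  apply: run_cast; first apply: (run_seq R1 (run_if (T := T) (s' := s') _)).
  - exact: H.
  - by lia.
  - by [].
apply: run_cast; first apply: (run_seq R1 (run_if (T := 3 * q.+1 + T) (s' := s') _)).
- rewrite /filled /tops /upd /=; apply: IH => //.
  by move: H => /=; congr run; eqst.
- by lia.
- by [].
Qed.

Definition is_minus (x : option sym) := if x is Some Minus then true else false.

Arguments is_minus : simpl never.

Section Simulator.

Variables (NR : nat) (prog : seq xinstr).
Hypothesis NR_gt0 : 0 < NR.
Hypothesis prog_ok : all (regs_ok NR) prog.

Local Notation PN := (size prog).

Definition instr_at p := nth (XGoto 0) prog p.

Definition body : cmd :=
  dispatch (mkseq (fun q => block PN (PN.-1 - q) (instr_at (PN.-1 - q))) PN).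

(** Minus signs are dropped, since all input numbers are nonnegative, and the
    commas are counted because index register 0 must hold the number of input
    numbers. *)
Definition read_loop : cmd :=
  While (filled 0)
    (If (fun h => is_comma (h 0)) (Push (reg 0) (fun _ => Comma)) Skip ;;
     If (fun h => is_minus (h 0)) Skip (Push 1 (top 0)) ;;
     Pop 0).

Definition prologue : cmd := read_loop ;; mvall 1 0 ;; setpc PN 0.

(** Skipping the first block leaves it, reversed, on stack 1. *)
Definition epilogue : cmd := skip_block ;; mvall 1 (reg NR).

Definition simulator : cmd :=
  prologue ;; While (filled 2) body ;; epilogue.

Definition xstep (x : xst) : xst :=
  if PN <= xpc x then x else xexec (instr_at (xpc x)) x.

Lemma run_body x N : xpc x < PN -> in_range (instr_at (xpc x)) (xidx x) (xmem x) ->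
  (forall i, nth 0 (xidx x) i <= N) -> size (mword (xmem x)) <= N ->
  run body (enc NR PN x) (5000 * (N + 1) ^ 2 + 5 * PN) (enc NR PN (xstep x)).
Proof.
case: x => p r m /= Hp Hin Hr Hm; rewrite /xstep /= leqNgt Hp /=.
have Hq : PN - p = (PN.-1 - p).+1 by move: Hp; clear; lia.
have Hlt : PN.-1 - p < PN by move: Hp; clear; lia.
have Hp' : PN.-1 - (PN.-1 - p) = p by move: Hp; clear; lia.
have Hdata : upd (enc NR PN (XState p r m)) 2 [::] = enc_data NR r m.
  by clear; rewrite /enc /enc_data; eqst.
have Hreg : regs_ok NR (instr_at p) by exact: (all_nthP _ prog_ok).
have R := @run_block NR PN p (instr_at p) r m N Hreg Hin Hr Hm.
apply: run_cast; first apply: (@run_dispatch _ (PN.-1 - p)).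
- by rewrite /enc /upd /= Hq.
- by rewrite size_mkseq.
- rewrite nth_mkseq // Hp' Hdata; exact: R.
- by move: Hp; clear; lia.
- by [].
Qed.

Definition unsigned (r : Defs.ratio) : urat := (rev r.1.2, rev r.2.2).
Definition ratios_word (rs : seq Defs.ratio) : seq sym :=
  flatten [seq rcons (ratio_word r) Comma | r <- rs].

Lemma mword_unsigned rs :
  mword (map unsigned rs) =
  [seq a <- ratios_word rs | ~~ is_minus (Some a)].
Proof.
elim: rs => // -[[s1 d1] [s2 d2]] rs IH; rewrite /ratios_word /= filter_cat -/(ratios_word rs) -IH.
rewrite mword_cons -cat_rcons; congr (_ ++ _).
have F l : [seq a <- [seq Bit b | b <- l] | ~~ is_minus (Some a)] = bits l.
  by elim: l => //= b l ->.
rewrite filter_rcons /= /ratio_word /uword /numeral_word /= !revK; congr rcons.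
by case: s1; case: s2; rewrite !(filter_cat, F) //= ?F.
Qed.

Lemma count_commas rs :
  count (fun a => is_comma (Some a)) (ratios_word rs) = size rs.
Proof.
elim: rs => // -[[s1 d1] [s2 d2]] rs IH; rewrite /ratios_word /= count_cat -/(ratios_word rs) IH.
have F l : count (fun a => is_comma (Some a)) [seq Bit b | b <- l] = 0 by elim: l.
by rewrite -cats1 count_cat /= /ratio_word /numeral_word /=;
  case: s1; case: s2; rewrite !(count_cat, F) //= ?F.
Qed.

Lemma run_read_loop l z c (t : stacks) : t 0 = l -> t 1 = z -> t (reg 0) = unary c ->
  run read_loop t (15 * size l + 1)
   (upd (upd (upd t 0 [::]) 1 (rev [seq a <- l | ~~ is_minus (Some a)] ++ z))
      (reg 0) (unary (count (fun a => is_comma (Some a)) l + c))).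
Proof.
elim: l z c t => [|a l IH] z c t E0 E1 Er.
  apply: run_cast; first by apply: run_while0; rewrite /filled /tops E0.
    by [].
  by eqst.
pose c1 := is_comma (Some a) + c.
pose t1 := upd t (reg 0) (unary c1).
have R1 : run (If (fun h => is_comma (h 0)) (Push (reg 0) (fun _ => Comma)) Skip) t 4 t1.
  apply: (run_if (T := 2)); rewrite /t1 /c1 /tops E0 -[ohead _]/(Some a).
  case: (is_comma (Some a)).
    by apply: (run_cast (run_push _ _ _)) => //; rewrite Er.
  by apply: (run_cast (run_skip _)) => //; rewrite -Er; eqst.
pose z1 := if is_minus (Some a) then z else a :: z.
pose t2 := upd t1 1 z1.
have R2 : run (If (fun h => is_minus (h 0)) Skip (Push 1 (top 0))) t1 4 t2.
  apply: (run_if (T := 2)); rewrite /t2 /z1 /tops /t1 {1}/upd E0 -[ohead _]/(Some a).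
  case: (is_minus (Some a)).
    by apply: (run_cast (run_skip _)) => //; rewrite -E1; eqst.
  by apply: (run_cast (run_push _ _ _)) => //; rewrite /top /tops /upd /= E0 E1.
apply: run_cast; first apply: (run_whileS _ (run_seq R1 (run_seq R2 (run_pop _ _))) (IH z1 c1 _ _ _ _)).
- by rewrite /filled /tops E0.
- by rewrite /t2 /t1 /upd /= E0.
- by [].
- by [].
- by rewrite /=; lia.
- rewrite /t2 /t1 /z1 /c1 /=; eqst.
  all: try (by congr unary; lia).
  by case: a {E0 R1 R2 c1 z1 t1 t2} => [b|||] /=; rewrite -?cat_rcons -?rev_cons.
Qed.

Lemma run_prologue rs :
  run prologue (input_stacks (ratios_word rs)) (20 * size (ratios_word rs) + 2 + 2 * PN)
    (enc NR PN (XState 0 [:: size rs] (map unsigned rs))).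
Proof.
have R1 := @run_read_loop (ratios_word rs) [::] 0 (input_stacks (ratios_word rs)) erefl erefl erefl.
set s1 := upd _ _ _ in R1.
have R2 := @run_mvall 1 0 s1 (rev (mword (map unsigned rs))) isT _.
set s2 := upd _ 1 [::] in R2.
have E2 : s2 = enc_data NR [:: size rs] (map unsigned rs).
  rewrite /s2 /s1 /enc_data /reg_stacks; apply: funext => i; updr; subst; rewrite ?revK //.
  - by rewrite /input_stacks cats0.
  - have -> : 14 < reg 0 < 15 + NR by rewrite /reg; lia.
    by rewrite count_commas addn0.
  - rewrite /input_stacks; updr; case: ifP => // Hi; unfold reg in *.
    by case E: (i - 15) => [|j]; [exfalso; lia | rewrite /= nth_nil].
rewrite E2 in R2.
apply: run_cast; first apply: (run_seq R1 (run_seq (R2 _) (run_setpc _ _ _ _ _))).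
- by rewrite /s1 /upd /= cats0 mword_unsigned.
- rewrite size_rev mword_unsigned size_filter.
  by have := count_size (fun a => ~~ is_minus (Some a)) (ratios_word rs); lia.
- by [].
Qed.

Lemma run_epilogue x u m : xmem x = u :: m ->
  exists2 s', run epilogue (enc NR PN x) (20 * size (mword (xmem x)) + 20) s' &
    s' (reg NR) = mword [:: u].
Proof.
case: x => p r m' /= ->; set s := enc _ _ _.
have E0 : s 0 = uword u ++ Comma :: mword m by rewrite /s /enc /= mword_cons.
have R1 := run_skip_block E0; set s1 := upd _ 1 _ in R1.
have R2 := @run_mvall 1 (reg NR) s1 (rev (mword [:: u])) isT _.
eexists; first apply: run_cast (run_seq R1 (R2 _)) _ erefl.
- by rewrite /s1 /upd /= mword_cons -cats1 /mword /= cats0.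
- by rewrite !mword_cons size_rev !size_cat /=; lia.
- rewrite revK /s1 /upd /= /s /enc /upd /= /reg_stacks /reg.
  by rewrite eqxx ltnn andbF cats0.
Qed.

Lemma holds_tape N (s : stacks) tp (o : 'I_N.+2) :
  holds s tp -> tape_holds (tp o) (s o).
Proof.
move=> [/(_ o)[Hl Hr] _].
have [m E1] : exists m, (tp o).1 = lit [::] ++ nseq m None by exact: stripP.
have [n E2] := stripP Hr.
by exists m, n; rewrite [tp o]surjective_pairing E1 E2.
Qed.

Definition simulator_machine : tm := machine (14 + NR) (compile 0 simulator).

Definition xrun (rs : seq Defs.ratio) i : xst :=
  iter i xstep (XState 0 [:: size rs] (map unsigned rs)).

Lemma xrunS rs i : xrun rs i.+1 = xstep (xrun rs i).
Proof. by []. Qed.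

Hypothesis simulator_ok : stacks_below (15 + NR).+1 simulator.

(** The result of a halted program is its first memory cell. *)
Lemma simulation rs n N :
  (forall i, i < n -> xpc (xrun rs i) < PN /\
     in_range (instr_at (xpc (xrun rs i))) (xidx (xrun rs i)) (xmem (xrun rs i))) ->
  PN <= xpc (xrun rs n) ->
  (forall i, i <= n -> (forall j, nth 0 (xidx (xrun rs i)) j <= N) /\
     size (mword (xmem (xrun rs i))) <= N) ->
  xmem (xrun rs n) != [::] ->
  let M := simulator_machine in let w := ratios_word rs in
  exists (tau : nat -> nat) (T : nat),
    [/\ forall i, tau i < tau i.+1, tau n <= T,
        T <= 20 * size w + 2 + 2 * PN + n * (5000 * (N + 1) ^ 2 + 5 * PN + 2) +
             (20 * N + 20) + 1,
        forall i, i <= n ->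
          tape_holds ((tm_run M w (tau i)).2 ord0) (mword (xmem (xrun rs i))) &
        tm_final (tm_run M w T).1 /\
        tape_holds ((tm_run M w T).2 ord_max)
          (mword [:: nth u0 (xmem (xrun rs n)) 0])].
Proof.
move=> Hrun Hend Hbnd Hmem M w.
case Em : (xmem (xrun rs n)) Hmem => [|u m] // _.
have [sf Hfin Hsf] := run_epilogue Em.
have Hbody i : i < n -> filled 2 (tops (enc NR PN (xrun rs i))) /\
    run body (enc NR PN (xrun rs i)) (5000 * (N + 1) ^ 2 + 5 * PN)
      (enc NR PN (xrun rs i.+1)).
  move=> Hi; have [Hpc Hin] := Hrun i Hi; have [Hr Hm] := Hbnd i (ltnW Hi).
  split; last exact: run_body.
  rewrite /filled /tops /enc /upd /=.
  by have -> : PN - xpc (xrun rs i) = (PN - xpc (xrun rs i)).-1.+1 by lia.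
have Hstop : ~~ filled 2 (tops (enc NR PN (xrun rs n))).
  rewrite /filled /tops /enc /upd /=.
  by have -> : PN - xpc (xrun rs n) = 0 by lia.
have [tau [T [H1 H2 H3 H4 [H5 H6]]]] :=
  @loop_trace (14 + NR) prologue (filled 2) body epilogue w n
    (fun i => enc NR PN (xrun rs i)) _ _ _ sf simulator_ok (run_prologue rs)
    Hbody Hstop Hfin.
exists tau, T; split=> //.
- have [_ HN] := Hbnd n (leqnn n); apply: leq_trans H3 _; rewrite -/w.
  by move: HN; clear; lia.
- by move=> i Hi; exact: (holds_tape ord0 (H4 i Hi)).
- by split=> //; have := holds_tape ord_max H6; rewrite Hsf.
Qed.

End Simulator.

(** * Values of unreduced fractions *)

Section Values.

Local Open Scope ring_scope.

Definition uval (u : urat) : rat := (bval u.1)%:R / (bval u.2)%:R.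
Definition proper_urat (u : urat) : bool :=
  [&& u.1 != [::], u.2 != [::] & (0 < bval u.2)%N].

Definition erase (o : xinstr) : instr :=
  match o with
  | XZero i => IZero i
  | XSucc i => ISucc i
  | XPred i => IPred i
  | XCopy i j => ICopy i j
  | XJump i j l => IJump i j l
  | XGoto l => IJump 0 0 l
  | XConst i b => RConst i (b%:R)
  | XOp OMul i j k => ROp Mul i j k
  | XOp OAddSame i j k | XOp (OCross false) i j k => ROp Defs.Add i j k
  | XOp (OCross true) i j k => ROp Defs.Sub i j k
  | XLe i j l => RJump i j l
  end.

(** The conditions under which an operation on fractions has the value of the
    operation on rationals: no mismatch of denominators and no negative
    result. *)
Definition numeric_ok (o : binop) (x y : urat) : Prop :=
  match o with
  | OAddSame => bval x.2 = bval y.2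
  | OCross true => uval y <= uval x
  | _ => True
  end.

Definition step_ok (o : xinstr) (r : seq nat) (m : seq urat) : Prop :=
  in_range o r m /\
  if o is XOp b _ j k then
    numeric_ok b (nth u0 m (nth 0%N r j)) (nth u0 m (nth 0%N r k))
  else True.

Lemma uval_ge0 u : 0 <= uval u.
Proof. by rewrite /uval divr_ge0. Qed.

Lemma bvalM a b : bval (mulb a (rev b)) = (bval a * bval b)%N.
Proof. by rewrite bval_mulb revK. Qed.

Lemma uval_le x y : proper_urat x -> proper_urat y ->
  (uval x <= uval y) = (bval x.1 * bval y.2 <= bval x.2 * bval y.1)%N.
Proof.
move=> /and3P[_ _ Hx] /and3P[_ _ Hy]; rewrite /uval.
rewrite ler_pdivrMr ?ltr0n // mulrAC ler_pdivlMr ?ltr0n // -!natrM ler_nat.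
by rewrite (mulnC (bval y.1)).
Qed.

Lemma uval_xle x y : proper_urat x -> proper_urat y -> xle x y = (uval x <= uval y).
Proof. by move=> Hx Hy; rewrite uval_le // /xle borrowE !bvalM -leqNgt. Qed.

Lemma uval_xconst b : uval (xconst b) = b%:R.
Proof. by case: b; rewrite /uval /= divr1. Qed.

Lemma uval_u0 : uval u0 = 0.
Proof. by rewrite /uval mul0r. Qed.

Lemma proper_xop o x y : proper_urat x -> proper_urat y -> proper_urat (xop o x y).
Proof.
move=> /and3P[x1 x2 x3] /and3P[y1 y2 y3].
have R (l : seq bool) : l != [::] -> rev l != [::].
  by rewrite -!size_eq0 size_rev.
have S sub a b : adds sub a b != [::] by rewrite -size_eq0 size_adds.
case: o => [||sub]; rewrite /proper_urat /= ?mulb_neq0 ?S ?R //= ?bvalM ?muln_gt0 ?x3 ?y3 //.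
by rewrite x2.
Qed.

Lemma uval_xop o x y : proper_urat x -> proper_urat y -> numeric_ok o x y ->
  uval (xop o x y) = match o with
                     | OMul => uval x * uval y
                     | OAddSame | OCross false => uval x + uval y
                     | OCross true => uval x - uval y
                     end.
Proof.
move=> Hx Hy; have /and3P[_ _ Hx2] := Hx; have /and3P[_ _ Hy2] := Hy.
have Nx : (bval x.2)%:R != 0 :> rat by rewrite pnatr_eq0 -lt0n.
have Ny : (bval y.2)%:R != 0 :> rat by rewrite pnatr_eq0 -lt0n.
case: o => [|/= E|[] /= H]; rewrite /uval /= ?bvalM ?natrM.
- by move=> _; rewrite invfM mulrACA.
- by rewrite bval_adds natrD -E mulrDl.
- have H' : (bval x.2 * bval y.1 <= bval x.1 * bval y.2)%N.
    by rewrite (mulnC (bval x.2)) (mulnC (bval x.1)) -uval_le.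
  rewrite bval_subs ?bvalM // natrB // !natrM.
  by field; rewrite Nx Ny.
- by rewrite bval_adds !bvalM natrD !natrM; field; rewrite Nx Ny.
Qed.

Definition values (x : xst) : ram := Ram (xpc x) (xidx x) (map uval (xmem x)).

Lemma nth_uval m k : nth 0 (map uval m) k = uval (nth u0 m k).
Proof.
case: (ltnP k (size m)) => H; first by rewrite (nth_map u0).
by rewrite !nth_default ?size_map // uval_u0.
Qed.

Lemma map_put m k u : map uval (put m k u) = set_nth 0 (map uval m) k (uval u).
Proof.
apply: (@eq_from_nth _ 0); first by rewrite size_map !size_set_nth size_map.
by move=> i _; rewrite nth_uval !nth_set_nth /= nth_uval; case: eqP.
Qed.

Lemma all_put (p : pred urat) m k u : p u0 -> p u -> all p m -> all p (put m k u).
Proof.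
move=> H0 Hu /(all_nthP u0) Hm; apply/(all_nthP u0) => i.
rewrite size_set_nth nth_set_nth /=; case: eqP => // _ _.
case: (ltnP i (size m)) => H; first exact: Hm.
by rewrite nth_default.
Qed.

Lemma nth_proper m k : all proper_urat m -> proper_urat (nth u0 m k).
Proof.
move=> Hm; case: (ltnP k (size m)) => H; first exact: (all_nthP u0 Hm).
by rewrite nth_default.
Qed.

Lemma xexec_values o x : all proper_urat (xmem x) -> step_ok o (xidx x) (xmem x) ->
  ram_exec (erase o) (values x) = values (xexec o x) /\
  all proper_urat (xmem (xexec o x)).
Proof.
case: x => p r m /= Hm [_ Hok].
case: o Hok => [i|i|i|i j|i j l|l|i b|o i j k|i j l] /= Hok; split=> //.
- by rewrite /jump_if leqnn.
- by rewrite /values /= /put_mem /= map_put uval_xconst.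
- exact: all_put.
- have Hx := nth_proper (nth 0%N r j) Hm; have Hy := nth_proper (nth 0%N r k) Hm.
  rewrite /values /= map_put uval_xop //.
  by case: o Hok => [||[]] Hok; rewrite /= /put_mem /get_mem /get_idx /= !nth_uval.
- by apply: all_put => //; apply: proper_xop; exact: nth_proper.
- rewrite /jump_if /get_mem /get_idx /values /= !nth_uval uval_xle //; exact: nth_proper.
Qed.

Lemma numeral_valueE (z : numeral) :
  numeral_value z = (-1) ^+ z.1 * (bval (rev z.2))%:Z.
Proof.
rewrite /numeral_value; congr (_ * Posz _).
elim/last_ind: z.2 => // s b IH; rewrite rev_rcons /= -cats1 foldl_cat /= IH.
by [].
Qed.

(** In a nonnegative ratio the two signs cancel, unless the numerator vanishes:
    either way the ratio equals its absolute value. *)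
Lemma ratio_value_unsigned r : proper_ratio r -> 0 <= ratio_value r ->
  uval (unsigned r) = ratio_value r /\ proper_urat (unsigned r).
Proof.
case/and3P => H1 H2 H3 H0; split; last first.
  rewrite /proper_urat /= -!size_eq0 !size_rev !size_eq0 H1 H2 lt0n /=.
  by apply: contraNneq H3 => E; rewrite numeral_valueE E mulr0.
rewrite -(ger0_norm H0) /ratio_value !numeral_valueE normrM normfV.
by rewrite !intrM !normrM !rmorphXn /= !normrX !rmorphN1 !normrN1 !expr1n !mul1r
  !normr_nat.
Qed.

Lemma encodes_mword m : all proper_urat m -> encodes (mword m) (map uval m).
Proof.
move=> Hm; exists [seq ((false, rev u.1), (false, rev u.2)) | u <- m]; split.
- rewrite all_map; apply/allP => u /(allP Hm)/and3P[H1 H2 H3].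
  rewrite /= /proper_ratio /= -!size_eq0 !size_rev !size_eq0 H1 H2 /=.
  by rewrite numeral_valueE /= mul1r revK; case: (bval u.2) H3.
- rewrite -map_comp; apply: eq_map => u /=.
  by rewrite /ratio_value !numeral_valueE /= !mul1r !revK.
- by rewrite -map_comp; congr flatten; apply: eq_map.
Qed.

Lemma ratio_values_unsigned rs : all proper_ratio rs ->
  (forall r, r \in rs -> 0 <= ratio_value r) ->
  map uval (map unsigned rs) = map ratio_value rs /\ all proper_urat (map unsigned rs).
Proof.
elim: rs => //= r rs IH /andP[H1 H2] H0.
have [r' Hr|-> ->] := IH H2; first by apply: H0; rewrite in_cons Hr orbT.
have [||-> ->] := @ratio_value_unsigned r; rewrite ?H0 ?mem_head //.
Qed.

End Values.

Section Executes.

Variables (NR : nat) (prog : seq xinstr).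
Hypothesis NR_gt0 : 0 < NR.
Hypothesis prog_ok : all (regs_ok NR) prog.
Hypothesis simulator_ok : stacks_below (15 + NR).+1 (simulator NR prog).

Definition small (B : nat) (r : seq nat) (m : seq urat) : Prop :=
  (forall j, nth 0 r j <= B) /\ size (mword m) <= B.

Lemma simulation_executes rs n B (M := simulator_machine NR prog)
    (w := ratios_word rs) (P := map erase prog) (inp := map ratio_value rs)
    (xs := xrun prog rs) :
  all proper_ratio rs -> (forall r, r \in rs -> (0 <= ratio_value r)%R) ->
  (forall i, i < n -> [/\ xpc (xs i) < size prog,
     step_ok (instr_at prog (xpc (xs i))) (xidx (xs i)) (xmem (xs i)) &
     small B (xidx (xs i)) (xmem (xs i))]) ->
  size prog <= xpc (xs n) -> small B (xidx (xs n)) (xmem (xs n)) ->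
  xmem (xs n) != [::] ->
  exists T : nat,
    [/\ T <= 20 * size w + n * (5000 * (B + 1) ^ 2 + 5 * size prog + 2) +
             2 * size prog + 20 * B + 23,
        ram_halted P (ram_run P inp n),
        nth 0%R (cells (ram_run P inp n)) 0 = uval (nth u0 (xmem (xs n)) 0),
        tm_final (tm_run M w T).1 /\
        (exists2 v, encodes v [:: uval (nth u0 (xmem (xs n)) 0)]
                  & tape_holds ((tm_run M w T).2 ord_max) v) &
        executes M w T P inp n].
Proof.
move=> Hrs H0 Hrun Hend Hsm Hmem.
have [Ev Hp] := ratio_values_unsigned Hrs H0.
have Hval i : i <= n -> ram_run P inp i = values (xs i) /\ all proper_urat (xmem (xs i)).
  elim: i => [|i IH] Hi; first by rewrite /ram_run /values /= Ev size_map.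
  have [Hpc Hok _] := Hrun i Hi; have [Er Hpi] := IH (ltnW Hi).
  have [Ee Hpe] := xexec_values Hpi Hok.
  rewrite /ram_run iterS -/(ram_run _ _ _) Er /xs xrunS /xstep leqNgt Hpc /=.
  split=> //; rewrite -Ee /ram_step /ram_halted /= size_map leqNgt Hpc /=.
  by congr ram_exec; rewrite (nth_map (XGoto 0)).
have [En Hpn] := Hval n (leqnn n).
have [||tau [T [T1 T2 T3 T4 [T5 T6]]]] :=
  @simulation NR prog NR_gt0 prog_ok simulator_ok rs n B _ Hend _ Hmem.
- by move=> i Hi; have [H1 [H2 _] _] := Hrun i Hi.
- move=> i; rewrite leq_eqVlt => /orP[/eqP->|Hi]; first exact: Hsm.
  by have [] := Hrun i Hi.
exists T; split.
- by apply: leq_trans T3 _; rewrite -/w; lia.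
- by rewrite /ram_halted En size_map.
- by rewrite En /= nth_uval.
- split=> //; exists (mword [:: nth u0 (xmem (xs n)) 0]) => //.
  have H1 : all proper_urat [:: nth u0 (xmem (xs n)) 0] by rewrite /= nth_proper.
  exact: (encodes_mword H1).
- exists tau; split=> // i Hi; have [Ei Hpi] := Hval i Hi.
  exists (mword (xmem (xs i))); last exact: T4.
  by rewrite Ei; exact: encodes_mword.
Qed.

End Executes.

(** * The arithmetic program for the transport distance *)

(** Initially the support points occupy the cells from 0 on, the probabilities
    those from [2K], two per coordinate, [y1] those from [4K], [y2] those from
    [5K], and [t] is in cell [6K]. The support points are known, so the cells
    [0 .. K-1] are reused for a row of the table of cumulative probabilities.
    Four cells are appended: the constant 1, the accumulator of the result, and
    two temporaries.

    Registers 0 to 4 point to the constant, to [t], to the accumulator and to the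
    temporaries; 5, 6, 7 walk through the probabilities, [y1] and [y2]; 8 holds
    [K]; 9 and 10 are [j] and [j - 1]; 11 counts the coordinates on which [y1]
    and [y2] differ; 12 and 13 point to the probabilities that the coordinate
    equals and does not equal that of [y2]; 14 is zero. The numbers in
    parentheses are the positions of the jump targets. *)
Definition ot_program : seq xinstr :=
  [:: XZero 14; XCopy 1 0; XPred 1; XCopy 2 0; XSucc 2; XCopy 3 2; XSucc 3;
      XCopy 4 3; XSucc 4; XConst 0 true; XConst 2 false; XConst 3 false;
      XConst 4 false;
      (* (13) fill the first row and set the registers *)
      XJump 1 9 34; XConst 8 true;
      XSucc 9; XSucc 9; XSucc 9; XSucc 9; XSucc 9; XSucc 9; XSucc 8;
      XSucc 5; XSucc 5; XSucc 6; XSucc 6; XSucc 6; XSucc 6;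
      XSucc 7; XSucc 7; XSucc 7; XSucc 7; XSucc 7; XGoto 13;
      (* (34) next coordinate: choose the probabilities *)
      XJump 1 7 66; XCopy 12 5; XCopy 13 5; XSucc 13; XLe 0 7 40; XGoto 42;
      XCopy 12 13; XCopy 13 5;
      (* (42) if y1 and y2 agree, add to the accumulator *)
      XLe 6 7 44; XGoto 48; XLe 7 6 46; XGoto 48;
      XOp (OCross false) 2 2 13; XGoto 61;
      (* (48) otherwise update the row, from right to left *)
      XOp (OCross true) 3 0 12; XCopy 9 8; XPred 9;
      (* (51) entries with a left neighbour *)
      XJump 9 14 59; XCopy 10 9; XPred 10; XOp OMul 4 10 12; XOp OMul 9 9 3;
      XOp OAddSame 9 9 4; XPred 9; XGoto 51;
      (* (59) the entry at 0 *)
      XOp OMul 9 9 3; XSucc 11;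
      (* (61) advance to the next coordinate *)
      XSucc 5; XSucc 5; XSucc 6; XSucc 7; XGoto 34;
      (* (66) add the distances of the last row to t *)
      XZero 9; XJump 11 9 75; XLe 9 1 71; XOp (OCross true) 3 9 1; XGoto 72;
      XOp (OCross true) 3 1 9; XOp (OCross false) 2 2 3; XSucc 9; XGoto 67;
      (* (75) copy the accumulator to cell 0 *)
      XOp OMul 14 2 0].

Definition ulen (u : urat) : nat := maxn (size u.1) (size u.2).

(** The coefficient 1 of the first operand is what keeps iterated operations
    polynomial: long intermediate results are always first operands. *)
Lemma ulen_xop o x y : ulen (xop o x y) <= ulen x + 2 * ulen y + 1.
Proof.
have H a b : size (mulb a (rev b)) <= size a + 2 * size b.
  by rewrite -(size_rev b); exact: size_mulb.
have := H x.1 y.1; have := H x.1 y.2; have := H x.2 y.1; have := H x.2 y.2.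
by rewrite /ulen; case: o => [||sub] /=; rewrite ?size_adds; lia.
Qed.

(** Both operands of the addition in the recursion are long, so the general
    bound would not do here. *)
Lemma ulen_addsame x y : ulen (xop OAddSame x y) <= (maxn (ulen x) (ulen y)).+1.
Proof. by rewrite /ulen /= size_adds; lia. Qed.

Section Reach.

Variables (prog : seq xinstr) (NB LB : nat).

Definition tidy (m : seq urat) : Prop :=
  [/\ size m <= NB, all proper_urat m & all (fun u => ulen u <= LB) m].

(** The state before an instruction that the machine simulates correctly and
    whose encoding is bounded. *)
Definition runnable (x : xst) : Prop :=
  [/\ xpc x < size prog, step_ok (instr_at prog (xpc x)) (xidx x) (xmem x),
      all (fun i => i <= NB) (xidx x) & tidy (xmem x)].

Definition reach (b : nat) (x y : xst) : Prop :=
  exists2 n, n <= b &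
    (forall i, i < n -> runnable (iter i (xstep prog) x)) /\
    iter n (xstep prog) x = y.

Lemma reach0 x : reach 0 x x.
Proof. by exists 0. Qed.

Lemma reach_le b b' x y : reach b x y -> b <= b' -> reach b' x y.
Proof. by case=> n Hn H Hb; exists n => //; exact: leq_trans Hb. Qed.

Lemma reach_trans b1 b2 x y z : reach b1 x y -> reach b2 y z -> reach (b1 + b2) x z.
Proof.
move=> [n1 H1 [R1 E1]] [n2 H2 [R2 E2]]; exists (n1 + n2); first exact: leq_add.
split; last by rewrite addnC iterD E1.
move=> i Hi; case: (ltnP i n1) => Hi1; first exact: R1.
by rewrite -(subnK Hi1) iterD E1; apply: R2; lia.
Qed.

(** Symbolic execution of one instruction. *)
Lemma reach1 p o r m b y : nth (XGoto 0) prog p = o -> p < size prog ->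
  all (fun i => i <= NB) r -> tidy m -> step_ok o r m ->
  reach b (xexec o (XState p r m)) y -> reach b.+1 (XState p r m) y.
Proof.
move=> Eo Hp Hr Hm Hok H; rewrite -add1n; apply: reach_trans H.
exists 1 => //; split.
  by case=> // _; split => //=; rewrite /instr_at Eo.
by rewrite /= /xstep /= leqNgt Hp /= /instr_at Eo.
Qed.

Lemma tidy_put m k u : k < NB -> 0 < LB -> tidy m -> proper_urat u ->
  ulen u <= LB -> tidy (put m k u).
Proof.
move=> Hk HL [H1 H2 H3] Hu Hl; split.
- by rewrite size_set_nth; lia.
- exact: all_put.
- exact: all_put.
Qed.

End Reach.

Lemma nth_put m k u i : nth u0 (put m k u) i = if i == k then u else nth u0 m i.
Proof. by rewrite nth_set_nth. Qed.

Lemma size_put m k u : k < size m -> size (put m k u) = size m.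
Proof. by rewrite size_set_nth => H; apply/maxn_idPr. Qed.

Section Program.

Variables (K W : nat) (mem0 : seq urat).
Hypothesis K_gt0 : 0 < K.
Hypothesis K_le_W : K <= W.
Hypothesis size_mem0 : size mem0 = 6 * K + 1.
Hypothesis mem0_proper : all proper_urat mem0.
Hypothesis mem0_len : all (fun u => ulen u <= W) mem0.

Let NB := 6 * K + 6.
(** No number in memory is longer: the accumulator receives at most [2K] terms of
    length [O(W ^ 2)]. *)
Let LB := 60 * W ^ 3.
Local Notation reach := (reach ot_program NB LB).
Local Notation tidy := (tidy NB LB).

Definition input_val i : rat := uval (nth u0 mem0 i).
Definition p_at k (b : bool) := input_val (2 * K + 2 * k + b).
Definition y1_at k := input_val (4 * K + k).
Definition y2_at k := input_val (5 * K + k).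
Definition y2_one k : bool := (1 <= y2_at k)%R.
Definition agree k : bool := y1_at k == y2_at k.
Definition t_val := input_val (6 * K).

Hypothesis p_sum : forall k, k < K -> (p_at k false + p_at k true = 1)%R.

(** The probability that [x] agrees with [y2] on at most [j] of those first [k]
    coordinates on which [y1] and [y2] differ. *)
Fixpoint cdf (k j : nat) : rat :=
  if k is k'.+1 then
    if agree k' then cdf k' j
    else ((1 - p_at k' (y2_one k')) * cdf k' j +
          if j is j'.+1 then cdf k' j' * p_at k' (y2_one k') else 0)%R
  else 1%R.

Fixpoint differing (k : nat) : nat :=
  if k is k'.+1 then ~~ agree k' + differing k' else 0.

(** The expected cost of the coordinates on which [y1] and [y2] agree. *)
Fixpoint common (k : nat) : rat :=
  if k is k'.+1 then
    (common k' + if agree k' then p_at k' (~~ y2_one k') else 0)%R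
  else 0%R.

Definition regs r5 r6 r7 r8 r9 r10 r11 r12 r13 : seq nat :=
  [:: 6 * K + 1; 6 * K; 6 * K + 2; 6 * K + 3; 6 * K + 4;
      r5; r6; r7; r8; r9; r10; r11; r12; r13; 0].

Lemma W_gt0 : 0 < W. Proof. exact: leq_trans K_le_W. Qed.

Lemma LB_ge : 60 * W <= LB.
Proof. by rewrite /LB leq_mul2l /= -{1}(expn1 W) leq_pexp2l // W_gt0. Qed.

Definition mem1 := mem0 ++ [:: xconst true; xconst false; xconst false; xconst false].

Lemma tidy0 : tidy mem0.
Proof.
split=> //; first by rewrite size_mem0 /NB; lia.
by apply: sub_all mem0_len => u Hu; apply: leq_trans LB_ge; lia.
Qed.

Lemma put_rcons m u : put m (size m) u = rcons m u.
Proof. by elim: m => //= a m IH; rewrite /put /= -[set_nth _ _ _ _]/(put m (size m) u) IH. Qed.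

Lemma put_end m k u : k = size m -> put m k u = rcons m u.
Proof. by move=> ->; exact: put_rcons. Qed.

Lemma tidy_mem1 : tidy mem1.
Proof.
have [H1 H2 H3] := tidy0; have HL : 1 <= LB by have := LB_ge; have := W_gt0; lia.
split; rewrite ?size_cat ?all_cat ?H2 ?H3 /= ?HL //.
by rewrite size_mem0 /NB; lia.
Qed.

Lemma tidy_cat m1 m2 m3 : m3 = m1 ++ m2 -> tidy m3 -> tidy m1.
Proof.
move=> -> [H1 H2 H3]; rewrite !all_cat size_cat in H1 H2 H3.
by case/andP: H2; case/andP: H3; split => //; lia.
Qed.

Ltac step_with H := eapply reach1; [reflexivity | reflexivity | exact: H | .. ].
Ltac step := eapply reach1; [reflexivity | reflexivity | by rewrite /= /NB; lia | .. ].

Lemma reach_alloc :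
  reach 13 (XState 0 [:: 6 * K + 1] mem0)
    (XState 13 (regs 0 0 0 0 0 0 0 0 0) mem1).
Proof.
have T1 : tidy (rcons mem0 (xconst true)).
  by apply: tidy_cat tidy_mem1; rewrite cat_rcons.
have T2 : tidy (rcons (rcons mem0 (xconst true)) (xconst false)).
  by apply: tidy_cat tidy_mem1; rewrite !cat_rcons.
have T3 : tidy (rcons (rcons (rcons mem0 (xconst true)) (xconst false)) (xconst false)).
  by apply: tidy_cat tidy_mem1; rewrite !cat_rcons.
do 9 (step; [exact: tidy0|by split|]; rewrite [xexec _ _]/=).
have -> : (6 * K + 1).-1 = 6 * K by lia.
have -> : (6 * K + 1).+1 = 6 * K + 2 by lia.
have -> : (6 * K + 2).+1 = 6 * K + 3 by lia.
have -> : (6 * K + 3).+1 = 6 * K + 4 by lia.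
step; [exact: tidy0| by split => //; rewrite /= size_mem0; lia|].
rewrite [xexec _ _]/= -[X in put _ X _]size_mem0 put_rcons.
step; [exact: T1| by split => //; rewrite /= size_rcons size_mem0; lia|].
rewrite [xexec _ _]/=.
have -> : put (rcons mem0 (xconst true)) (6 * K + 2) (xconst false) =
    rcons (rcons mem0 (xconst true)) (xconst false).
  by apply: put_end; rewrite size_rcons size_mem0; lia.
step; [exact: T2| by split => //; rewrite /= !size_rcons size_mem0; lia|].
rewrite [xexec _ _]/=.
set m2 := rcons (rcons mem0 (xconst true)) (xconst false) in T3 *.
have -> : put m2 (6 * K + 3) (xconst false) = rcons m2 (xconst false).
  by apply: put_end; rewrite !size_rcons size_mem0; lia.
step; [exact: T3| by split => //; rewrite /= !size_rcons size_mem0; lia|].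
rewrite [xexec _ _]/=.
set m3 := rcons m2 (xconst false).
have -> : put m3 (6 * K + 4) (xconst false) = rcons m3 (xconst false).
  by apply: put_end; rewrite !size_rcons size_mem0; lia.
have -> : rcons m3 (xconst false) = mem1 by rewrite /m3 /m2 /mem1 -!cats1 -!catA.
exact: reach0.
Qed.

(** The first row of the table is constant 1; it overwrites support points. *)
Definition mem_init i := nseq i (xconst true) ++ drop i mem1.

Lemma size_mem1 : size mem1 = 6 * K + 5.
Proof. by rewrite size_cat size_mem0 /=; lia. Qed.

Lemma tidy_mem_init i : i <= K -> tidy (mem_init i).
Proof.
move=> Hi; have [H1 H2 H3] := tidy_mem1.
have HL : 1 <= LB by have := LB_ge; have := W_gt0; lia.
rewrite -(cat_take_drop i mem1) !all_cat in H2 H3.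
case/andP: H2 => _ H2; case/andP: H3 => _ H3; split.
- by rewrite size_cat size_nseq size_drop size_mem1 /NB; lia.
- by rewrite all_cat H2 all_nseq orbT.
- by rewrite all_cat H3 all_nseq /= /ulen /= HL orbT.
Qed.

Lemma put_mem_init i : i < K -> put (mem_init i) i (xconst true) = mem_init i.+1.
Proof.
move=> Hi; have Hi1 : i < size mem1 by rewrite size_mem1; lia.
rewrite /mem_init (drop_nth u0 Hi1); move: (nth u0 mem1 i) (drop i.+1 mem1) => v tl.
elim: i {Hi Hi1} => //= i IH.
by rewrite /put /= -[set_nth _ _ _ _]/(put _ i _) IH.
Qed.

Lemma reach_setup i : i <= K ->
  reach (22 * (K - i) + 1)
    (XState 13 (regs (2 * i) (4 * i) (5 * i) i (6 * i) 0 0 0 0) (mem_init i))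
    (XState 34 (regs (2 * K) (4 * K) (5 * K) K (6 * K) 0 0 0 0) (mem_init K)).
Proof.
move En : (K - i) => n; elim: n i En => [|n IH] i En Hi.
  have -> : i = K by lia.
  step; [exact: tidy_mem_init | by split | rewrite [xexec _ _]/= leqnn; exact: reach0].
have Hi' : i < K by lia.
have -> : 22 * n.+1 + 1 = 21 + (22 * n + 1).+1 by lia.
step; [exact: tidy_mem_init | by split | rewrite [xexec _ _]/= leqNgt].
have -> : 6 * i < 6 * K by lia.
rewrite [~~ true]/=.
step; [exact: tidy_mem_init | | rewrite [xexec _ _]/= put_mem_init //].
  by split => //; rewrite /= size_cat size_nseq leq_addr.
do 19 (step; [exact: tidy_mem_init|by split|]; rewrite [xexec _ _]/=).
have -> : (2 * i).+2 = 2 * i.+1 by lia.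
have -> : (4 * i).+4 = 4 * i.+1 by lia.
have -> : (5 * i).+4.+1 = 5 * i.+1 by lia.
have -> : (6 * i).+4.+2 = 6 * i.+1 by lia.
by apply: (reach_le (IH _ _ _)); lia.
Qed.

(** The part of the memory on which the main loops rely and that they leave
    unchanged. *)
Definition base (m : seq urat) : Prop :=
  [/\ tidy m, size m = 6 * K + 5,
      forall i, 2 * K <= i <= 6 * K -> nth u0 m i = nth u0 mem0 i &
      nth u0 m (6 * K + 1) = xconst true].

Lemma base_put m k u : base m -> (k < K) || (6 * K + 2 <= k < 6 * K + 5) ->
  proper_urat u -> ulen u <= LB -> base (put m k u).
Proof.
move=> [H1 H2 H3 H4] Hk Hu Hl; split.
- by apply: tidy_put => //; rewrite /NB; have := LB_ge; have := W_gt0; lia.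
- by rewrite size_put // H2; lia.
- by move=> i Hi; rewrite nth_put; case: eqP => [E|_]; [lia|exact: H3].
- by rewrite nth_put; case: eqP => [E|_]; [lia|].
Qed.

Lemma base_proper m i : base m -> proper_urat (nth u0 m i).
Proof. by case=> -[_ H _] _ _ _; exact: nth_proper. Qed.

Lemma base_input m i : base m -> 2 * K <= i <= 6 * K ->
  uval (nth u0 m i) = input_val i /\ ulen (nth u0 m i) <= W.
Proof.
move=> [_ _ H _] Hi; rewrite H //; split => //.
by apply: (all_nthP u0 mem0_len); rewrite size_mem0; lia.
Qed.

(** [P(x_k = y2_k)] is the second probability of coordinate [k] if [y2_k] is 1
    and the first one otherwise. *)
Lemma reach_choose k m r9 r10 r11 r12 r13 : k < K -> base m ->
  r9 <= 6 * K + 6 -> r10 <= 6 * K + 6 -> r11 <= K ->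
  r12 <= 6 * K + 6 -> r13 <= 6 * K + 6 ->
  reach 8
    (XState 34 (regs (2 * K + 2 * k) (4 * K + k) (5 * K + k) K r9 r10 r11 r12 r13) m)
    (XState 42 (regs (2 * K + 2 * k) (4 * K + k) (5 * K + k) K r9 r10 r11
       (2 * K + 2 * k + y2_one k) (2 * K + 2 * k + ~~ y2_one k)) m).
Proof.
move=> Hk Hb H9 H10 H11 H12 H13; have [Ht Hs Hi H1] := Hb.
step; [exact: Ht | by split | rewrite [xexec _ _]/=].
have -> : (6 * K <= 5 * K + k) = false by lia.
do 3 (step; [exact: Ht | by split | rewrite [xexec _ _]/=]).
step; [exact: Ht | by split => //; rewrite /= Hs; lia | rewrite [xexec _ _]/=].
rewrite H1 uval_xle //; last exact: base_proper.
have -> : uval (nth u0 m (5 * K + k)) = y2_at k by apply: (proj1 (base_input Hb _)); lia.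
rewrite uval_xconst -[(_ <= _)%R]/(y2_one k); case: (y2_one k) => /=.
  do 2 (step; [exact: Ht | by split | rewrite [xexec _ _]/=]).
  by rewrite (addn0 (2 * K + 2 * k)) (addn1 (2 * K + 2 * k)); apply: (reach_le (reach0 _ _ _ _)).
step; [exact: Ht | by split | rewrite [xexec _ _]/=].
by rewrite (addn0 (2 * K + 2 * k)) (addn1 (2 * K + 2 * k)); apply: (reach_le (reach0 _ _ _ _)).
Qed.

Lemma reach_agree k m r9 r10 r11 r12 r13 : k < K -> base m ->
  r9 <= 6 * K + 6 -> r10 <= 6 * K + 6 -> r11 <= K ->
  r12 <= 6 * K + 6 -> r13 <= 6 * K + 6 ->
  let r := regs (2 * K + 2 * k) (4 * K + k) (5 * K + k) K r9 r10 r11 r12 r13 in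
  reach 4 (XState 42 r m) (XState (if agree k then 46 else 48) r m).
Proof.
move=> Hk Hb H9 H10 H11 H12 H13 r; have [Ht Hs Hi H1] := Hb.
have E1 : uval (nth u0 m (4 * K + k)) = y1_at k by apply: (proj1 (base_input Hb _)); lia.
have E2 : uval (nth u0 m (5 * K + k)) = y2_at k by apply: (proj1 (base_input Hb _)); lia.
rewrite /r.
step; [exact: Ht | by split => //; rewrite /= Hs; lia | rewrite [xexec _ _]/=].
rewrite uval_xle ?E1 ?E2; try exact: base_proper.
rewrite /agree eq_le; case: (_ <= _)%R => /=; last first.
  step; [exact: Ht | by split | rewrite [xexec _ _]/=].
  by apply: (reach_le (reach0 _ _ _ _)).
step; [exact: Ht | by split => //; rewrite /= Hs; lia | rewrite [xexec _ _]/=].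
rewrite uval_xle ?E1 ?E2; try exact: base_proper.
case: (_ <= _)%R => /=; first by apply: (reach_le (reach0 _ _ _ _)).
step; [exact: Ht | by split | rewrite [xexec _ _]/=].
by apply: (reach_le (reach0 _ _ _ _)).
Qed.

(** The denominator [D] does not depend on [j]; this is what justifies adding
    numerators only. *)
Definition cdf_cell k D m j : Prop :=
  [/\ bval (nth u0 m j).2 = D, uval (nth u0 m j) = cdf k j &
      ulen (nth u0 m j) <= 1 + 10 * W * k].

Definition inv k m : Prop :=
  [/\ base m, uval (nth u0 m (6 * K + 2)) = common k,
      ulen (nth u0 m (6 * K + 2)) <= 1 + 3 * W * k &
      exists D, forall j, j < K -> cdf_cell k D m j].

(** The slack of [40 * W] pays for the temporaries of one row update. *)
Lemma common_bound k : k <= K -> 1 + 10 * W * k + 40 * W <= LB.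
Proof.
move=> Hk; have H : k <= W by lia.
rewrite /LB; have := W_gt0; case: W H => // w H _.
by rewrite !expnS expn0 muln1; nia.
Qed.

Lemma reach_common k m r9 r10 r11 r12 : k < K -> inv k m -> agree k ->
  r9 <= 6 * K + 6 -> r10 <= 6 * K + 6 -> r11 <= K -> r12 <= 6 * K + 6 ->
  let r := regs (2 * K + 2 * k) (4 * K + k) (5 * K + k) K r9 r10 r11 r12
             (2 * K + 2 * k + ~~ y2_one k) in
  exists m', reach 2 (XState 46 r m) (XState 61 r m') /\ inv k.+1 m'.
Proof.
move=> Hk [Hb Hc Hl [D HD]] Ha H9 H10 H11 H12 r; have [Ht Hs Hi H1] := Hb.
have [E L] : uval (nth u0 m (2 * K + 2 * k + ~~ y2_one k)) = p_at k (~~ y2_one k) /\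
  ulen (nth u0 m (2 * K + 2 * k + ~~ y2_one k)) <= W.
  by apply: base_input Hb _; case: (y2_one k) => /=; lia.
set a := nth u0 m (6 * K + 2) in Hc Hl; set c := nth u0 m _ in E L.
pose v := xop (OCross false) a c.
have Hv := ulen_xop (OCross false) a c; rewrite -/v in Hv.
have Pv : proper_urat v by apply: proper_xop; exact: base_proper.
have HB := common_bound Hk.
have HbP : base (put m (6 * K + 2) v).
  by apply: base_put => //; [lia | have := W_gt0; lia].
exists (put m (6 * K + 2) v); split.
  rewrite /r; have Hy : (~~ y2_one k : nat) <= 1 by case: (y2_one k).
  step; [exact: Ht | by split => //; rewrite /= Hs; lia | rewrite [xexec _ _]/=].
  rewrite -/a -/c -/v; have [Ht' _ _ _] := HbP.
  step; [exact: Ht' | by split | rewrite [xexec _ _]/=]; exact: reach0.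
split=> //.
- rewrite nth_put eqxx uval_xop //; try exact: base_proper.
  by rewrite Hc E /= Ha.
- by rewrite nth_put eqxx; have := W_gt0; lia.
- exists D => j Hj; have [C1 C2 C3] := HD j Hj.
  have Ej : nth u0 (put m (6 * K + 2) v) j = nth u0 m j.
    by rewrite nth_put; case: eqP => // ?; lia.
  by rewrite /cdf_cell Ej; split => //=; [rewrite Ha | lia].
Qed.

Lemma y2_cell_range k : k < K -> 2 * K <= 2 * K + 2 * k + y2_one k < 4 * K.
Proof. by case: (y2_one k) => /=; clear; lia. Qed.

Lemma y2_cell_ok k (c := nth u0 mem0 (2 * K + 2 * k + y2_one k)) : k < K ->
  [/\ proper_urat c, uval c = p_at k (y2_one k) & ulen c <= W].
Proof.
move=> Hk; have := y2_cell_range Hk; split => //; first exact: nth_proper.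
by apply: (all_nthP u0 mem0_len); rewrite size_mem0; lia.
Qed.

Section DifferingCoordinate.

Variables (k D : nat) (m : seq urat) (r11 r13 : nat).
Hypothesis k_lt : k < K.
Hypothesis r11_le : r11 <= K.
Hypothesis r13_le : r13 <= 6 * K + 6.
Hypothesis k_diff : ~~ agree k.
Hypothesis m_cells : forall j, j < K -> cdf_cell k D m j.

Let qi := 2 * K + 2 * k + y2_one k.
Let qc := nth u0 mem0 qi.
Let q := p_at k (y2_one k).
Let rr i r10 := regs (2 * K + 2 * k) (4 * K + k) (5 * K + k) K i r10 r11 qi r13.

Lemma inner_regs_ok i r10 : i <= 6 * K + 6 -> r10 <= 6 * K + 6 ->
  all (fun i => i <= NB) (rr i r10).
Proof.
move=> Hi Hr; have := y2_cell_range k_lt; rewrite -/qi /rr /= /NB; move: Hi Hr r11_le r13_le k_lt; generalize qi; clear; lia.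
Qed.

(** A row is updated from right to left, because the entry at [j - 1] must still
    be old when the one at [j] is computed; the entries up to [i] are old. The
    temporary [u] is [1 - q]: computed from [q], it has the denominator of
    [q]. *)
Definition updated (u : urat) i mm : Prop :=
  [/\ base mm, nth u0 mm (6 * K + 2) = nth u0 m (6 * K + 2),
      nth u0 mm (6 * K + 3) = u,
      forall j, j <= i -> nth u0 mm j = nth u0 m j &
      forall j, i < j < K -> cdf_cell k.+1 (D * bval qc.2) mm j].

Variable u : urat.
Hypothesis u_proper : proper_urat u.
Hypothesis u_val : uval u = (1 - q)%R.
Hypothesis u_den : bval u.2 = bval qc.2.
Hypothesis u_len : ulen u <= 2 * W + 2.

(** Both summands of a new entry have denominator [D] times that of [q]. *)
Lemma reach_inner i mm r10 : i < K -> r10 <= 6 * K + 6 -> updated u i mm ->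
  exists mm' r10', [/\ r10' <= 6 * K + 6, updated u 0 mm' &
    reach (8 * i + 1) (XState 51 (rr i r10) mm) (XState 59 (rr 0 r10') mm')].
Proof.
have Hqi := y2_cell_range k_lt; have [Pq Vq Lq] := y2_cell_ok k_lt; have HW := W_gt0.
have HL := common_bound (ltnW k_lt); rewrite -/qi -/qc -/q in Hqi Pq Vq Lq.
elim: i mm r10 => [|i IH] mm r10 Hi H10 Hup; have [Hb Ha Hu Hlo Hhi] := Hup.
  have [Ht Hs Hin H1] := Hb; exists mm, r10; split=> //.
  by step_with (inner_regs_ok (leq0n _) H10); [exact: Ht | by split | rewrite [xexec _ _]/=; exact: reach0].
have [Ht Hs Hin H1] := Hb.
have [A1 A2 A3] := m_cells (ltnW Hi); have [B1 B2 B3] := m_cells Hi.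
set x0 := nth u0 m i in A1 A2 A3; set x1 := nth u0 m i.+1 in B1 B2 B3.
have E0 : nth u0 mm i = x0 by apply: Hlo.
have E1 : nth u0 mm i.+1 = x1 by apply: Hlo.
have Eq : nth u0 mm qi = qc by apply: Hin; lia.
have Px0 : proper_urat x0 by rewrite -E0; exact: base_proper.
have Px1 : proper_urat x1 by rewrite -E1; exact: base_proper.
pose v := xop OMul x0 qc; pose w := xop OMul x1 u; pose z := xop OAddSame w v.
have Pv : proper_urat v by exact: proper_xop.
have Pw : proper_urat w by exact: proper_xop.
have Pz : proper_urat z by exact: proper_xop.
have Lv : ulen v <= 1 + 10 * W * k + 9 * W.
  by apply: leq_trans (ulen_xop _ _ _) _; move: A3 Lq HW; clear; lia.
have Lw : ulen w <= 1 + 10 * W * k + 9 * W.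
  by apply: leq_trans (ulen_xop _ _ _) _; move: B3 u_len HW; clear; lia.
have Lz : ulen z <= 1 + 10 * W * k.+1.
  by apply: leq_trans (ulen_addsame _ _) _; rewrite mulnS; move: Lv Lw HW; clear; lia.
have Lv' : ulen v <= LB by apply: leq_trans Lv _; move: HL; clear; lia.
have Lw' : ulen w <= LB by apply: leq_trans Lw _; move: HL; clear; lia.
have Lz' : ulen z <= LB by apply: leq_trans Lz _; rewrite mulnS; move: HL; clear; lia.
have Dv : bval v.2 = D * bval qc.2 by rewrite /= bvalM A1.
have Dw : bval w.2 = D * bval qc.2 by rewrite /= bvalM B1 u_den.
pose m1 := put mm (6 * K + 4) v; pose m2 := put m1 i.+1 w; pose m3 := put m2 i.+1 z.
have Hi' : (i.+1 < K) || (6 * K + 2 <= i.+1 < 6 * K + 5) by rewrite Hi.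
have Hb1 : base m1.
  by apply: (base_put Hb _ Pv Lv'); move: K_gt0; clear; lia.
have Hb2 : base m2 by exact: (base_put Hb1 Hi' Pw Lw').
have Hb3 : base m3 by exact: (base_put Hb2 Hi' Pz Lz').
clear Lv Lw Lv' Lw' Lz' A3 B3 Lq HL.
have [T1 S1 _ _] := Hb1; have [T2 S2 _ _] := Hb2; have [T3 S3 _ _] := Hb3.
have N3 j : nth u0 m3 j = if j == i.+1 then z else if j == 6 * K + 4 then v else nth u0 mm j.
  by rewrite /m3 nth_put; case: eqP => // Hj; rewrite /m2 nth_put; case: eqP => // _; rewrite nth_put.
have ne2 : ((6 * K + 2 == i.+1) = false) /\ ((6 * K + 2 == 6 * K + 4) = false).
  by move: Hi; clear; lia.
have ne3 : ((6 * K + 3 == i.+1) = false) /\ ((6 * K + 3 == 6 * K + 4) = false).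
  by move: Hi; clear; lia.
have neK j : j < K -> (j == 6 * K + 4) = false by clear; lia.
have iK : i < K by exact: ltnW.
have Hup3 : updated u i m3.
  split=> //.
  - by rewrite N3 ne2.1 ne2.2.
  - by rewrite N3 ne3.1 ne3.2.
  - move=> j Hj; rewrite N3 neK ?(leq_ltn_trans Hj) //.
    by rewrite (ltn_eqF (Hj : j < i.+1)); apply/Hlo/leqW.
  - move=> j /andP[Hj HjK]; rewrite /cdf_cell N3; case: (j =P i.+1) => [->|/eqP Hne]; last first.
      by rewrite neK //; apply: Hhi; rewrite HjK andbT ltn_neqAle eq_sym Hne.
    split; first exact: Dw.
    + rewrite uval_xop //; last by rewrite /= in Dv Dw *; rewrite Dv Dw.
      by rewrite !uval_xop // A2 B2 u_val Vq /= (negPf k_diff) -/q mulrC.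
    + exact: Lz.
have Hi6 : i <= 6 * K + 6 by move: iK; clear; lia.
have [mm' [r10' [H10' Hup' R]]] := IH m3 i iK Hi6 Hup3.
exists mm', r10'; split=> //.
have -> : 8 * i.+1 + 1 = 7 + (8 * i + 1).+1 by clear; lia.
have M1 : nth u0 m1 i.+1 = x1.
  by rewrite nth_put; case: eqP => // E; move: E Hi; clear; lia.
have M2 : nth u0 m1 (6 * K + 3) = u by rewrite nth_put ne3.2.
have M3 : nth u0 m2 i.+1 = w by rewrite nth_put eqxx.
have M4 : nth u0 m2 (6 * K + 4) = v.
  by rewrite nth_put eq_sym neK // nth_put eqxx.
have M5 : bval w.2 = bval v.2 by rewrite Dv Dw.
have Hqi6 : qi <= 6 * K + 6 by move: Hqi; clear; lia.
have Hi1 : i.+1 <= 6 * K + 6 by move: Hi; clear; lia.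
have rng a : a <= i.+1 -> a < 6 * K + 5 by move: Hi; clear; lia.
have rng2 : [/\ qi < 6 * K + 5, 6 * K + 3 < 6 * K + 5 & 6 * K + 4 < 6 * K + 5].
  by split; move: Hqi k_lt; generalize qi; clear; lia.
have [G1 G2 G3] := rng2.
step_with (inner_regs_ok Hi1 H10); [exact: Ht | by split | rewrite [xexec _ _]/=].
step_with (inner_regs_ok Hi1 H10); [exact: Ht | by split | rewrite [xexec _ _]/=].
step_with (inner_regs_ok Hi1 Hi1); [exact: Ht | by split | rewrite [xexec _ _]/=].
step_with (inner_regs_ok Hi1 Hi6); [exact: Ht | | rewrite [xexec _ _]/= E0 Eq -/v -/m1].
  by split => //; rewrite /= Hs (ltnW G3) G1 rng.
step_with (inner_regs_ok Hi1 Hi6); [exact: T1 | | rewrite [xexec _ _]/= M1 M2 -/w -/m2].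
  by split => //; rewrite /= S1 G2 ltnW ?rng.
step_with (inner_regs_ok Hi1 Hi6); [exact: T2 | | rewrite [xexec _ _]/= M3 M4 -/z -/m3].
  split; first by rewrite /= S2 G3 ltnW ?rng.
  by rewrite /= M3 M4; exact: M5.
step_with (inner_regs_ok Hi1 Hi6); [exact: T3 | by split | rewrite [xexec _ _]/=].
step_with (inner_regs_ok Hi6 Hi6); [exact: T3 | by split | rewrite [xexec _ _]/=].
exact: (reach_le R).
Qed.

End DifferingCoordinate.

Lemma reach_differing k m r9 r10 r11 r13 : k < K -> inv k m -> ~~ agree k ->
  r9 <= 6 * K + 6 -> r10 <= 6 * K + 6 -> r11 < K -> r13 <= 6 * K + 6 ->
  let r i j l := regs (2 * K + 2 * k) (4 * K + k) (5 * K + k) K i j l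
             (2 * K + 2 * k + y2_one k) r13 in
  exists m' r10', [/\ r10' <= 6 * K + 6, inv k.+1 m' &
    reach (8 * K + 5) (XState 48 (r r9 r10 r11) m) (XState 61 (r 0 r10' r11.+1) m')].
Proof.
move=> Hk [Hb Hc Hl [D HD]] Ha H9 H10 H11 H13 r; have [Ht Hs Hi H1] := Hb.
have HL := common_bound (ltnW Hk); have HW := W_gt0.
have Hqi := y2_cell_range Hk; have [Pq Vq Lq] := y2_cell_ok Hk.
set qi := 2 * K + 2 * k + y2_one k in Hqi Pq Vq Lq r *.
set qc := nth u0 mem0 qi in Pq Vq Lq.
have Eq : nth u0 m qi = qc by apply: Hi; lia.
pose u := xop (OCross true) (xconst true) qc.
have q_le1 : (uval qc <= 1)%R.
  rewrite Vq -(p_sum Hk); case: (y2_one k); rewrite ?lerDl ?lerDr; exact: uval_ge0.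
have Hnum : numeric_ok (OCross true) (xconst true) qc.
  by rewrite /= uval_xconst.
have Pu : proper_urat u by exact: proper_xop.
have Lu := ulen_xop (OCross true) (xconst true) qc; rewrite -/u in Lu.
have Vu : uval u = (1 - p_at k (y2_one k))%R by rewrite uval_xop // uval_xconst Vq.
have Du : bval u.2 = bval qc.2 by rewrite /= bvalM mul1n.
have Lu' : ulen u <= 2 * W + 2 by apply: leq_trans Lu _; rewrite /ulen /=; rewrite /ulen in Lq; lia.
have Hb1 : base (put m (6 * K + 3) u) by apply: base_put => //; lia.
set m1 := put m (6 * K + 3) u in Hb1; have [T1 S1 _ _] := Hb1.
have N1 j : nth u0 m1 j = if j == 6 * K + 3 then u else nth u0 m j by exact: nth_put.
have R0 b y : reach b (XState 49 (r r9 r10 r11) m1) y ->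
    reach b.+1 (XState 48 (r r9 r10 r11) m) y.
  move=> R; rewrite /r.
  step; [exact: Ht | | rewrite [xexec _ _]/= H1 Eq -/u -/m1; exact: R].
  split; first by rewrite /= Hs; move: Hqi; clear; lia.
  by rewrite /= H1 Eq.
clearbody u m1; clear Lu Hnum q_le1 Eq Vq Lq Pq.
have Hup : updated k D m u K.-1 m1.
  split=> //.
  - by rewrite N1; case: eqP => // E; move: E; clear; lia.
  - by rewrite N1 eqxx.
  - by move=> j Hj; rewrite N1; case: eqP => // E; move: E Hj; clear; lia.
  - by move=> j Hj; exfalso; move: Hj; clear; lia.
have [|m2 [r10' [H10' [Hb2 Hacc Hu2 Hlo Hhi] R]]] :=
  reach_inner Hk (ltnW H11) H13 Ha HD Pu Vu Du Lu' _ H10 Hup.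
  by move: K_gt0; clear; lia.
have [T2 S2 _ _] := Hb2.
pose x := nth u0 m 0; have [C1 C2 C3] := HD 0 K_gt0; rewrite -/x in C1 C2 C3.
have E0 : nth u0 m2 0 = x by apply: Hlo.
have Px : proper_urat x by exact: base_proper.
have [w Ew] : exists w, w = xop OMul x u by eexists.
have Pw : proper_urat w by rewrite Ew; exact: proper_xop.
have Lw : ulen w <= 1 + 10 * W * k.+1.
  rewrite Ew; apply: leq_trans (ulen_xop _ _ _) _; rewrite mulnS.
  by move: C3 Lu' HW; clear; lia.
have Dw : bval w.2 = D * bval qc.2 by rewrite Ew /= bvalM C1 Du.
have Vw : uval w = cdf k.+1 0.
  by rewrite Ew uval_xop // C2 Vu /= (negPf Ha) addr0 mulrC.
pose m3 := put m2 0 w.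
have Hb3 : base m3.
  apply: base_put => //; first by rewrite K_gt0.
  by apply: leq_trans Lw _; rewrite mulnS; move: HL; clear; lia.
have [T3 S3 _ _] := Hb3.
have N3 j : nth u0 m3 j = if j == 0 then w else nth u0 m2 j by exact: nth_put.
have N3' j : j != 0 -> nth u0 m3 j = nth u0 m2 j by move=> Hj; rewrite N3 (negPf Hj).
have ne0 : 6 * K + 2 != 0 by rewrite addn2.
exists m3, r10'; split=> //.
- split=> //.
  + by rewrite (N3' _ ne0) Hacc Hc /= (negPf Ha) addr0.
  + rewrite (N3' _ ne0) Hacc; apply: leq_trans Hl _.
    by rewrite leq_add2l leq_mul2l leqnSn orbT.
  + exists (D * bval qc.2) => j Hj; rewrite /cdf_cell.
    case: (posnP j) => [->|Hj0]; first by rewrite N3 /=.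
    by rewrite N3' -?lt0n //; apply: Hhi; rewrite Hj0.
- have HR : 8 * K + 5 = (2 + (8 * K.-1 + 1 + 2) + 7).+1 by move: K_gt0; clear; lia.
  apply: reach_le (R0 _ _ _) (_ : (2 + (8 * K.-1 + 1 + 2)).+1 <= _); last first.
    by rewrite HR ltnS leq_addr.
  clear R0 HD Hlo Hhi Hup Hl HL Lu' Lw N1 N3 N3' Dw Vw C1 C2 C3 HR Du.
  rewrite /r.
  do 2 (step; [exact: T1 | by split | rewrite [xexec _ _]/=]).
  apply: reach_trans R _.
  step; [exact: T2 | by split => //; rewrite /= S2; lia | rewrite [xexec _ _]/= E0 Hu2 -/(xop OMul x u) -Ew -/m3].
  step; [exact: T3 | by split | rewrite [xexec _ _]/=].
  exact: reach0.
Qed.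

Definition head_regs k r9 r10 r12 r13 :=
  regs (2 * K + 2 * k) (4 * K + k) (5 * K + k) K r9 r10 (differing k) r12 r13.

Lemma differing_le k : differing k <= k.
Proof. by elim: k => //= k IH; case: (agree k); lia. Qed.

Lemma reach_next k m r9 r10 r11 r12 r13 : k < K -> tidy m ->
  r9 <= 6 * K + 6 -> r10 <= 6 * K + 6 -> r11 <= K ->
  r12 <= 6 * K + 6 -> r13 <= 6 * K + 6 ->
  reach 5
    (XState 61 (regs (2 * K + 2 * k) (4 * K + k) (5 * K + k) K r9 r10 r11 r12 r13) m)
    (XState 34 (regs (2 * K + 2 * k.+1) (4 * K + k.+1) (5 * K + k.+1) K r9 r10 r11 r12 r13) m).
Proof.
move=> Hk Ht H9 H10 H11 H12 H13.
do 5 (step; [exact: Ht | by split | rewrite [xexec _ _]/=]).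
have -> : (2 * K + 2 * k).+2 = 2 * K + 2 * k.+1 by lia.
by rewrite -!addnS; exact: reach0.
Qed.

Lemma reach_coordinate k m r9 r10 r12 r13 : k < K -> inv k m ->
  r9 <= 6 * K + 6 -> r10 <= 6 * K + 6 -> r12 <= 6 * K + 6 -> r13 <= 6 * K + 6 ->
  exists m' r9' r10' r12' r13',
    [/\ r9' <= 6 * K + 6, r10' <= 6 * K + 6, r12' <= 6 * K + 6 & r13' <= 6 * K + 6] /\
    inv k.+1 m' /\
    reach (8 * K + 30) (XState 34 (head_regs k r9 r10 r12 r13) m)
      (XState 34 (head_regs k.+1 r9' r10' r12' r13') m').
Proof.
move=> Hk Hinv H9 H10 H12 H13; have [Hb _ _ _] := Hinv.
have Hd : differing k < K := leq_ltn_trans (differing_le k) Hk.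
pose q := 2 * K + 2 * k + y2_one k; pose o := 2 * K + 2 * k + ~~ y2_one k.
have Hq : q <= 6 * K + 6 by rewrite /q; case: (y2_one k) => /=; move: Hk; clear; lia.
have Ho : o <= 6 * K + 6 by rewrite /o; case: (y2_one k) => /=; move: Hk; clear; lia.
have R1 := reach_choose Hk Hb H9 H10 (ltnW Hd) H12 H13.
have R2 := reach_agree Hk Hb H9 H10 (ltnW Hd) Hq Ho.
case Ha : (agree k) R2 => R2.
  have [m' [R3 Hinv']] := reach_common Hk Hinv Ha H9 H10 (ltnW Hd) Hq.
  have [[Ht' _ _ _] _ _ _] := Hinv'.
  have R4 := reach_next Hk Ht' H9 H10 (ltnW Hd) Hq Ho.
  exists m', r9, r10, q, o; split=> //; split=> //.
  rewrite /head_regs [differing k.+1]/= Ha add0n.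
  apply: (reach_le (reach_trans R1 (reach_trans R2 (reach_trans R3 R4)))).
  by clear; lia.
have [m' [r10' [H10' Hinv' R3]]] := reach_differing Hk Hinv (negbT Ha) H9 H10 Hd Ho.
have [[Ht' _ _ _] _ _ _] := Hinv'.
have R4 := reach_next Hk Ht' (leq0n _) H10' Hd Hq Ho.
exists m', 0, r10', q, o; split=> //; split=> //.
rewrite /head_regs [differing k.+1]/= Ha add1n.
apply: (reach_le (reach_trans R1 (reach_trans R2 (reach_trans R3 R4)))).
by clear; lia.
Qed.

Lemma reach_coordinates i k m r9 r10 r12 r13 : k + i = K -> inv k m ->
  r9 <= 6 * K + 6 -> r10 <= 6 * K + 6 -> r12 <= 6 * K + 6 -> r13 <= 6 * K + 6 ->
  exists m' r9' r10' r12' r13',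
    [/\ r9' <= 6 * K + 6, r10' <= 6 * K + 6, r12' <= 6 * K + 6 & r13' <= 6 * K + 6] /\
    inv K m' /\
    reach (i * (8 * K + 30)) (XState 34 (head_regs k r9 r10 r12 r13) m)
      (XState 34 (head_regs K r9' r10' r12' r13') m').
Proof.
elim: i k m r9 r10 r12 r13 => [|i IH] k m r9 r10 r12 r13 Hk Hinv H9 H10 H12 H13.
  rewrite addn0 in Hk; subst k; exists m, r9, r10, r12, r13.
  by split=> //; split=> //; exact: reach0.
have Hk' : k < K by rewrite -Hk addnS ltnS leq_addr.
have [m1 [s9 [s10 [s12 [s13 [[G9 G10 G12 G13] [Hinv1 R1]]]]]]] :=
  reach_coordinate Hk' Hinv H9 H10 H12 H13.
rewrite -addSnnS in Hk.
have [m2 [t9 [t10 [t12 [t13 [HT [Hinv2 R2]]]]]]] := IH _ _ _ _ _ _ Hk Hinv1 G9 G10 G12 G13.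
exists m2, t9, t10, t12, t13; split=> //; split=> //.
by rewrite mulSn; exact: reach_trans R1 R2.
Qed.

Definition sum_regs i r10 r12 r13 :=
  regs (2 * K + 2 * K) (4 * K + K) (5 * K + K) K i r10 (differing K) r12 r13.

Definition deviation i : rat := (\sum_(j < i) `|cdf K j - t_val|)%R.

Definition sum_inv m i mm : Prop :=
  [/\ base mm, forall j, j < K -> nth u0 mm j = nth u0 m j,
      uval (nth u0 mm (6 * K + 2)) = (common K + deviation i)%R &
      ulen (nth u0 mm (6 * K + 2)) <= 1 + 3 * W * K + 49 * (W * W) * i].

Lemma sum_bound i : i <= K -> 1 + 3 * W * K + 49 * (W * W) * i + 7 <= LB.
Proof.
move=> Hi; apply: (@leq_trans (1 + 3 * W * W + 49 * (W * W) * W + 7)).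
  by rewrite leq_add2r leq_add // ?leq_add2l leq_mul //; exact: leq_trans Hi _.
have HW := W_gt0; rewrite /LB !expnS expn0 muln1 (mulnA W W W).
have H1 : W <= W * W by rewrite leq_pmulr.
have H2 : W * W <= W * W * W by rewrite leq_pmulr.
by move: H1 H2 HW; rewrite -!mulnA; clear; lia.
Qed.

(** Comparing [F(j)] with [t] first makes the difference nonnegative. *)
Lemma reach_sum_step m i mm r10 r12 r13 :
  (forall j, j < K -> uval (nth u0 m j) = cdf K j /\ ulen (nth u0 m j) <= 1 + 10 * W * K) ->
  i < differing K -> sum_inv m i mm ->
  r10 <= 6 * K + 6 -> r12 <= 6 * K + 6 -> r13 <= 6 * K + 6 ->
  exists mm', sum_inv m i.+1 mm' /\
    reach 7 (XState 67 (sum_regs i r10 r12 r13) mm)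
      (XState 67 (sum_regs i.+1 r10 r12 r13) mm').
Proof.
move=> Hm Hi [Hb Hcells Hacc Hlen] H10 H12 H13.
have Hd := differing_le K; have HiK : i < K by exact: leq_trans Hi Hd.
have [Ht Hs Hin H1] := Hb; have HW := W_gt0; have HL := sum_bound HiK.
have [Vf Lf] := Hm _ HiK; rewrite -(Hcells _ HiK) in Vf Lf.
have [Vt Lt] : uval (nth u0 mm (6 * K)) = t_val /\ ulen (nth u0 mm (6 * K)) <= W.
  by apply: base_input Hb _; rewrite leq_mul2r orbT leqnn.
set f := nth u0 mm i in Vf Lf; set t := nth u0 mm (6 * K) in Vt Lt.
set a := nth u0 mm (6 * K + 2) in Hacc Hlen.
have Pf : proper_urat f by exact: base_proper.
have Pt : proper_urat t by exact: base_proper.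
have Pa : proper_urat a by exact: base_proper.
pose b := (uval f <= uval t)%R.
have [d Ed] : exists d, d = xop (OCross true) (if b then t else f) (if b then f else t).
  by eexists.
have Hnum : (uval (if b then f else t) <= uval (if b then t else f))%R.
  by rewrite /b; case E: (uval f <= uval t)%R => //; rewrite ltW // ltNge E.
have Pd : proper_urat d by rewrite Ed; case: (b); exact: proper_xop.
have Vd : uval d = `|cdf K i - t_val|%R.
  rewrite Ed uval_xop //; try by case: (b).
  rewrite -Vf -Vt /b; case: leP => H; first by rewrite ler0_norm ?subr_le0 ?opprB.
  by rewrite ger0_norm // subr_ge0 ltW.
have H2 : 1 <= W * W by rewrite muln_gt0 HW.
have H3 : W <= W * W by rewrite leq_pmulr.
have H4 : W * K <= W * W by rewrite leq_mul2l K_le_W orbT.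
have Ld : ulen d <= 24 * (W * W).
  rewrite Ed; apply: leq_trans (ulen_xop _ _ _) _.
  move: Lf Lt H2 H3 H4; rewrite -!mulnA; case: (b); clear; lia.
have [c Ec] : exists c, c = xop (OCross false) a d by eexists.
have Pc : proper_urat c by rewrite Ec; exact: proper_xop.
have Vc : uval c = (common K + deviation i.+1)%R.
  by rewrite Ec uval_xop // Hacc Vd /deviation big_ord_recr /= addrA.
have Lc : ulen c <= 1 + 3 * W * K + 49 * (W * W) * i.+1.
  rewrite Ec; apply: leq_trans (ulen_xop _ _ _) _.
  rewrite mulnS; move: (49 * (W * W) * i) Hlen Ld H2 => z; clear; lia.
have Ld' : ulen d <= LB.
  by apply: leq_trans Ld _; move: HL H2; rewrite mulnS; move: (49 * (W * W) * i) => z; clear; lia.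
have Lc' : ulen c <= LB by apply: leq_trans Lc _; move: HL; clear; lia.
pose m1 := put mm (6 * K + 3) d; pose m2 := put m1 (6 * K + 2) c.
have Hb1 : base m1 by apply: (base_put Hb _ Pd Ld'); clear; lia.
have Hb2 : base m2 by apply: (base_put Hb1 _ Pc Lc'); clear; lia.
have [T1 S1 _ _] := Hb1; have [T2 S2 _ _] := Hb2.
exists m2; split.
  split=> //.
  - move=> j Hj; rewrite -Hcells // /m2 /m1 !nth_put.
    by do 2 (case: eqP => [E|_]; first by exfalso; move: E Hj; clear; lia).
  - by rewrite /m2 nth_put eqxx.
  - by rewrite /m2 nth_put eqxx.
have M1 : nth u0 m1 (6 * K + 3) = d by rewrite nth_put eqxx.
have M2 : nth u0 m1 (6 * K + 2) = a.
  by rewrite nth_put; case: eqP => // E; exfalso; move: E; clear; lia.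
have Hbi : xle f t = b by rewrite uval_xle.
have sr j : j <= i.+1 -> all (fun z => z <= NB) (sum_regs j r10 r12 r13).
  by rewrite /= /NB; move: HiK H10 H12 H13 Hd; clear; lia.
have Hi1 := sr _ (leqnSn i); have Hi2 := sr _ (leqnn i.+1).
have rng : [/\ i < 6 * K + 5, 6 * K < 6 * K + 5, 6 * K + 2 < 6 * K + 5 & 6 * K + 3 < 6 * K + 5].
  by split; move: HiK; clear; lia.
have [G1 G2 G3 G4] := rng.
have ltdi : (differing K <= i) = false by rewrite leqNgt Hi.
have R3 : reach 3 (XState 72 (sum_regs i r10 r12 r13) m1)
                  (XState 67 (sum_regs i.+1 r10 r12 r13) m2).
  step_with Hi1; [exact: T1 | | rewrite [xexec _ _]/= M1 M2 -/(xop (OCross false) a d) -Ec -/m2].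
    by split => //; rewrite /= S1 G3 G4 ltnW.
  step_with Hi1; [exact: T2 | by split | rewrite [xexec _ _]/=].
  step_with Hi2; [exact: T2 | by split | rewrite [xexec _ _]/=].
  exact: reach0.
step_with Hi1; [exact: Ht | by split | rewrite [xexec _ _]/= ltdi].
step_with Hi1; [exact: Ht | by split => //; rewrite /= Hs G1 G2 | rewrite [xexec _ _]/= -/f -/t Hbi].
case Eb : b Ed Hnum => Ed Hnum.
  step_with Hi1; [exact: Ht | | rewrite [xexec _ _]/= -/f -/t -/(xop (OCross true) t f) -Ed -/m1].
    by split; [rewrite /= Hs G1 G2 ltnW | rewrite /= -/f -/t].
  exact: (reach_le R3).
step_with Hi1; [exact: Ht | | rewrite [xexec _ _]/= -/f -/t -/(xop (OCross true) f t) -Ed -/m1].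
  by split; [rewrite /= Hs G1 G2 ltnW | rewrite /= -/f -/t].
step_with Hi1; [exact: T1 | by split | rewrite [xexec _ _]/=].
exact: R3.
Qed.

Lemma reach_sum n m i mm r10 r12 r13 :
  (forall j, j < K -> uval (nth u0 m j) = cdf K j /\ ulen (nth u0 m j) <= 1 + 10 * W * K) ->
  i + n = differing K -> sum_inv m i mm ->
  r10 <= 6 * K + 6 -> r12 <= 6 * K + 6 -> r13 <= 6 * K + 6 ->
  exists mm', sum_inv m (differing K) mm' /\
    reach (7 * n) (XState 67 (sum_regs i r10 r12 r13) mm)
      (XState 67 (sum_regs (differing K) r10 r12 r13) mm').
Proof.
move=> Hm; elim: n i mm => [|n IH] i mm Hi Hinv H10 H12 H13.
  by rewrite addn0 in Hi; subst i; exists mm; split=> //; exact: reach0.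
have Hi' : i < differing K by rewrite -Hi addnS ltnS leq_addr.
have [m1 [Hinv1 R1]] := reach_sum_step Hm Hi' Hinv H10 H12 H13.
rewrite -addSnnS in Hi; have [m2 [Hinv2 R2]] := IH _ _ Hi Hinv1 H10 H12 H13.
by exists m2; split=> //; rewrite mulnS; exact: reach_trans R1 R2.
Qed.

Lemma inv_init : inv 0 (mem_init K).
Proof.
have nth_init i : nth u0 (mem_init K) i = if i < K then xconst true else nth u0 mem1 i.
  rewrite /mem_init nth_cat size_nseq nth_nseq; case: ltnP => // H.
  by rewrite nth_drop subnKC.
have Hsz : size (mem_init K) = 6 * K + 5.
  by rewrite size_cat size_nseq size_drop size_mem1; clear; lia.
have tl i : i < 4 -> nth u0 (mem_init K) (6 * K + 1 + i) =
    nth u0 [:: xconst true; xconst false; xconst false; xconst false] i.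
  move=> Hi; rewrite nth_init; case: ltnP => [H|_]; first by exfalso; move: H; clear; lia.
  by rewrite nth_cat size_mem0 ltnNge leq_addr /= addKn.
have E1 := tl 0 isT; have E2 := tl 1 isT; rewrite addn0 in E1.
rewrite -addnA in E2; split.
- split; [exact: tidy_mem_init | exact: Hsz | | exact: E1].
  move=> i /andP[H1 H2]; rewrite nth_init; case: ltnP => [H|_].
    by exfalso; move: H1 H K_gt0; clear; lia.
  by rewrite nth_cat size_mem0; case: ltnP => // H; exfalso; move: H H2; clear; lia.
- by rewrite E2 uval_xconst.
- by rewrite E2 /ulen /= muln0.
- exists 1 => j Hj; rewrite /cdf_cell nth_init Hj uval_xconst /ulen /= muln0.
  by split.
Qed.

Theorem ot_program_correct :
  exists x, [/\ reach (100 * (K + 1) ^ 2) (XState 0 [:: 6 * K + 1] mem0) x,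
    xpc x = size ot_program,
    all (fun i => i <= NB) (xidx x) /\ tidy (xmem x),
    xmem x != [::] &
    uval (nth u0 (xmem x) 0) = (common K + deviation (differing K))%R].
Proof.
have R1 := reach_alloc; have R2 := reach_setup (leq0n K).
rewrite !muln0 in R2.
have Em : mem_init 0 = mem1 by rewrite /mem_init drop0.
rewrite Em subn0 in R2.
have K6 : 6 * K <= 6 * K + 6 by rewrite leq_addr.
have [m [r9 [r10 [r12 [r13 [[H9 H10 H12 H13] [Hinv R3]]]]]]] :=
  @reach_coordinates K 0 _ _ _ _ _ (add0n K) inv_init K6 (leq0n _) (leq0n _) (leq0n _).
rewrite /head_regs !muln0 !addn0 /= in R3.
have [Hb Hc Hl [D HD]] := Hinv; have [Ht Hs Hin H1] := Hb.
have Hm j : j < K -> uval (nth u0 m j) = cdf K j /\ ulen (nth u0 m j) <= 1 + 10 * W * K.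
  by move=> /HD[].
have Hsum0 : sum_inv m 0 m.
  by split => //; rewrite ?/deviation ?big_ord0 ?addr0 ?muln0 ?addn0.
have [mm [[Hb' _ Hacc Hlen] R4]] :=
  reach_sum Hm (add0n _) Hsum0 H10 H12 H13.
have [Ht' Hs' Hin' H1'] := Hb'; have HW := W_gt0.
set a := nth u0 mm (6 * K + 2) in Hacc Hlen.
have [c Ec] : exists c, c = xop OMul a (xconst true) by eexists.
have Pa : proper_urat a by exact: base_proper.
have Pc : proper_urat c by rewrite Ec; exact: proper_xop.
have Hd := differing_le K.
have Lc : ulen c <= LB.
  apply: leq_trans (sum_bound Hd); rewrite Ec.
  apply: leq_trans (ulen_xop _ _ _) _; rewrite {2}/ulen /=.
  by move: Hlen; clear; lia.
have Hb2 : base (put mm 0 c) by apply: (base_put Hb' _ Pc Lc); rewrite K_gt0.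
have [T2 S2 _ _] := Hb2.
have sr j q : j <= 6 * K + 6 -> q <= 6 * K + 6 ->
    all (fun z => z <= NB) (sum_regs j q r12 r13).
  by rewrite /= /NB; move: H12 H13 Hd; clear; lia.
have srd := sr _ _ (leq_trans Hd (leq_trans (leq_pmull K (isT : 0 < 6)) K6)) H10.
exists (XState 76 (sum_regs (differing K) r10 r12 r13) (put mm 0 c)); split=> //.
- have R5 : reach 2 (XState 34 (head_regs K r9 r10 r12 r13) m)
                    (XState 67 (sum_regs 0 r10 r12 r13) m).
    step_with (sr _ _ H9 H10); [exact: Ht | by split | rewrite [xexec _ _]/=].
    have -> : (6 * K <= 5 * K + K) by clear; lia.
    step_with (sr _ _ H9 H10); [exact: Ht | by split | rewrite [xexec _ _]/=].
    exact: reach0.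
  have R6 : reach 2 (XState 67 (sum_regs (differing K) r10 r12 r13) mm)
      (XState 76 (sum_regs (differing K) r10 r12 r13) (put mm 0 c)).
    step_with srd; [exact: Ht' | by split | rewrite [xexec _ _]/= leqnn].
    step_with srd; [exact: Ht' | | rewrite [xexec _ _]/= -/a H1' -/(xop OMul a (xconst true)) -Ec].
      by split => //; rewrite /= Hs'; clear; lia.
    exact: reach0.
  have R := reach_trans R1 (reach_trans R2 (reach_trans R3 (reach_trans R5 (reach_trans R4 R6)))).
  apply: (reach_le R).
  by move: Hd; move: (differing K) => d; clear; nia.
- rewrite -size_eq0 S2; by clear; lia.
- by rewrite nth_put eqxx Ec uval_xop // Hacc uval_xconst mulr1.
Qed.

End Program.

Lemma tidy_size NB LB m : tidy NB LB m -> size (mword m) <= NB * (2 * LB + 2).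
Proof.
case=> H1 _ H3; apply: (@leq_trans (size m * (2 * LB + 2))); last exact: leq_mul.
elim: m H3 {H1} => //= u m IH /andP[Hu Hm].
rewrite mword_cons size_cat /= /uword size_cat /= !size_map !size_rev.
by move: (IH Hm) Hu; rewrite /ulen mulSn; lia.
Qed.

Lemma size_ratios_word rs : size rs <= size (ratios_word rs).
Proof.
rewrite -[X in X <= _]count_commas; exact: count_size.
Qed.

Lemma ulen_unsigned rs : all (fun u => ulen u <= size (ratios_word rs)) (map unsigned rs).
Proof.
apply/(all_nthP u0) => i Hi.
have := size_nth_mword Hi; rewrite mword_unsigned size_filter => H.
apply: leq_trans (leq_trans H (count_size _ _)).
by rewrite /ulen; lia.
Qed.

(** At most [400 W^2] instructions, each simulated in time quadratic in the length
    [O(W^4)] of the memory word. *)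
Lemma polynomial_bounds A : exists c, forall K W n T B,
  0 < W -> K <= W -> n <= 100 * (K + 1) ^ 2 -> B <= 1464 * W ^ 4 ->
  T <= 20 * W + n * (5000 * (B + 1) ^ 2 + 5 * A + 2) + 2 * A + 20 * B + 23 ->
  n <= c * (6 * K + 1) ^ 10 + c /\ T <= c * W ^ 10 + c.
Proof.
(* Naming the constants keeps them from being evaluated in unary. *)
have [X HX] : exists X, X = 5000 * 1465 ^ 2 by eexists.
have [Y HY] : exists Y, Y = 20 * 1464 by eexists.
exists (20 + 400 * (X + 5 * A + 2) + 2 * A + Y + 123).
move=> K W n T B HW HK Hn HB HT; split.
  apply: (leq_trans Hn); apply: leq_trans (leq_addr _ _).
  apply: leq_mul; first by lia.
  apply: (@leq_trans ((6 * K + 1) ^ 2)); first by rewrite leq_exp2r; lia.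
  by rewrite leq_pexp2l; lia.
have P1 : 1 <= W ^ 10 by rewrite expn_gt0 HW.
have W1 : W <= W ^ 10 by rewrite -{1}(expn1 W) leq_pexp2l.
have W4 : W ^ 4 <= W ^ 10 by rewrite leq_pexp2l.
have HB2 : 5000 * (B + 1) ^ 2 <= X * W ^ 8.
  rewrite HX -mulnA leq_mul2l /=.
  have -> : W ^ 8 = (W ^ 4) ^ 2 by rewrite -expnM.
  rewrite -expnMn leq_exp2r //; apply: (@leq_trans (1464 * W ^ 4 + W ^ 4)).
    by apply: leq_add => //; rewrite expn_gt0 HW.
  by rewrite -[X in _ + X <= _]mul1n -mulnDl.
have Hn' : n <= 400 * W ^ 2.
  apply: (leq_trans Hn); apply: (@leq_trans (100 * (2 * W) ^ 2)).
    by rewrite leq_mul2l leq_exp2r //; lia.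
  by rewrite expnMn mulnA.
have P8 : 1 <= W ^ 8 by rewrite expn_gt0 HW.
have Hmain : n * (5000 * (B + 1) ^ 2 + 5 * A + 2) <= 400 * (X + 5 * A + 2) * W ^ 10.
  have -> : W ^ 10 = W ^ 2 * W ^ 8 by rewrite -expnD.
  rewrite mulnACA; apply: leq_mul => //.
  have up m : m <= m * W ^ 8 by rewrite leq_pmulr.
  by rewrite (mulnDl _ 2) (mulnDl X) !leq_add.
have HB' : 20 * B <= Y * W ^ 10.
  rewrite HY -mulnA leq_mul2l /=; apply: (leq_trans HB).
  by rewrite leq_mul2l W4.
apply: (leq_trans HT); apply: leq_trans (leq_addr _ _).
have up m : m <= m * W ^ 10 by rewrite leq_pmulr.
have H20 : 20 * W <= 20 * W ^ 10 by rewrite leq_mul2l W1.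
have H23 : 23 <= 123 * W ^ 10 by apply: leq_trans (up 123).
by rewrite (mulnDl _ 123) (mulnDl _ Y) (mulnDl _ (2 * A)) (mulnDl 20) !leq_add.
Qed.

(** * Transport to two points *)

Local Open Scope ring_scope.

Lemma sum_ord_lt g m : (\sum_(j < m) (j < g) = minn g m)%N.
Proof.
elim: m => [|m IH]; first by rewrite big_ord0 minn0.
by rewrite big_ord_recr /= IH; case: ltnP; lia.
Qed.

Lemma sum_ord_ge g m : (\sum_(j < m) (g <= j) = m - g)%N.
Proof.
elim: m => [|m IH]; first by rewrite big_ord0 sub0n.
by rewrite big_ord_recr /= IH; case: leqP; lia.
Qed.

Section TwoPointTransport.

Variables (R : realType) (I : finType) (K : nat).
Variables (mu : ddist R I 'rV[R]_K) (y1 y2 : 'rV[R]_K) (t : R).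
Variables (c : 'rV[R]_K -> 'rV[R]_K -> R) (com : I -> R) (G : I -> nat) (m : nat).
Hypothesis w_ge0 : forall i, 0 <= weight mu i.
Hypothesis w_sum : \sum_i weight mu i = 1.
Hypothesis t01 : 0 <= t <= 1.
Hypothesis G_le : forall i, (G i <= m)%N.
Hypothesis cost1 : forall i, c (atom mu i) y1 = com i + (G i)%:R.
Hypothesis cost2 : forall i, c (atom mu i) y2 = com i + (m - G i)%:R.

Local Notation w := (weight mu).
Let nu := two_point t y1 y2.

Definition mass_below (g : nat) : R := \sum_(i | (G i < g)%N) w i.

(** An atom of level [g] lies above [g] of the [m] layers and inside the other
    [m - g]. *)
Lemma cost_layers pi : coupling mu nu pi ->
  transport_cost c mu nu pi =
  \sum_i com i * w i +
  \sum_(j < m) (\sum_(i | (j < G i)%N) pi i true +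
                \sum_(i | (G i <= j)%N) pi i false).
Proof.
move=> [_ Hrow _]; rewrite big_split /=.
have layer (P : I -> nat -> bool) (f : I -> R) :
    \sum_(j < m) \sum_(i | P i j) f i = \sum_i (\sum_(j < m) (P i j))%N%:R * f i.
  under eq_bigr do rewrite big_mkcond.
  rewrite exchange_big; apply: eq_bigr => i _ /=.
  rewrite natr_sum mulr_suml; apply: eq_bigr => j _.
  by case: (P i j); rewrite ?mul1r ?mul0r.
have /= -> := layer (fun i j => (j < G i)%N) (fun i => pi i true).
have /= -> := layer (fun i j => (G i <= j)%N) (fun i => pi i false).
rewrite -!big_split /=; apply: eq_bigr => i _.
rewrite sum_ord_lt sum_ord_ge (minn_idPl (G_le i)) big_bool /= cost1 cost2.
by rewrite -(Hrow i) big_bool /=; ring.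
Qed.

Lemma coupling_layer pi j : coupling mu nu pi ->
  mass_below j.+1 - t =
  \sum_(i | (G i <= j)%N) pi i false - \sum_(i | (j < G i)%N) pi i true.
Proof.
move=> [_ Hrow Hcol]; have := Hcol true; rewrite /= => <-.
rewrite /mass_below (bigID (fun i => (G i <= j)%N) xpredT) /=.
under eq_bigr => i _ do rewrite -(Hrow i) big_bool.
rewrite big_split /=.
have -> : \sum_(i | ~~ (G i <= j)%N) pi i true = \sum_(i | (j < G i)%N) pi i true.
  by apply: eq_bigl => i; rewrite -ltnNge.
have -> : \sum_(i | (G i < j.+1)%N) pi i true = \sum_(i | (G i <= j)%N) pi i true by [].
have -> : \sum_(i | (G i < j.+1)%N) pi i false = \sum_(i | (G i <= j)%N) pi i false by [].
ring.
Qed.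

(** The two masses that a coupling pays in a layer are nonnegative and have a
    prescribed difference. *)
Lemma cost_lower pi : coupling mu nu pi ->
  \sum_i com i * w i + \sum_(j < m) `|mass_below j.+1 - t| <=
  transport_cost c mu nu pi.
Proof.
move=> Hpi; rewrite cost_layers // lerD2l; apply: ler_sum => j _.
rewrite (coupling_layer _ Hpi); have [H0 _ _] := Hpi.
apply: le_trans (ler_normB _ _) _.
by rewrite addrC !ger0_norm // sumr_ge0.
Qed.

Lemma mass_belowS g : mass_below g.+1 = mass_below g + \sum_(i | G i == g) w i.
Proof.
rewrite /mass_below (bigID (fun i => G i == g)) /= addrC; congr (_ + _).
  by apply: eq_bigl => i; rewrite ltnS ltn_neqAle andbC.
by apply: eq_bigl => i; rewrite ltnS andbC; case: eqP => // ->; rewrite leqnn.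
Qed.

(** The mass that the greedy coupling sends to the first point from the levels
    below [g]. *)
Definition fill (g : nat) : R := Num.min t (mass_below g).

(** The fraction of the mass at level [g] that goes to the first point. At a
    level without mass both differences vanish. *)
Definition share (g : nat) : R :=
  (fill g.+1 - fill g) / (mass_below g.+1 - mass_below g).

Lemma level_ge0 g : 0 <= \sum_(i | G i == g) w i.
Proof. exact: sumr_ge0. Qed.

Lemma share_level g : \sum_(i | G i == g) w i * share (G i) = fill g.+1 - fill g.
Proof.
rewrite (eq_bigr (fun i => w i * share g)); last by move=> i /eqP->.
rewrite -mulr_suml /share /fill mass_belowS [_ + _ - mass_below g]addrC addKr.
case: (eqVneq (\sum_(i | G i == g) w i) 0) => [->|H].
  by rewrite mul0r addr0 subrr.
by rewrite mulrC divfK.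
Qed.

Lemma share01 g : 0 <= share g <= 1.
Proof.
rewrite /share /fill mass_belowS [_ + _ - mass_below g]addrC addKr.
have := level_ge0 g; set p := \sum_(i | _) _; rewrite le_eqVlt => /orP[/eqP<-|Hp].
  by rewrite invr0 mulr0 lexx ler01.
rewrite divr_ge0 ?(ltW Hp) //= ?ler_pdivrMr ?mul1r //.
  by case: (leP t (mass_below g)) => ?; case: (leP t (mass_below g + p)) => ?; lra.
by case: (leP t (mass_below g)) => ?; case: (leP t (mass_below g + p)) => ?; lra.
Qed.

Lemma sum_share g : \sum_(i | (G i < g)%N) w i * share (G i) = fill g.
Proof.
elim: g => [|g IH].
  by rewrite /fill /mass_below !big_pred0 // min_r //; case/andP: t01.
rewrite (bigID (fun i => G i == g)) /= addrC.
rewrite (eq_bigl (fun i => (G i < g)%N)); last first.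
  by move=> i; rewrite ltnS ltn_neqAle andbC.
rewrite IH (eq_bigl (fun i => G i == g)); last first.
  by move=> i; rewrite ltnS andbC; case: eqP => // ->; rewrite leqnn.
by rewrite share_level addrC subrK.
Qed.

Definition greedy (i : I) (b : bool) : R :=
  if b then w i * share (G i) else w i * (1 - share (G i)).

Lemma sum_greedy : \sum_i w i * share (G i) = t.
Proof.
transitivity (\sum_(i | (G i < m.+1)%N) w i * share (G i)).
  by apply: eq_bigl => i; rewrite ltnS G_le.
rewrite sum_share /fill /mass_below.
rewrite (eq_bigl xpredT) ?w_sum; last by move=> i; rewrite ltnS G_le.
by rewrite min_l //; case/andP: t01.
Qed.

Lemma greedy_coupling : coupling mu nu greedy.
Proof.
split.
- move=> i [] /=; have /andP[H1 H2] := share01 (G i); rewrite mulr_ge0 ?subr_ge0 //.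
- by move=> i; rewrite big_bool /= -mulrDr addrC subrK mulr1.
- case=> /=; first exact: sum_greedy.
  under eq_bigr do rewrite mulrBr mulr1.
  by rewrite sumrB sum_greedy w_sum.
Qed.

(** In every layer one of the two masses vanishes, so the lower bound is
    attained. *)
Lemma greedy_cost :
  transport_cost c mu nu greedy =
  \sum_i com i * w i + \sum_(j < m) `|mass_below j.+1 - t|.
Proof.
rewrite (cost_layers greedy_coupling); congr (_ + _); apply: eq_bigr => j _ /=.
have E := coupling_layer j greedy_coupling; rewrite /= in E.
have H : \sum_(i | (G i <= j)%N) w i * (1 - share (G i)) = mass_below j.+1 - fill j.+1.
  rewrite -(sum_share j.+1) /mass_below -sumrB.
  by apply: eq_bigr => i _; rewrite mulrBr mulr1.
rewrite H in E *.
have -> : \sum_(i | (j < G i)%N) w i * share (G i) = t - fill j.+1.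
  by move: E; set a := \sum_(i | _) _; lra.
rewrite /fill; case: leP => H'.
  by rewrite ger0_norm ?subr_ge0 // subrr add0r.
by rewrite ltr0_norm ?subr_lt0 //; lra.
Qed.

Theorem two_point_ot :
  is_ot_distance c mu nu (\sum_i com i * w i + \sum_(j < m) `|mass_below j.+1 - t|).
Proof.
split; last exact: cost_lower.
by exists greedy; [exact: greedy_coupling | rewrite greedy_cost].
Qed.

End TwoPointTransport.

(** * The law of the level as a recursion *)

Definition coin (b : bool) : 'I_2 := if b then ord_max else ord0.

Lemma big_coin (V : nmodType) (f : 'I_2 -> V) :
  \sum_l f l = f (coin false) + f (coin true).
Proof. by rewrite big_ord_recl big_ord1; congr (_ + f _); apply: val_inj. Qed.

Section Value.

Variables (K : nat) (mem0 : seq urat) (prob : 'M[rat]_(K, 2)) (e1 e2 : 'I_K -> bool).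

Local Notation p_at := (p_at K mem0).
Local Notation agree := (agree K mem0).
Local Notation y2_one := (y2_one K mem0).
Local Notation cdf := (cdf K mem0).

Hypothesis p_atE : forall (k : 'I_K) b, p_at k b = prob k (coin b).
Hypothesis y1E : forall k : 'I_K, y1_at K mem0 k = (e1 k)%:R.
Hypothesis y2E : forall k : 'I_K, y2_at K mem0 k = (e2 k)%:R.
Hypothesis prob_sum : forall k, \sum_l prob k l = 1.

Lemma y2_oneE (k : 'I_K) : y2_one k = e2 k.
Proof. by rewrite /y2_one y2E; case: (e2 k); rewrite ?lexx ?lt_geF. Qed.

Lemma agreeE (k : 'I_K) : agree k = (e1 k == e2 k).
Proof. by rewrite /agree y1E y2E; case: (e1 k); case: (e2 k). Qed.

Definition toward2 k (l : 'I_2) : bool :=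
  (e1 k != e2 k) && ((l == 1%N :> nat) == e2 k).
Definition unavoidable k (l : 'I_2) : bool :=
  (e1 k == e2 k) && ((l == 1%N :> nat) != e2 k).

Definition level (i : {ffun 'I_K -> 'I_2}) : nat := \sum_k toward2 k (i k).
Definition ndiff : nat := \sum_k (e1 k != e2 k).

(** The generating polynomial of the contribution of coordinate [k] to the
    level. *)
Definition factor (k : nat) : {poly rat} :=
  if agree k then 1 else (1 - p_at k (y2_one k))%:P + p_at k (y2_one k) *: 'X.

Definition head_sum (P : {poly rat}) (j : nat) : rat := \sum_(i < j.+1) P`_i.

Lemma head_sum_factor (P : {poly rat}) a b j :
  head_sum (P * (a%:P + b *: 'X)) j =
  a * head_sum P j + if j is j'.+1 then head_sum P j' * b else 0.
Proof.
rewrite /head_sum mulrDr mulrC mul_polyC -scalerAr.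
under eq_bigr do rewrite coefD !coefZ coefMX.
rewrite big_split /= -!mulr_sumr; congr (_ + _).
rewrite big_ord_recl /= add0r; case: j => [|j]; first by rewrite big_ord0 mulr0.
by rewrite mulrC.
Qed.

Lemma cdf_head_sum k j : cdf k j = head_sum (\prod_(i < k) factor i) j.
Proof.
elim: k j => [|k IH] j.
  rewrite big_ord0 /head_sum big_ord_recl coef1 /= big1 ?addr0 // => i _.
  by rewrite coef1.
rewrite big_ord_recr /= /factor; case: (agree k); first by rewrite mulr1.
by rewrite head_sum_factor IH; case: j => // j; rewrite IH.
Qed.

Lemma factorE (k : 'I_K) : factor k = \sum_l prob k l *: 'X^(toward2 k l).
Proof.
have := prob_sum k; rewrite !big_coin => Hs.
have H0 : 1 - prob k (coin false) = prob k (coin true) by move: Hs; lra.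
have H1 : 1 - prob k (coin true) = prob k (coin false) by move: Hs; lra.
rewrite /factor agreeE y2_oneE p_atE /toward2.
case: (e1 k) (e2 k) => -[] /=; rewrite ?expr0 ?expr1 -?scalerDl ?Hs ?scale1r //.
  by rewrite H0 -alg_polyC addrC.
by rewrite H1 -alg_polyC.
Qed.

Lemma cdfE j :
  cdf K j = \sum_(i | (level i < j.+1)%N) \prod_k prob k (i k).
Proof.
rewrite cdf_head_sum /head_sum (eq_bigr _ (fun (k : 'I_K) _ => factorE k)).
rewrite bigA_distr_bigA /=.
under eq_bigr => n _ do rewrite coef_sum.
rewrite exchange_big [RHS]big_mkcond /=; apply: eq_bigr => i _.
have E : \prod_k (prob k (i k) *: 'X^(toward2 k (i k))) =
    (\prod_k prob k (i k)) *: 'X^(level i) :> {poly rat}.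
  by rewrite scaler_prod prodrXr.
under eq_bigr => n _ do rewrite E coefZ coefXn.
rewrite -mulr_sumr; case: ltnP => H.
  rewrite (bigD1 (Ordinal H)) //= eqxx [X in _ * (_ + X)]big1 ?addr0 ?mulr1 // => n /eqP Hn.
  by case: eqP => // En; case: Hn; apply: val_inj.
rewrite [X in _ * X]big1 ?mulr0 // => n _.
by rewrite ltn_eqF // (leq_trans (ltn_ord n)).
Qed.

(** Distribute the product of the marginals with one factor weighted by [h]; the
    others sum to 1. *)
Lemma marginal_sum k0 (h : 'I_2 -> rat) :
  \sum_(i : {ffun 'I_K -> 'I_2}) (\prod_k prob k (i k)) * h (i k0) =
  \sum_l prob k0 l * h l.
Proof.
transitivity (\sum_(i : {ffun 'I_K -> 'I_2})
    \prod_k (prob k (i k) * if k == k0 then h (i k) else 1)).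
  apply: eq_bigr => i _; rewrite big_split /=; congr (_ * _).
  by rewrite -big_mkcond big_pred1_eq.
rewrite -(bigA_distr_bigA (fun k l => prob k l * if k == k0 then h l else 1)).
rewrite (bigD1 k0) //= eqxx [X in _ * X]big1 ?mulr1 // => k /negPf->.
by under eq_bigr do rewrite mulr1.
Qed.

Lemma commonE :
  common K mem0 K =
  \sum_(i : {ffun 'I_K -> 'I_2}) (\sum_k unavoidable k (i k))%:R * \prod_k prob k (i k).
Proof.
have -> n : common K mem0 n =
    \sum_(k < n) if agree k then p_at k (~~ y2_one k) else 0.
  elim: n => [|n IH]; first by rewrite big_ord0.
  by rewrite big_ord_recr /= IH.
under [RHS]eq_bigr => i _ do rewrite natr_sum mulr_suml.
rewrite exchange_big; apply: eq_bigr => k _ /=.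
under eq_bigr => i _ do rewrite mulrC.
rewrite (marginal_sum k (fun l => (unavoidable k l)%:R)) big_coin.
rewrite agreeE y2_oneE p_atE /unavoidable.
by case: (e1 k) (e2 k) => -[] /=; rewrite ?mulr0 ?mulr1 ?addr0 ?add0r.
Qed.

Lemma differingE : differing K mem0 K = ndiff.
Proof.
have -> n : differing K mem0 n = (\sum_(k < n) ~~ agree k)%N.
  elim: n => [|n IH]; first by rewrite big_ord0.
  by rewrite big_ord_recr /= IH addnC.
by apply: eq_bigr => k _; rewrite agreeE.
Qed.

Lemma prob_total : \sum_(i : {ffun 'I_K -> 'I_2}) \prod_k prob k (i k) = 1.
Proof. by rewrite -bigA_distr_bigA big1. Qed.

End Value.

(** * The transport distance from the input numbers *)

Lemma enum_coin : enum 'I_2 = [:: coin false; coin true].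
Proof. by apply: (inj_map val_inj); rewrite val_enum_ord. Qed.

Lemma nth_pairs (T : eqType) (f : T -> 'I_2 -> rat) s d i (b : bool) : (i < size s)%N ->
  nth 0 [seq f k l | k <- s, l <- enum 'I_2] (2 * i + b)%N = f (nth d s i) (coin b).
Proof.
rewrite enum_coin; elim: s i => //= x s IH [|i] Hi; first by case: (b).
have -> : (2 * i.+1 + b = (2 * i + b).+2)%N by lia.
by rewrite /= IH.
Qed.

Section Layout.

Variables (K : nat) (supp prob : 'M[rat]_(K, 2)) (y1 y2 : 'rV[rat]_K) (t : rat).
Let a := @Instance K 2 supp prob y1 y2 t.

Lemma size_pairs (f : 'I_K -> 'I_2 -> rat) :
  size [seq f k l | k <- enum 'I_K, l <- enum 'I_2] = (2 * K)%N.
Proof.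
have H s : size [seq f k l | k <- s, l <- enum 'I_2] = (2 * size s)%N.
  by rewrite enum_coin; elim: s => //= k s ->; lia.
by rewrite H size_enum_ord.
Qed.

Lemma size_input : size (input_numbers a) = (6 * K + 1)%N.
Proof.
by rewrite /input_numbers /= !size_cat !size_pairs /= !(size_enum_ord, size_map); lia.
Qed.

Lemma nth_prob (k : 'I_K) (b : bool) :
  nth 0 (input_numbers a) (2 * K + 2 * k + b) = prob k (coin b).
Proof.
rewrite /input_numbers /= nth_cat size_pairs -addnA ltnNge leq_addr /= addKn.
rewrite nth_cat size_pairs; have Hk := ltn_ord k.
have -> : (2 * k + b < 2 * K)%N by case: b; lia.
by rewrite (nth_pairs _ k) ?size_enum_ord // nth_ord_enum.
Qed.

Lemma nth_pt1 (k : 'I_K) : nth 0 (input_numbers a) (4 * K + k) = y1 0 k.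
Proof.
have Hk := ltn_ord k.
rewrite /input_numbers /= !nth_cat !size_pairs !(size_enum_ord, size_map).
have -> : (4 * K + k < 2 * K)%N = false by lia.
have -> : (4 * K + k - 2 * K < 2 * K)%N = false by lia.
have -> : (4 * K + k - 2 * K - 2 * K = k)%N by lia.
by rewrite Hk (nth_map k) ?size_enum_ord // nth_ord_enum.
Qed.

Lemma nth_pt2 (k : 'I_K) : nth 0 (input_numbers a) (5 * K + k) = y2 0 k.
Proof.
have Hk := ltn_ord k.
rewrite /input_numbers /= !nth_cat !size_pairs !(size_enum_ord, size_map).
have -> : (5 * K + k < 2 * K)%N = false by lia.
have -> : (5 * K + k - 2 * K < 2 * K)%N = false by lia.
have -> : (5 * K + k - 2 * K - 2 * K < K)%N = false by lia.
have -> : (5 * K + k - 2 * K - 2 * K - K = k)%N by lia.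
by rewrite Hk (nth_map k) ?size_enum_ord // nth_ord_enum.
Qed.

Lemma nth_mass : nth 0 (input_numbers a) (6 * K) = t.
Proof.
rewrite /input_numbers /= !nth_cat !size_pairs !(size_enum_ord, size_map).
have -> : (6 * K < 2 * K)%N = false by lia.
have -> : (6 * K - 2 * K < 2 * K)%N = false by lia.
have -> : (6 * K - 2 * K - 2 * K < K)%N = false by lia.
have -> : (6 * K - 2 * K - 2 * K - K < K)%N = false by lia.
by have -> : (6 * K - 2 * K - 2 * K - K - K = 0)%N by lia.
Qed.

Variables (R : realType) (e1 e2 : 'I_K -> bool) (mem0 : seq urat).
Hypothesis suppE : forall k l, supp k l = (l == 1%N :> nat)%:R.
Hypothesis y1E : forall k, y1 0 k = (e1 k)%:R.
Hypothesis y2E : forall k, y2 0 k = (e2 k)%:R.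
Hypothesis mem0E : map uval mem0 = input_numbers a.
Hypothesis a_ok : well_formed a.

Local Notation level := (level e1 e2).
Local Notation unavoidable := (unavoidable e1 e2).

Lemma input_valE i : input_val mem0 i = nth 0 (input_numbers a) i.
Proof. by rewrite -mem0E nth_uval. Qed.

Lemma atomE (i : {ffun 'I_K -> 'I_2}) k : atom (mu_of R a) i 0 k = (i k == 1%N :> nat)%:R.
Proof. by rewrite mxE /= suppE rmorph_nat. Qed.

Lemma weightE (i : {ffun 'I_K -> 'I_2}) :
  weight (mu_of R a) i = ratr (\prod_k prob k (i k)).
Proof. by rewrite /= rmorph_prod. Qed.

Lemma sq_distE (x y : 'rV[R]_K) : sq_dist x y = \sum_k (x 0 k - y 0 k) ^+ 2.
Proof.
rewrite /sq_dist /enorm sqr_sqrtr; last by apply: sumr_ge0 => k _; exact: sqr_ge0.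
by apply: eq_bigr => k _; rewrite !mxE.
Qed.

Lemma ot_distance_value :
  is_ot_distance (@sq_dist R K) (mu_of R a) (nu_of R a)
    (ratr (common K mem0 K + deviation K mem0 (differing K mem0 K))).
Proof.
have [w0 w1 /andP[t0 t1]] := a_ok; rewrite /= in w0 w1 t0 t1.
have p_atE (k : 'I_K) b : p_at K mem0 k b = prob k (coin b).
  by rewrite /p_at input_valE nth_prob.
have y1_atE (k : 'I_K) : y1_at K mem0 k = (e1 k)%:R.
  by rewrite /y1_at input_valE nth_pt1.
have y2_atE (k : 'I_K) : y2_at K mem0 k = (e2 k)%:R.
  by rewrite /y2_at input_valE nth_pt2.
have level_le i : (level i <= ndiff e1 e2)%N.
  by apply: leq_sum => k _; rewrite /toward2; case: (e1 k != e2 k) => //=; case: (_ == _).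
have cost (i : {ffun 'I_K -> 'I_2}) (y : 'rV[rat]_K) (e : 'I_K -> bool) :
    (forall k, y 0 k = (e k)%:R) ->
    sq_dist (atom (mu_of R a) i) (map_mx ratr y) =
    (\sum_k ((i k == 1%N :> nat) != e k))%N%:R.
  move=> Hy; rewrite sq_distE natr_sum; apply: eq_bigr => k _.
  rewrite atomE mxE Hy rmorph_nat.
  case: (nat_of_ord (i k) == 1%N); case: (e k); by rewrite /= ?subrr ?expr0n ?sub0r ?subr0 ?sqrrN ?expr1n.
have cost1 (i : {ffun 'I_K -> 'I_2}) : sq_dist (atom (mu_of R a) i) (map_mx ratr y1) =
    (\sum_k unavoidable k (i k))%N%:R + (level i)%:R.
  rewrite (cost i y1 e1 y1E) -natrD -big_split; congr _%:R; apply: eq_bigr => k _ /=.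
  rewrite /unavoidable /toward2.
  by case: (nat_of_ord (i k) == 1%N); case: (e1 k); case: (e2 k).
have cost2 (i : {ffun 'I_K -> 'I_2}) : sq_dist (atom (mu_of R a) i) (map_mx ratr y2) =
    (\sum_k unavoidable k (i k))%N%:R + (ndiff e1 e2 - level i)%:R.
  rewrite (cost i y2 e2 y2E) -natrD; congr _%:R; apply/eqP.
  rewrite -(eqn_add2r (level i)) -addnA subnK // -!big_split /=; apply/eqP.
  apply: eq_bigr => k _ /=; rewrite /unavoidable /toward2.
  by case: (nat_of_ord (i k) == 1%N); case: (e1 k); case: (e2 k).
have w_ge0 (i : {ffun 'I_K -> 'I_2}) : 0 <= weight (mu_of R a) i.
  by rewrite weightE ler0q prodr_ge0 // => k _; exact: w0.
have w_sum : \sum_(i : {ffun 'I_K -> 'I_2}) weight (mu_of R a) i = 1.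
  under eq_bigr do rewrite weightE.
  by rewrite -rmorph_sum (prob_total w1) rmorph1.
have t01 : 0 <= (ratr t : R) <= 1 by rewrite ler0q t0 /= -[1](@ratr_nat R 1) ler_rat.
have := @two_point_ot R _ K (mu_of R a) (map_mx ratr y1) (map_mx ratr y2) (ratr t)
  (@sq_dist R K) (fun i => (\sum_k unavoidable k (i k))%N%:R) level (ndiff e1 e2)
  w_ge0 w_sum t01 level_le cost1 cost2.
congr is_ot_distance; rewrite rmorphD /=; congr (_ + _).
  rewrite (commonE p_atE y1_atE y2_atE w1) rmorph_sum; apply: eq_bigr => i _ /=.
  by rewrite rmorphM /= rmorph_nat rmorph_prod.
rewrite (differingE y1_atE y2_atE) /deviation rmorph_sum; apply: eq_bigr => j _ /=.
rewrite ratr_norm rmorphB /= /t_val input_valE nth_mass.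
congr `|_ - _|; rewrite /mass_below (cdfE p_atE y1_atE y2_atE w1) rmorph_sum.
by apply: eq_bigr => i _ /=; rewrite rmorph_prod.
Qed.

End Layout.

Theorem corollary4p6 (R : realType) :
  strongly_polynomial input_numbers
    (fun a : instance =>
      [/\ well_formed a,
          exists (n : nat) (N : set R), regular_grid n N /\ spans (M_of a) N,
          dimL a = 2%N /\
          (forall k (l : 'I_(dimL a)),
             (nat_of_ord l = 0%N -> supp a k l = 0) /\
             (nat_of_ord l = 1%N -> supp a k l = 1))
        & forall k, (pt1 a 0 k = 0 \/ pt1 a 0 k = 1) /\
                    (pt2 a 0 k = 0 \/ pt2 a 0 k = 1)])
    (fun a r =>
      is_ot_distance (@sq_dist R (dimK a)) (mu_of R a) (nu_of R a) (ratr r)).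
Proof.
have [c Hc] := polynomial_bounds (size ot_program).
(* Variables in place of the program and the machine keep simplification from
   unfolding them. *)
have [P EP] : exists P, P = map erase ot_program by eexists.
have [M EM] : exists M, M = simulator_machine 15 ot_program by eexists.
exists P, M, c, 10%N.
case=> K L supp prob y1 y2 t /= [Ha [gn [N [_ [_ [x [[[k0 _] _] _]] _]]]] [HL Hsupp] Hy].
move=> w [rs [Hrs Enum Ew]]; subst L.
pose e1 (k : 'I_K) := y1 0 k == 1; pose e2 (k : 'I_K) := y2 0 k == 1.
have y1E k : y1 0 k = (e1 k)%:R.
  by rewrite /e1; have [[->|->] _] := Hy k.
have y2E k : y2 0 k = (e2 k)%:R.
  by rewrite /e2; have [_ [->|->]] := Hy k.
have suppE k (l : 'I_2) : supp k l = (l == 1%N :> nat)%:R.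
  have [H0 H1] := Hsupp k l; case: l H0 H1 => -[|[|l]] Hl //= H0 H1.
    by rewrite H0.
  by rewrite H1.
have Hpos r : r \in rs -> 0 <= ratio_value r.
  move=> Hr; have : ratio_value r \in input_numbers (Instance supp prob y1 y2 t).
    by rewrite Enum map_f.
  have [w0 _ /andP[t0 _]] := Ha.
  rewrite /input_numbers !mem_cat mem_seq1 => /or4P[].
  - by case/allpairsP => -[k l] [_ _ ->]; rewrite /= suppE ler0n.
  - by case/allpairsP => -[k l] [_ _ ->]; exact: w0.
  - by case/mapP => k _ ->; rewrite /= y1E ler0n.
  - by case/orP => [/mapP[k _ ->]|/eqP->]; rewrite //= y2E ler0n.
have [mem0E mem0_ok] := ratio_values_unsigned Hrs Hpos.
rewrite -Enum in mem0E.
have Hsz : size rs = (6 * K + 1)%N by rewrite -(size_input supp prob y1 y2 t) Enum size_map.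
set W := size w.
have EW : W = size (ratios_word rs) by rewrite /W Ew.
have HKW : (6 * K + 1 <= W)%N by rewrite -Hsz EW size_ratios_word.
(* A set that spans a grid has a minimum, hence an element: there is a
   coordinate. *)
have K_gt0 : (0 < K)%N := leq_ltn_trans (leq0n k0) (ltn_ord k0).
have KW : (K <= W)%N by move: HKW; clear; lia.
have len0 := ulen_unsigned rs; rewrite -EW in len0.
have psum k : (k < K)%N ->
    p_at K (map unsigned rs) k false + p_at K (map unsigned rs) k true = 1.
  move=> Hk; have [_ w1 _] := Ha; rewrite -(w1 (Ordinal Hk)) big_coin.
  by rewrite /p_at !(input_valE mem0E) -!(nth_prob supp prob y1 y2 t (Ordinal Hk)).
have sz0 : size (map unsigned rs) = (6 * K + 1)%N by rewrite size_map.
have [z [[n Hn [Hrun Hz]] Hpc [Hidx Htidy] Hne Hval]] :=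
  ot_program_correct K_gt0 KW sz0 mem0_ok len0 psum.
set B := ((6 * K + 6) * (2 * (60 * W ^ 3) + 2))%N.
have Hxr i : xrun ot_program rs i =
    iter i (xstep ot_program) (XState 0 [:: (6 * K + 1)%N] (map unsigned rs)).
  by rewrite /xrun Hsz.
have Hsmall r m : all (fun i => (i <= 6 * K + 6)%N) r -> tidy (6 * K + 6) (60 * W ^ 3) m ->
    small B r m.
  move=> Hr Hm; split; last exact: tidy_size.
  move=> j; apply: (@leq_trans (6 * K + 6)%N); last by rewrite leq_pmulr // addn2.
  case: (ltnP j (size r)) => Hj; last by rewrite nth_default.
  exact: (all_nthP 0%N Hr).
have [T [HT Hh Hc0 Hout Hex]] : exists T : nat,
    [/\ (T <= 20 * size (ratios_word rs) +
              n * (5000 * (B + 1) ^ 2 + 5 * size ot_program + 2) +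
              2 * size ot_program + 20 * B + 23)%N,
        ram_halted P (ram_run P (map ratio_value rs) n),
        nth 0 (cells (ram_run P (map ratio_value rs) n)) 0%N =
          uval (nth u0 (xmem z) 0),
        tm_final (tm_run M (ratios_word rs) T).1 /\
        (exists2 v, encodes v [:: uval (nth u0 (xmem z) 0)]
           & tape_holds ((tm_run M (ratios_word rs) T).2 ord_max) v) &
        executes M (ratios_word rs) T P (map ratio_value rs) n].
  rewrite EM EP.
  have -> : z = xrun ot_program rs n by rewrite Hxr Hz.
  apply: simulation_executes => //; rewrite ?Hxr ?Hz ?Hpc //.
  - by move=> i Hi; rewrite Hxr; have [H1 H2 H3 H4] := Hrun i Hi; split=> //; exact: Hsmall.
  - exact: Hsmall.
have W_gt0 : (0 < W)%N := leq_trans K_gt0 KW.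
have HB : (B <= 1464 * W ^ 4)%N.
  have W3 : (1 <= W ^ 3)%N by rewrite expn_gt0 W_gt0.
  have -> : (1464 * W ^ 4 = (12 * W) * (122 * W ^ 3))%N by rewrite mulnACA -expnS.
  apply: leq_mul; first by move: KW W_gt0; clear; lia.
  by move: (W ^ 3)%N W3 => W3; clear; lia.
rewrite -EW in HT; have [c1 c2] := Hc K W n T B W_gt0 KW Hn HB HT.
exists n, T, (uval (nth u0 (xmem z) 0)).
rewrite Enum size_map Hsz -/W Ew; split=> //.
by rewrite Hval; exact: (ot_distance_value R suppE y1E y2E mem0E Ha).
Qed.
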